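(* Let $p\ge2$. A circle is a stationary point of $\mathscr{E}_p$. That is: let $m\in\mathbb{R}^3$, $r>0$, let $u,v\in\mathbb{R}^3$ be orthonormal, and let $\gamma(x)=m+r(\cos(x)\,u+\sin(x)\,v)$; then $\delta\mathscr{E}_p(\gamma,\Phi)=0$ for every $\Phi\in X_p$. In particular, a circle is a stationary point of $\mathscr{M}_3$.
   Context: Functions on $\mathbb{R}/2\pi\mathbb{Z}$ are $2\pi$-periodic functions on $\mathbb{R}$. For a closed, simple ($\gamma(s)\neq\gamma(t)$ whenever $s-t\notin2\pi\mathbb{Z}$) and regular ($\gamma'$ never zero) $C^1$ curve $\gamma:\mathbb{R}/2\pi\mathbb{Z}\to\mathbb{R}^3$ put $$c_\gamma(s,t,\sigma):=\frac{2\,|(\gamma(t)-\gamma(s))\wedge(\gamma(\sigma)-\gamma(s))|}{|\gamma(t)-\gamma(s)|\,|\gamma(s)-\gamma(\sigma)|\,|\gamma(\sigma)-\gamma(t)|}$$ (with $\wedge$ the cross product; defined off the null set where two arguments differ by an element of $2\pi\mathbb{Z}$), $$\mathscr{M}_p(\gamma):=\int_0^{2\pi}\int_0^{2\pi}\int_0^{2\pi}c_\gamma(s,t,\sigma)^p\,|\gamma'(s)|\,|\gamma'(t)|\,|\gamma'(\sigma)|\,d\sigma\,dt\,ds,\qquad \mathscr{L}(\gamma):=\int_0^{2\pi}|\gamma'(x)|\,dx,$$ $$\mathscr{E}_p(\gamma):=\mathscr{M}_p(\gamma)^{\frac1p}\,\mathscr{L}(\gamma)^{\frac{p-3}{p}}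 .$$ In particular $\mathscr{E}_3=\mathscr{M}_3^{1/3}$. The first variation of a functional $E$ at $\gamma$ in direction $\Phi$ is $\delta E(\gamma,\Phi):=\frac{d}{d\tau}\big|_{\tau=0}E(\gamma+\tau\Phi)$, and $\gamma$ is a stationary point of $E$ if $\delta E(\gamma,\Phi)=0$ for every admissible $\Phi$. Admissible directions: for $p>3$, $X_p:=W^{2-\frac2p,p}(\mathbb{R}/2\pi\mathbb{Z},\mathbb{R}^3)$, the space of all $\Phi\in W^{1,p}(\mathbb{R}/2\pi\mathbb{Z},\mathbb{R}^3)$ with $\int_0^{2\pi}\int_{-\pi}^{\pi}\frac{|\Phi'(x+w)-\Phi'(x)|^p}{|w|^{p-1}}\,dw\,dx<\infty$; for $p\in[2,3]$, $X_p:=C^{1,\alpha}(\mathbb{R}/2\pi\mathbb{Z},\mathbb{R}^3)$ with any fixed $\alpha\in(1-\frac2p,1]$. For these $\Phi$, $\gamma+\tau\Phi$ is simple and regular for small $|\tau|$ and the first variations of $\mathscr{M}_p$ and $\mathscr{E}_p$ exist. *)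

(* Defs.v *)
From HB Require Import structures.
From mathcomp Require Import all_boot all_order all_algebra.
From mathcomp Require Import all_classical all_reals all_analysis.

Set Implicit Arguments.
Unset Strict Implicit.
Unset Printing Implicit Defensive.

Import Order.TTheory GRing.Theory Num.Theory.
Import numFieldNormedType.Exports.

Local Open Scope classical_set_scope.
Local Open Scope ring_scope.

Section MengerCurvature.
Variable R : realType.

Notation R3 := 'rV[R]_3.
Notation twopi := (pi *+ 2 : R).
Notation mu := (@lebesgue_measure R).

(* The library norm `|u| on row vectors is the sup norm, hence [enorm]. *)
Definition dot (u v : R3) : R := \sum_(i < 3) u 0 i * v 0 i.

Definition enorm (u : R3) : R := Num.sqrt (dot u u).

(* Indices are taken in 'I_3 with the cyclic addition of Z/3Z. *)
Definition cross (u v : R3) : R3 :=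
  \row_(i < 3) (u 0 (i + 1) * v 0 (i + 2%:R) - u 0 (i + 2%:R) * v 0 (i + 1)).

(* Curves on R/2piZ are functions on R of period twopi. The quotient below
   takes the junk value 0 where two of the arguments differ by a multiple of
   2 pi, which is a null set. *)
Definition menger_c (gamma : R -> R3) (s t sigma : R) : R :=
  2 * enorm (cross (gamma t - gamma s) (gamma sigma - gamma s)) /
  (enorm (gamma t - gamma s) * enorm (gamma s - gamma sigma) *
   enorm (gamma sigma - gamma t)).

Definition speed (gamma : R -> R3) (x : R) : R := enorm (derive1 gamma x).

Definition menger_energy (p : R) (gamma : R -> R3) : \bar R :=
  (\int[mu]_(s in `[0%R, twopi]) \int[mu]_(t in `[0%R, twopi])
     \int[mu]_(sigma in `[0%R, twopi])
       (menger_c gamma s t sigma `^ p *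
        speed gamma s * speed gamma t * speed gamma sigma)%R%:E)%E.

Definition curve_length (gamma : R -> R3) : \bar R :=
  (\int[mu]_(x in `[0%R, twopi]) (speed gamma x)%:E)%E.

Definition scaled_energy (p : R) (gamma : R -> R3) : \bar R :=
  (menger_energy p gamma `^ p^-1 * curve_length gamma `^ ((p - 3) / p))%E.

(* The derivative at tau = 0 of E (gamma + tau Phi) exists and equals l; the
   finiteness clause ensures that [fine] loses no information. *)
Definition is_first_variation (E : (R -> R3) -> \bar R) (gamma Phi : R -> R3)
    (l : R) : Prop :=
  let Etau := fun tau : R => E (fun x => gamma x + tau *: Phi x) in
  (\forall tau \near (0 : R), Etau tau \is a fin_num) /\
  is_derive (0 : R) (1 : R) (fun tau : R => fine (Etau tau)) l.

Definition stationary (E : (R -> R3) -> \bar R) (X : set (R -> R3))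
    (gamma : R -> R3) : Prop :=
  forall Phi, X Phi -> is_first_variation E gamma Phi 0.

Definition holder_C1 (alpha : R) : set (R -> R3) :=
  [set Phi | [/\ periodic Phi twopi,
     forall x, derivable Phi x 1 &
     exists C : R, forall x y,
       enorm (derive1 Phi x - derive1 Phi y) <= C * `|x - y| `^ alpha]].

Definition in_Lp (p : R) (f : R -> R3) : Prop :=
  [/\ periodic f twopi,
    forall i, measurable_fun [set: R] (fun x => f x 0 i) &
    (\int[mu]_(x in `[0%R, twopi]) (enorm (f x) `^ p)%:E < +oo)%E].

Definition test_function (phi : R -> R) : Prop :=
  periodic phi twopi /\ forall n x, derivable (derive1n n phi) x 1.

Definition weak_derivative (f g : R -> R3) : Prop :=
  forall phi, test_function phi -> forall i,
    \int[mu]_(x in `[0, twopi]) (f x 0 i * derive1 phi x) =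
    - \int[mu]_(x in `[0, twopi]) (g x 0 i * phi x).

(* The p-th power of the Slobodeckii seminorm of order 1 - 2/p. *)
Definition slobodeckii (p : R) (g : R -> R3) : \bar R :=
  (\int[mu]_(x in `[0%R, twopi]) \int[mu]_(w in `[(- pi)%R, pi%R])
     (enorm (g (x + w) - g x) `^ p / `|w| `^ (p - 1))%R%:E)%E.

(* W^{2-2/p,p}, an element being given by its continuous representative. *)
Definition sobolev_slobodeckii (p : R) : set (R -> R3) :=
  [set Phi | [/\ continuous Phi, in_Lp p Phi &
     exists g, [/\ in_Lp p g, weak_derivative Phi g &
                   (slobodeckii p g < +oo)%E]]].

(* The Hoelder exponent alpha is only relevant for p <= 3. *)
Definition admissible (p alpha : R) : set (R -> R3) :=
  if 3 < p then sobolev_slobodeckii p else holder_C1 alpha.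

Definition circle (m u v : R3) (r : R) (x : R) : R3 :=
  m + r *: (cos x *: u + sin x *: v).

End MengerCurvature.

(* Main.v *)
Require Import Defs.
From HB Require Import structures.
From mathcomp Require Import all_boot all_order all_algebra.
From mathcomp Require Import all_classical all_reals all_analysis.
From mathcomp Require Import measurable_realfun.
From mathcomp Require Import ring lra.
Set Implicit Arguments.
Unset Strict Implicit.
Unset Printing Implicit Defensive.
Import Order.TTheory GRing.Theory Num.Theory.
Import numFieldNormedType.Exports.
Local Open Scope classical_set_scope.
Local Open Scope ring_scope.

(** Every triangle inscribed in the circle has circumradius r, so off a null set the integrand of
    [menger_energy] at the circle is the constant E0 = r^(-p) r^3. In the variables t = s + a, x = s
    + b, the integrand of gamma + tau Phi is E0 (1 + tau V(s, a, b)) plus a remainder, V being a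
    logarithmic derivative ([edge_variation]). For fixed a and b, integrating V over s only sees the
    average of Phi over the rotations of the circle. This average is a sum of an infinitesimal
    rotation, a translation along the axis and a dilation. Only the dilation counts, and it changes
    curvature with weight -1 and each of the three line elements with weight +1. Accordingly
    [average_variation] finds (3 - p) W / r whatever a and b are, where W is the integral of Phi
    against the outward normal.

    Hence M(tau) = E0 ((2 pi)^3 + tau (3 - p) (2 pi)^2 W / r) + O(tau^2) by [energy_expansion], and
    L(tau) = 2 pi r + tau W + O(tau^2) by [length_expansion]. The logarithmic derivatives at 0 are
    (3 - p) W / (2 pi r) and W / (2 pi r). With the exponents 1/p and (p - 3)/p of the scaled energy
    they cancel; for p = 3 the derivative of M already vanishes.

    The analytic work is to show that the remainder integrates to O(tau^2). The sides and speeds are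
    harmless, since Phi is Lipschitz. The area factor is not, because the variation of A /\ B may be
    large compared with A /\ B for small triangles. By symmetry only triangles whose longest side is
    opposite the base point s are considered ([ge0_integral3_dominates]). There the relative
    variation is bounded by a constant times Z = 1 + (D(a) + D(b)) / (|a| + |b|), with D(a) the
    distance of the secant slope of Phi over [s, s + a] from Phi'(s), and the remainder is at most C
    Z^p tau^2 ([circle_remainder_le]). A Jensen type bound for D(a)^p ([quotient_error_powR]) and a
    Hardy inequality ([hardy_integral]) control the integral of Z^p by the Slobodeckii seminorm of
    Phi'.

    It remains to see that every admissible Phi is C^1 with Phi' of finite seminorm. For Hoelder
    directions this is integrability of |w|^q for q > -1. For p > 3, testing the weak derivative
    against smoothed indicators gives the fundamental theorem of calculus for Phi. A Campanato
    argument then upgrades the seminorm bound to a continuous derivative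
    ([sobolev_slobodeckii_C1]). *)

(** * Derivatives of functions of one real variable *)

Section PointwiseDerivatives.
Context {R : realType}.
Implicit Types (f g : R -> R) (x a b k : R).

Lemma is_derive_add f g x a b : is_derive x 1 f a -> is_derive x 1 g b ->
  is_derive x 1 (fun y => f y + g y) (a + b).
Proof. exact: is_deriveD. Qed.

Lemma is_derive_opp f x a : is_derive x 1 f a -> is_derive x 1 (fun y => - f y) (- a).
Proof. exact: is_deriveN. Qed.

Lemma is_derive_sub f g x a b : is_derive x 1 f a -> is_derive x 1 g b ->
  is_derive x 1 (fun y => f y - g y) (a - b).
Proof. exact: is_deriveB. Qed.

Lemma is_derive_mul f g x a b : is_derive x 1 f a -> is_derive x 1 g b ->
  is_derive x 1 (fun y => f y * g y) (a * g x + f x * b).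
Proof. by move=> fa gb; rewrite addrC [a * _]mulrC; exact: is_deriveM. Qed.

Lemma is_derive_scale f k x a : is_derive x 1 f a ->
  is_derive x 1 (fun y => k * f y) (k * a).
Proof. exact: is_deriveZ. Qed.

Lemma is_derive_comp f g x a b : is_derive (g x) 1 f a -> is_derive x 1 g b ->
  is_derive x 1 (fun y => f (g y)) (a * b).
Proof. exact: is_derive1_comp. Qed.

Lemma is_derive_continuous f x a : is_derive x 1 f a -> {for x, continuous f}.
Proof. by move=> [fx _]; exact/differentiable_continuous/derivable1_diffP. Qed.

Lemma is_derive_eq1 f x a b : is_derive x 1 f a -> a = b -> is_derive x 1 f b.
Proof. by move=> ? <-. Qed.

Lemma is_derive_rV n (F : R -> 'rV[R]_n) x (d : 'rV[R]_n) :
  (forall i, is_derive x 1 (fun y => F y 0 i) (d 0 i)) -> is_derive x 1 F d.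
Proof.
move=> h; have dF : derivable F x 1.
  by apply/derivable_mxP => i j; rewrite (ord1 i); have [] := h j.
apply: DeriveDef => //; rewrite derive_mx//.
by apply/rowP => i; rewrite mxE; have [_ ->] := h i.
Qed.

Lemma is_derive_coord n (F : R -> 'rV[R]_n) x (d : 'rV[R]_n) i :
  is_derive x 1 F d -> is_derive x 1 (fun y => F y 0 i) (d 0 i).
Proof.
move=> [dF dFE]; apply: DeriveDef; first by have /derivable_mxP := dF; exact.
by rewrite -dFE derive_mx// mxE.
Qed.

End PointwiseDerivatives.

(** * Translation invariance, integrals over a period, exchange of integrals *)

Section Tonelli.
Local Open Scope ereal_scope.
Context {R : realType}.
Notation mu := (@lebesgue_measure R).

(** The pushforward under the translation has the right value on half-open intervals, and Lebesgue
    measure is the only measure with these values. *)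
Lemma lebesgue_measure_shift (c : R) (A : set R) : measurable A ->
  pushforward mu ((fun x => x + c)%R : _ -> measurableTypeR R) A = mu A.
Proof.
move=> mA.
have mc : measurable_fun [set: measurableTypeR R]
    ((fun x => x + c)%R : _ -> measurableTypeR R) by exact: measurable_funD.
pose m := isMeasurableFun.Build _ _ _ _ _ mc.
pose f : {mfun measurableTypeR R >-> measurableTypeR R} :=
  HB.pack ((fun x => x + c)%R : _ -> measurableTypeR R) m.
apply/esym/(@lebesgue_measure_unique R (pushforward mu f)) => //= _ [[a b]] _ <-.
rewrite /pushforward/= (_ : _ @^-1` _ = `](a - c)%R, (b - c)%R]%classic); last first.
  by apply/seteqP; split=> x /=; rewrite !in_itv/= ltrBlDr lerBrDr.
rewrite !lebesgue_measure_itv/= !lte_fin ltrD2r.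
by case: ifPn => // _; rewrite -!EFinB; congr EFin; ring.
Qed.

Lemma ge0_integral_shift (c : R) (D : set R) (f : R -> \bar R) :
  measurable D -> measurable_fun [set: R] f -> (forall x, 0 <= f x) ->
  \int[mu]_(x in D) f x = \int[mu]_(x in (fun x => x + c)%R @^-1` D) f (x + c)%R.
Proof.
move=> mD mf f0.
have mc : measurable_fun [set: measurableTypeR R]
    ((fun x => x + c)%R : _ -> measurableTypeR R) by exact: measurable_funD.
rewrite -(ge0_integral_pushforward mc mu (D := D) (f := f))//; last exact: measurable_funTS.
by apply: eq_measure_integral => //= A mA AS; exact/esym/lebesgue_measure_shift.
Qed.

Lemma ge0_integral_itv_shift (c a b : R) (f : R -> \bar R) :
  measurable_fun [set: R] f -> (forall x, 0 <= f x) ->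
  \int[mu]_(x in `[(a + c)%R, (b + c)%R]) f x = \int[mu]_(x in `[a, b]) f (x + c)%R.
Proof.
move=> mf f0; rewrite (ge0_integral_shift c)//; congr integral.
by apply/seteqP; split=> x /=; rewrite !in_itv/= !lerD2r.
Qed.

Lemma ge0_integral_itv_split (a b c : R) (f : R -> \bar R) :
  (a <= b)%R -> (b <= c)%R ->
  measurable_fun [set: R] f -> (forall x, 0 <= f x) ->
  \int[mu]_(x in `[a, c]) f x =
  \int[mu]_(x in `[a, b]) f x + \int[mu]_(x in `[b, c]) f x.
Proof.
move=> ab bc mf f0.
rewrite -(@integral_itv_obnd_cbnd _ b (BRight c)); last exact: measurable_funTS.
rewrite -ge0_integral_setU//=.
- by rewrite -itv_bndbnd_setU.
- exact: measurable_funTS.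
- by apply: lt_disjoint => x y /=; rewrite !in_itv/= => /andP[_ xb] /andP[bx _]; exact: le_lt_trans bx.
Qed.

(** The shifted window [c, T + c] is cut at T, and its part beyond T is moved back by one period to
    [0, c]. *)
Let ge0_periodic_shift0 (T c : R) (f : R -> \bar R) : (0 <= c <= T)%R ->
  measurable_fun [set: R] f -> (forall x, 0 <= f x) ->
  (forall x, f (x + T)%R = f x) ->
  \int[mu]_(x in `[0%R, T]) f (x + c)%R = \int[mu]_(x in `[0%R, T]) f x.
Proof.
move=> /andP[c0 cT] mf f0 fT.
rewrite -ge0_integral_itv_shift// add0r.
rewrite (@ge0_integral_itv_split c T)//; last by rewrite lerDl.
rewrite (@ge0_integral_itv_split 0%R c T)// addeC; congr (_ + _).
rewrite -[in X in `[X, _]](add0r T) [in X in `[_, X]](addrC T c) ge0_integral_itv_shift//.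
by under eq_integral do rewrite fT.
Qed.

(** A general shift is reduced modulo T, by an integer part, to one in [0, T]. *)
Lemma ge0_periodic_integral_shift (T c : R) (f : R -> \bar R) : (0 < T)%R ->
  measurable_fun [set: R] f -> (forall x, 0 <= f x) ->
  (forall x, f (x + T)%R = f x) ->
  \int[mu]_(x in `[0%R, T]) f (x + c)%R = \int[mu]_(x in `[0%R, T]) f x.
Proof.
move=> T0 mf f0 fT.
have fTn n x : f (x + T *+ n)%R = f x.
  by elim: n x => [|n IH] x; rewrite ?mulr0n ?addr0// mulrS addrA IH fT.
have fTz (z : int) x : f (x + T *~ z)%R = f x.
  case: z => n; first exact: fTn.
  by rewrite NegzE mulrNz -pmulrn -[in RHS](subrK (T *+ n.+1)%R x) fTn.
pose z := Num.floor (c / T).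
have cz : (0 <= c - T *~ z <= T)%R.
  have := floor_itv (c / T); rewrite -/z => /andP[h1 h2].
  have cE : c = (c / T * T)%R by rewrite divfK// gt_eqF.
  have cB : (c - T *~ z = (c / T - z%:~R) * T)%R by rewrite mulrBl -cE mulrzl.
  rewrite intrD -ltrBlDl in h2; rewrite cB; apply/andP; split.
    by apply: mulr_ge0; [rewrite subr_ge0|exact: ltW].
  by apply: (le_trans (ler_wpM2r (ltW T0) (ltW h2))); rewrite mul1r.
rewrite -[RHS](ge0_periodic_shift0 cz)//.
by apply: eq_integral => x _; rewrite addrA -mulrNz fTz.
Qed.

Lemma periodic_integral_shift (T c : R) (f : R -> \bar R) : (0 < T)%R ->
  measurable_fun [set: R] f -> (forall x, f (x + T)%R = f x) ->
  \int[mu]_(x in `[0%R, T]) f (x + c)%R = \int[mu]_(x in `[0%R, T]) f x.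
Proof.
move=> T0 mf fT; rewrite integralE [RHS]integralE; congr (_ - _).
- rewrite -[RHS](ge0_periodic_integral_shift c T0)//.
  + by apply: eq_integral => x _; rewrite ?funeposE ?funenegE.
  + exact: measurable_funepos.
  + by move=> x; rewrite !funeposE fT.
- rewrite -[RHS](ge0_periodic_integral_shift c T0)//.
  + by apply: eq_integral => x _; rewrite ?funeposE ?funenegE.
  + exact: measurable_funeneg.
  + by move=> x; rewrite !funenegE fT.
Qed.

(** Passes from a parameter on the period 2T to its offset from a base point s, taken in the
    symmetric window where offsets are small exactly when the points are close. *)
Lemma ge0_periodic_integral_center (T s : R) (f : R -> \bar R) : (0 < T)%R ->
  measurable_fun [set: R] f -> (forall x, 0 <= f x) ->
  (forall x, f (x + T *+ 2)%R = f x) ->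
  \int[mu]_(x in `[(- T)%R, T]) f (s + x)%R = \int[mu]_(x in `[0%R, (T *+ 2)%R]) f x.
Proof.
move=> T0 mf f0 fT; rewrite -(@ge0_periodic_integral_shift _ (s - T))//; last by rewrite pmulrn_lgt0.
have -> : `[(- T)%R, T]%classic = `[(0 + (- T))%R, (T *+ 2 + (- T))%R]%classic :> set R.
  by rewrite add0r mulr2n addrK.
rewrite (@ge0_integral_itv_shift (- T) 0 (T *+ 2) (fun x => f (s + x)%R))//.
- by apply: eq_integral => x _; congr f; ring.
- by apply: measurableT_comp => //; exact: measurable_funD.
Qed.

Lemma measurable_integral_ge0 d (X : measurableType d) (D : set R)
    (f : X * R -> \bar R) :
  measurable D -> measurable_fun [set: X * R] f -> (forall z, 0 <= f z) ->
  measurable_fun [set: X] (fun x => \int[mu]_(y in D) f (x, y)).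
Proof.
move=> mD mf f0.
under eq_fun do rewrite integral_mkcond.
have mfD : measurable_fun [set: X * R] (f \_ (setT `*` D)).
  by apply/(measurable_restrictT _ _).1; [exact: measurableX|exact: measurable_funTS].
rewrite (_ : (fun x => _) = fubini_F mu (f \_ (setT `*` D))).
  apply: measurable_fun_fubini_tonelli_F => // z.
  by apply: erestrict_ge0 => ? _.
apply/funext => x; apply: eq_integral => y _; rewrite /patch/=.
by congr (if _ then _ else _); apply/idP/idP => /set_mem h; apply/mem_set => //=; case: h.
Qed.

Lemma ge0_integral_swap (A B : set R) (f : R -> R -> \bar R) :
  measurable A -> measurable B ->
  measurable_fun [set: R * R] (fun z => f z.1 z.2) -> (forall x y, 0 <= f x y) ->
  \int[mu]_(x in A) \int[mu]_(y in B) f x y =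
  \int[mu]_(y in B) \int[mu]_(x in A) f x y.
Proof.
move=> mA mB mf f0.
pose g := (fun z : R * R => f z.1 z.2) \_ (A `*` B).
have mg : measurable_fun setT g.
  by apply/(measurable_restrictT _ _).1; [exact: measurableX|exact: measurable_funTS].
have g0 z : 0 <= g z by apply: erestrict_ge0 => ? _.
have E1 x y : g (x, y) = if x \in A then if y \in B then f x y else 0 else 0.
  rewrite /g /patch; case: ifPn => [/set_mem[/= xA yB]|].
    by rewrite !mem_set.
  case: ifPn => // xA; case: ifPn => // yB /negP; case.
  by apply/mem_set; split => /=; exact: set_mem.
transitivity (\int[mu]_x \int[mu]_y g (x, y)).
  rewrite integral_mkcond; apply: eq_integral => x _; rewrite /patch.
  case: ifPn => xA; last by under eq_integral do rewrite E1 (negbTE xA); rewrite integral0.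
  by rewrite [LHS]integral_mkcond; apply: eq_integral => y _; rewrite E1 xA.
rewrite fubini_tonelli// [RHS]integral_mkcond; apply: eq_integral => y _; rewrite /patch.
case: ifPn => yB; last first.
  by under eq_integral do rewrite E1 (negbTE yB) if_same; rewrite integral0.
by rewrite [RHS]integral_mkcond; apply: eq_integral => x _; rewrite E1 yB.
Qed.

End Tonelli.

(** * Euclidean geometry of three-space *)

Section Space.
Context {R : realType}.
Implicit Types u v w z : 'rV[R]_3.

Lemma dotE u v : dot u v = u 0 0 * v 0 0 + u 0 1 * v 0 1 + u 0 2%:R * v 0 2%:R.
Proof.
rewrite /dot !big_ord_recl big_ord0 addr0 addrA.
have -> : lift ord0 ord0 = 1 :> 'I_3 by exact/val_inj.
by have -> : lift ord0 (lift ord0 ord0) = 2%:R :> 'I_3 by exact/val_inj.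
Qed.

Lemma cross0E u v : cross u v 0 0 = u 0 1 * v 0 2%:R - u 0 2%:R * v 0 1.
Proof. by rewrite mxE !add0r. Qed.

Lemma cross1E u v : cross u v 0 1 = u 0 2%:R * v 0 0 - u 0 0 * v 0 2%:R.
Proof.
rewrite mxE; have -> : 1 + 1 = 2%:R :> 'I_3 by exact/val_inj.
by have -> : 1 + 2%:R = 0 :> 'I_3 by exact/val_inj.
Qed.

Lemma cross2E u v : cross u v 0 2%:R = u 0 0 * v 0 1 - u 0 1 * v 0 0.
Proof.
rewrite mxE; have -> : 2%:R + 1 = 0 :> 'I_3 by exact/val_inj.
by have -> : 2%:R + 2%:R = 1 :> 'I_3 by exact/val_inj.
Qed.

Lemma eq_rV3 u v : u 0 0 = v 0 0 -> u 0 1 = v 0 1 -> u 0 2%:R = v 0 2%:R -> u = v.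
Proof.
move=> e0 e1 e2; apply/rowP => -[[|[|[|//]]] i].
- by rewrite (_ : Ordinal i = 0)//; exact/val_inj.
- by rewrite (_ : Ordinal i = 1)//; exact/val_inj.
- by rewrite (_ : Ordinal i = 2%:R)//; exact/val_inj.
Qed.

Lemma dotC u v : dot u v = dot v u.
Proof. by rewrite !dotE; ring. Qed.

Lemma dotDl u v w : dot (u + v) w = dot u w + dot v w.
Proof. by rewrite !dotE !mxE; ring. Qed.

Lemma dotZl a u w : dot (a *: u) w = a * dot u w.
Proof. by rewrite !dotE !mxE; ring. Qed.

Lemma dotNl u w : dot (- u) w = - dot u w.
Proof. by rewrite !dotE !mxE; ring. Qed.

Lemma dotDr u v w : dot w (u + v) = dot w u + dot w v.
Proof. by rewrite !dotE !mxE; ring. Qed.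

Lemma dotZr a u w : dot w (a *: u) = a * dot w u.
Proof. by rewrite !dotE !mxE; ring. Qed.

Lemma dotNr u w : dot w (- u) = - dot w u.
Proof. by rewrite !dotE !mxE; ring. Qed.

Lemma crossDl u v w : cross (u + v) w = cross u w + cross v w.
Proof. by apply: eq_rV3; rewrite !mxE; ring. Qed.

Lemma crossDr u v w : cross w (u + v) = cross w u + cross w v.
Proof. by apply: eq_rV3; rewrite !mxE; ring. Qed.

Lemma crossZl a u w : cross (a *: u) w = a *: cross u w.
Proof. by apply: eq_rV3; rewrite !mxE; ring. Qed.

Lemma crossZr a u w : cross w (a *: u) = a *: cross w u.
Proof. by apply: eq_rV3; rewrite !mxE; ring. Qed.

Lemma crossvv u : cross u u = 0.
Proof. by apply: eq_rV3; rewrite !mxE; ring. Qed.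

Lemma crossNC u v : cross u v = - cross v u.
Proof. by apply: eq_rV3; rewrite !mxE; ring. Qed.

(** The Binet-Cauchy identity. For w = u and z = v it is Lagrange's identity, from which both the
    Cauchy-Schwarz inequality and the bound on the norm of a cross product are read off. *)
Lemma dot_cross u v w z :
  dot (cross u v) (cross w z) = dot u w * dot v z - dot u z * dot v w.
Proof. by rewrite !dotE !cross0E !cross1E !cross2E; ring. Qed.

Lemma dot_ge0 u : 0 <= dot u u.
Proof. by rewrite dotE !addr_ge0// -expr2 sqr_ge0. Qed.

Lemma enorm_ge0 u : 0 <= enorm u.
Proof. exact: sqrtr_ge0. Qed.

Lemma enorm_sqr u : enorm u ^+ 2 = dot u u.
Proof. by rewrite sqr_sqrtr// dot_ge0. Qed.

Lemma enorm0 : enorm (0 : 'rV[R]_3) = 0.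
Proof. by rewrite /enorm dotE !mxE !mul0r !addr0 sqrtr0. Qed.

Lemma enormN u : enorm (- u) = enorm u.
Proof. by rewrite /enorm dotNl dotNr opprK. Qed.

Lemma enormZ a u : enorm (a *: u) = `|a| * enorm u.
Proof. by rewrite /enorm dotZl dotZr mulrA -expr2 sqrtrM ?sqr_ge0// sqrtr_sqr. Qed.

Lemma enorm_sqrE u : dot u u = enorm u * enorm u.
Proof. by rewrite -expr2 enorm_sqr. Qed.

Lemma dot_le_enorm u v : `|dot u v| <= enorm u * enorm v.
Proof.
rewrite -(@ler_pXn2r _ 2%N)// ?nnegrE ?mulr_ge0 ?enorm_ge0//.
rewrite real_normK ?num_real// exprMn !enorm_sqr -subr_ge0.
by apply: le_trans (dot_ge0 (cross u v)) _; rewrite dot_cross (dotC v u) expr2.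
Qed.

Lemma enorm_cross_le u v : enorm (cross u v) <= enorm u * enorm v.
Proof.
rewrite -(@ler_pXn2r _ 2%N)// ?nnegrE ?mulr_ge0 ?enorm_ge0//.
rewrite exprMn !enorm_sqr dot_cross (dotC v u) -expr2 gerBl.
exact: sqr_ge0.
Qed.

Lemma enormD u v : enorm (u + v) <= enorm u + enorm v.
Proof.
rewrite -(@ler_pXn2r _ 2%N)// ?nnegrE ?addr_ge0 ?enorm_ge0//.
rewrite enorm_sqr dotDl !dotDr (dotC v u) sqrrD !enorm_sqr.
have := le_trans (ler_norm _) (dot_le_enorm u v); lra.
Qed.

Lemma enormB u v : enorm (u - v) <= enorm u + enorm v.
Proof. by rewrite -(enormN v) enormD. Qed.

Lemma coord_le_enorm u i : `|u 0 i| <= enorm u.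
Proof.
rewrite -(@ler_pXn2r _ 2%N)// ?nnegrE ?enorm_ge0//.
rewrite real_normK ?num_real// enorm_sqr /dot (bigD1 i)//= expr2 lerDl.
by apply: sumr_ge0 => j _; rewrite -expr2 sqr_ge0.
Qed.

(** The factor 2 is a convenient bound for the square root of 3. *)
Lemma enorm_le_coord u (C : R) : (forall i, `|u 0 i| <= C) -> enorm u <= 2 * C.
Proof.
move=> uC; have C0 : 0 <= C := le_trans (normr_ge0 _) (uC 0).
rewrite -(@ler_pXn2r _ 2%N)// ?nnegrE ?enorm_ge0// ?mulr_ge0//.
rewrite enorm_sqr dotE -!expr2.
have h i : u 0 i ^+ 2 <= C ^+ 2.
  by rewrite -real_normK ?num_real// lerXn2r// nnegrE.
have := h 0; have := h 1; have := h 2%:R; have := sqr_ge0 C.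
rewrite exprMn; lra.
Qed.

Lemma enorm_eq0 u : enorm u = 0 -> u = 0.
Proof.
move=> u0; apply/rowP => i; rewrite mxE; apply/eqP.
by rewrite -normr_le0 -u0 coord_le_enorm.
Qed.

End Space.

(** * First order expansions of real powers *)

Section RealPowers.
Context {R : realType}.
Implicit Types x y z p q kappa tau A B c : R.

Lemma mean_value_ineq (f df : R -> R) (a b M : R) :
  (forall z, a <= z <= b -> is_derive z 1 f (df z)) ->
  (forall z, a <= z <= b -> `|df z| <= M) ->
  forall x y, a <= x <= b -> a <= y <= b -> `|f y - f x| <= M * `|y - x|.
Proof.
move=> fd dfM x y; wlog xy : x y / x <= y.
  move=> h xab yab; case: (leP x y) => [xy|/ltW yx]; first exact: h.
  by rewrite distrC (distrC y) h.
move=> /andP[ax xb] /andP[ay yb].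
have [|||c cxy ->] := @MVT_segment R f df x y.
- by [].
- move=> z /[!in_itv]/= /andP[xz zy]; apply: fd.
  by rewrite (le_trans ax (ltW xz)) (le_trans (ltW zy) yb).
- apply: derivable_within_continuous => z /[!in_itv]/= /andP[xz zy].
  have [] : is_derive z 1 f (df z).
    by apply: fd; rewrite (le_trans ax xz) (le_trans zy yb).
  by [].
- rewrite normrM ler_wpM2r// dfM//.
  by move: cxy; rewrite in_itv/= => /andP[xc cy]; rewrite (le_trans ax xc) (le_trans cy yb).
Qed.

Lemma is_derive_powR kappa x : 0 < x ->
  is_derive x 1 (fun y => y `^ kappa) (kappa * x `^ (kappa - 1)).
Proof.
move=> x0; have xI : x \in `]0, +oo[ by rewrite in_itv/= x0.
apply: DeriveDef; first exact: derivable_powR.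
by rewrite -derive1E powR_derive1.
Qed.

Lemma powR_le_half kappa z : 2^-1 <= z <= 3 / 2 -> z `^ kappa <= 2 `^ `|kappa|.
Proof.
move=> /andP[z1 z2]; have z0 : 0 < z by lra.
have [z3|z3] := leP 1 z.
  apply: (le_trans (ler_powR z3 (ler_norm kappa))).
  by apply: ge0_ler_powR; rewrite ?nnegrE//; lra.
have -> : z `^ kappa = z^-1 `^ (- kappa).
  by rewrite -(powR_inv1 (ltW z0)) -powRrM mulN1r opprK.
have z4 : 1 <= z^-1 by rewrite invf_ge1// ltW.
apply: (le_trans (ler_powR z4 (ler_norm (- kappa)))); rewrite normrN.
apply: ge0_ler_powR; rewrite ?nnegrE ?invr_ge0//; first exact: ltW.
by rewrite invf_ple ?posrE.
Qed.

(** The mean value inequality is used twice: it makes the derivative kappa z^(kappa - 1) Lipschitz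
    near 1, and then bounds the increment of z^kappa - kappa z, whose derivative vanishes at 1. *)
Lemma powR_taylor kappa : exists2 C, 0 <= C & forall y, `|y - 1| <= 2^-1 ->
  `|y `^ kappa - 1 - kappa * (y - 1)| <= C * (y - 1) ^+ 2.
Proof.
pose M := `|kappa - 1| * 2 `^ `|kappa - 1 - 1|.
have M0 : 0 <= M by rewrite mulr_ge0// powR_ge0.
exists (`|kappa| * M); first by rewrite mulr_ge0.
move=> y y1; have /andP[ya yb] : 2^-1 <= y <= 3 / 2.
  by move: y1; rewrite ler_norml => /andP[]; lra.
have h1 z : 2^-1 <= z <= 3 / 2 -> `|z `^ (kappa - 1) - 1| <= M * `|z - 1|.
  move=> zI.
  have -> : z `^ (kappa - 1) - 1 = z `^ (kappa - 1) - 1 `^ (kappa - 1) by rewrite powR1.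
  apply: (@mean_value_ineq (fun z => z `^ (kappa - 1))
    (fun z => (kappa - 1) * z `^ (kappa - 1 - 1)) 2^-1 (3 / 2) M) => //; last lra.
    by move=> w wI; apply: is_derive_powR; lra.
  move=> w wI; rewrite normrM ler_wpM2l// ger0_norm ?powR_ge0//.
  exact: powR_le_half.
pose f z := z `^ kappa - kappa * z.
(* The mean value inequality is applied on the interval between 1 and y only, where the derivative
   of [f] is at most a multiple of |y - 1|. *)
pose m1 := Num.min 1 y; pose m2 := Num.max 1 y.
have m1P : m1 <= 1 /\ m1 <= y /\ 2^-1 <= m1.
  by rewrite /m1; case: (leP 1 y) => ?; repeat split; lra.
have m2P : 1 <= m2 /\ y <= m2 /\ m2 <= 3 / 2.
  by rewrite /m2; case: (leP 1 y) => ?; repeat split; lra.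
have := @mean_value_ineq f (fun z => kappa * z `^ (kappa - 1) - kappa) m1 m2
  (`|kappa| * M * `|y - 1|) _ _ 1 y.
rewrite /f powR1 mulr1 => h.
have -> : y `^ kappa - 1 - kappa * (y - 1) = y `^ kappa - kappa * y - (1 - kappa) by ring.
rewrite -[(y - 1) ^+ 2]real_normK ?num_real// expr2 mulrA; apply: h.
- move=> z zI; rewrite -[X in _ - X](mulr1 kappa).
  by apply: is_derive_sub; apply: is_derive_powR; lra.
- move=> z zI; rewrite (_ : _ - kappa = kappa * (z `^ (kappa - 1) - 1)); last by rewrite mulrBr mulr1.
  rewrite normrM -mulrA ler_wpM2l//.
  apply: (le_trans (h1 z _)); first lra.
  rewrite ler_wpM2l//; move: zI; rewrite /m1 /m2.
  by case: (leP 1 y) => ? /andP[? ?];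
    [rewrite !ger0_norm|rewrite !ler0_norm]; lra.
- lra.
- lra.
Qed.

(** A quantitative form of y = 1 + tau y1 + O(tau^2), with one constant for the error and for the
    slope. Factors are normalised to 1 at tau = 0, so slopes are logarithmic derivatives. *)
Definition approx1 tau A (y y1 : R) : Prop :=
  `|y - 1 - tau * y1| <= A * tau ^+ 2 /\ `|y1| <= A.

Lemma approx1_ge0 tau A y y1 : approx1 tau A y y1 -> 0 <= A.
Proof. by move=> [_]; apply: le_trans. Qed.

Lemma approx1_le tau A B y y1 : A <= B -> approx1 tau A y y1 -> approx1 tau B y y1.
Proof.
move=> AB [h1 h2]; split; last exact: le_trans AB.
by apply: (le_trans h1); rewrite ler_wpM2r// sqr_ge0.
Qed.

Lemma approx1_dist tau A y y1 : `|tau| <= 1 -> approx1 tau A y y1 ->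
  `|y - 1| <= 2 * A * `|tau|.
Proof.
move=> t1 yA; have A0 := approx1_ge0 yA; have [h1 h2] := yA.
have -> : y - 1 = (y - 1 - tau * y1) + tau * y1 by ring.
apply: (le_trans (ler_normD _ _)).
have : `|tau * y1| <= A * `|tau| by rewrite normrM mulrC ler_wpM2r.
have : A * tau ^+ 2 <= A * `|tau|.
  by rewrite ler_wpM2l// -real_normK ?num_real// expr2 ler_piMl.
lra.
Qed.

(** Logarithmic derivatives add. The constant 6 = 3 + 2 + 1 collects the three error terms of the
    expanded product. *)
Lemma approx1M tau A B y y1 z z1 : `|tau| <= 1 -> 1 <= A -> 1 <= B ->
  approx1 tau A y y1 -> approx1 tau B z z1 ->
  approx1 tau (6 * A * B) (y * z) (y1 + z1).
Proof.
move=> t1 A1 B1 yA zB; have [ya yb] := yA; have [za zb] := zB.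
have AB : A * B >= A /\ A * B >= B by split; [rewrite ler_peMr|rewrite ler_peMl]; lra.
split; last by apply: (le_trans (ler_normD _ _)); lra.
have zn : `|z| <= 3 * B.
  have -> : z = (z - 1) + 1 by ring.
  apply: (le_trans (ler_normD _ _)); rewrite normr1.
  have := approx1_dist t1 zB.
  have : B * `|tau| <= B by rewrite ler_piMr//; lra.
  lra.
have -> : y * z - 1 - tau * (y1 + z1) = (y - 1 - tau * y1) * z +
   (1 + tau * y1) * (z - 1 - tau * z1) + tau ^+ 2 * (y1 * z1) by ring.
have t2 : 0 <= tau ^+ 2 by exact: sqr_ge0.
have e1 : `|(y - 1 - tau * y1) * z| <= 3 * (A * B) * tau ^+ 2.
  rewrite normrM (_ : 3 * _ * _ = A * tau ^+ 2 * (3 * B)); last ring.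
  by rewrite ler_pM.
have e2 : `|(1 + tau * y1) * (z - 1 - tau * z1)| <= 2 * (A * B) * tau ^+ 2.
  rewrite normrM (_ : 2 * _ * _ = 2 * A * (B * tau ^+ 2)); last ring.
  apply: ler_pM => //; apply: (le_trans (ler_normD _ _)); rewrite normr1 normrM.
  have : `|tau| * `|y1| <= 1 * A by rewrite ler_pM.
  lra.
have e3 : `|tau ^+ 2 * (y1 * z1)| <= (A * B) * tau ^+ 2.
  by rewrite normrM ger0_norm// mulrC ler_wpM2r// normrM ler_pM.
apply: (le_trans (ler_normD _ _)); apply: (le_trans (lerD (ler_normD _ _) (lexx _))).
lra.
Qed.

(** The bound 1 / (4 A) on tau keeps y within 1/2 of 1, where [powR_taylor] applies. *)
Lemma approx1_powR kappa A : 1 <= A -> exists2 C, 1 <= C &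
  forall tau y y1, `|tau| <= (4 * A)^-1 -> approx1 tau A y y1 ->
  approx1 tau C (y `^ kappa) (kappa * y1).
Proof.
move=> A1; have [C C0 hC] := powR_taylor kappa.
exists (1 + C * 4 * A ^+ 2 + `|kappa| * A).
  have : 0 <= C * 4 * A ^+ 2 by rewrite mulr_ge0 ?sqr_ge0// mulr_ge0.
  have : 0 <= `|kappa| * A by rewrite mulr_ge0//; lra.
  lra.
move=> tau y y1 tA yA; have A4 : (4 * A)^-1 <= 1 by rewrite invf_le1; lra.
have t1 : `|tau| <= 1 by lra.
have yd := approx1_dist t1 yA.
have kA : 0 <= `|kappa| * A by rewrite mulr_ge0//; lra.
have CA : 0 <= C * 4 * A ^+ 2 by rewrite mulr_ge0 ?sqr_ge0// mulr_ge0.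
have At : A * `|tau| <= 4^-1.
  rewrite (le_trans (ler_wpM2l _ tA)); [by []|lra|].
  by rewrite invfM mulrCA divff ?mulr1//; lra.
have {}hC := hC y ltac:(lra).
have [h1 h2] := yA; split; last first.
  by rewrite normrM; apply: (@le_trans _ _ (`|kappa| * A)); [rewrite ler_wpM2l|lra].
have -> : y `^ kappa - 1 - tau * (kappa * y1) =
  (y `^ kappa - 1 - kappa * (y - 1)) + kappa * (y - 1 - tau * y1) by ring.
apply: (le_trans (ler_normD _ _)).
have t2 : 0 <= tau ^+ 2 by exact: sqr_ge0.
have e1 : C * (y - 1) ^+ 2 <= C * 4 * A ^+ 2 * tau ^+ 2.
  have -> : C * 4 * A ^+ 2 * tau ^+ 2 = C * (2 * A * `|tau|) ^+ 2.
    by rewrite !exprMn real_normK ?num_real//; ring.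
  rewrite ler_wpM2l// -[leLHS]real_normK ?num_real//.
  by rewrite lerXn2r ?nnegrE// (le_trans _ yd).
have e2 : `|kappa * (y - 1 - tau * y1)| <= `|kappa| * A * tau ^+ 2.
  by rewrite normrM -mulrA ler_wpM2l.
lra.
Qed.

(** The range of tau must not depend on Z, which will be unbounded, so |tau| Z may be large. While
    |tau| Z <= 1 the Taylor expansion works. Beyond that every term is at most a multiple of (|tau|
    Z)^(2 q), and 2 q >= 2 makes this at most Z^(2 q) tau^2. *)
Lemma approx1_powR_large q c : 1 <= q -> 1 <= c -> exists2 C, 1 <= C &
  forall tau Z y y1, `|tau| <= 1 -> 1 <= Z -> 0 <= y ->
  `|y - 1 - tau * y1| <= c * Z ^+ 2 * tau ^+ 2 -> `|y1| <= c * Z ->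
  approx1 tau (C * Z `^ (2 * q)) (y `^ q) (q * y1).
Proof.
move=> q1 c1; have [C C0 hC] := powR_taylor q.
pose K := (1 + 2 * c) `^ q.
have K1 : 1 <= K.
  apply: (@le_trans _ _ (1 `^ q)); first by rewrite powR1.
  by apply: ge0_ler_powR; rewrite ?nnegrE; lra.
have qc : 1 <= q * c by rewrite (le_trans q1)// ler_peMr; lra.
pose D := C + 4 * K + 4 + 4 * q * c.
have D0 : 0 <= D by rewrite /D; lra.
have C4 : 0 <= D * (4 * c ^+ 2).
  by apply: mulr_ge0 => //; apply: mulr_ge0 => //; exact: sqr_ge0.
pose C' := q * c + 1 + K + D * (4 * c ^+ 2).
exists C'; first by rewrite /C'; lra.
move=> tau Z y y1 t1 Z1 y0 h1 h2.
pose P := Z `^ (2 * q).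
have Z2 : Z ^+ 2 <= P.
  rewrite -(@powR_mulrn R Z 2)//; last lra.
  by apply: ler_powR => //; lra.
have ZP : Z <= P by apply: le_trans Z2; rewrite expr2 ler_peMr; lra.
have P1 : 1 <= P by lra.
have C'P E : E <= C' -> E * P <= C' * P by move=> ?; rewrite ler_wpM2r//; lra.
split; last first.
  rewrite normrM ger0_norm; last lra.
  apply: (le_trans (ler_wpM2l _ h2)); first lra.
  rewrite mulrA; apply: (@le_trans _ _ (q * c * P)); first by rewrite ler_wpM2l//; lra.
  by apply: C'P; rewrite /C'; lra.
pose Y := `|tau| * Z.
have Y0 : 0 <= Y by rewrite mulr_ge0//; lra.
have t2 : 0 <= tau ^+ 2 by exact: sqr_ge0.
have YY : Y ^+ 2 = Z ^+ 2 * tau ^+ 2 by rewrite exprMn real_normK ?num_real// mulrC.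
have ty1 : `|tau * y1| <= c * Y by rewrite normrM /Y mulrCA ler_wpM2l.
have yd : `|y - 1| <= c * Y ^+ 2 + c * Y.
  have -> : y - 1 = (y - 1 - tau * y1) + tau * y1 by ring.
  by apply: (le_trans (ler_normD _ _)); rewrite YY mulrA lerD.
have YP : Y ^+ 2 <= P * tau ^+ 2 by rewrite YY ler_wpM2r.
(* [Y] = |tau| Z separates the perturbative regime from the one where crude growth bounds
   suffice. *)
have [Ylt|Ygt] := leP Y 1.
- have Y21 : Y ^+ 2 <= Y by rewrite expr2 ler_piMl.
  have yd1 : `|y - 1| <= 2 * c * Y.
    apply: (le_trans yd); have : c * Y ^+ 2 <= c * Y by rewrite ler_wpM2l; lra.
    lra.
  have yd2 : (y - 1) ^+ 2 <= 4 * c ^+ 2 * Y ^+ 2.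
    have -> : 4 * c ^+ 2 * Y ^+ 2 = (2 * c * Y) ^+ 2 by ring.
    rewrite -[in leLHS]real_normK ?num_real// lerXn2r// nnegrE//.
    by rewrite mulr_ge0//; lra.
  have ylec : y <= 1 + 2 * c.
    have : c * Y <= c by rewrite ler_piMr; lra.
    by move: yd1; rewrite ler_norml => /andP[_]; lra.
  have yqK : 0 <= y `^ q <= K.
    by rewrite powR_ge0/=; apply: ge0_ler_powR; rewrite ?nnegrE; lra.
  have main : `|y `^ q - 1 - q * (y - 1)| <= D * (y - 1) ^+ 2.
    have y2 : 0 <= (y - 1) ^+ 2 by exact: sqr_ge0.
    (* If y is far from 1, then (y - 1)^2 >= 1/4 and a multiple of it absorbs every bounded term. *)
    have [ys|yl] := leP `|y - 1| 2^-1.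
      by apply: (le_trans (hC _ ys)); rewrite ler_wpM2r// /D; lra.
    have y3 : 4^-1 <= (y - 1) ^+ 2.
      rewrite -[leRHS]real_normK ?num_real// (_ : 4^-1 = 2^-1 ^+ 2); last by field.
      by rewrite lerXn2r ?nnegrE// ltW.
    have y4 : `|y - 1| <= 2 * (y - 1) ^+ 2.
      rewrite -[in leRHS]real_normK ?num_real// expr2 mulrA ler_peMl//.
      by move: yl; lra.
    have e1 : `|q * (y - 1)| <= 2 * q * c * (y - 1) ^+ 2.
      rewrite normrM ger0_norm; last lra.
      apply: (@le_trans _ _ (q * (2 * (y - 1) ^+ 2))); first by rewrite ler_wpM2l//; lra.
      rewrite (_ : _ * _ = 2 * q * (y - 1) ^+ 2); last ring.
      by rewrite ler_wpM2r// -mulrA ler_wpM2l// ler_peMr; lra.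
    have e2 : `|y `^ q - 1| <= (4 * K + 4) * (y - 1) ^+ 2.
      apply: (@le_trans _ _ ((4 * K + 4) * 4^-1)); last by rewrite ler_wpM2l; lra.
      by rewrite ler_norml; lra.
    have e3 : 0 <= C * (y - 1) ^+ 2 by rewrite mulr_ge0.
    have e4 : 0 <= q * c * (y - 1) ^+ 2 by rewrite mulr_ge0; lra.
    apply: (le_trans (ler_normB _ _)); rewrite /D; lra.
  have -> : y `^ q - 1 - tau * (q * y1) =
    (y `^ q - 1 - q * (y - 1)) + q * (y - 1 - tau * y1) by ring.
  apply: (le_trans (ler_normD _ _)).
  have e1 : `|q * (y - 1 - tau * y1)| <= q * c * (P * tau ^+ 2).
    rewrite normrM ger0_norm; last lra.
    rewrite -mulrA ler_wpM2l; [by []|lra|].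
    apply: (le_trans h1); rewrite -mulrA ler_wpM2l ?ler_wpM2r//; lra.
  have e2 : `|y `^ q - 1 - q * (y - 1)| <=
     D * (4 * c ^+ 2) * (P * tau ^+ 2).
    apply: (le_trans main); rewrite -mulrA ler_wpM2l//.
    by apply: (le_trans yd2); rewrite ler_wpM2l// mulr_ge0// sqr_ge0.
  have e3 : 0 <= P * tau ^+ 2 by rewrite mulr_ge0//; lra.
  apply: (le_trans (lerD e2 e1)); rewrite -mulrDl.
  apply: (@le_trans _ _ (C' * (P * tau ^+ 2))); last by rewrite mulrA.
  by rewrite ler_wpM2r// /C'; lra.
- have Y2 : Y <= Y ^+ 2 by rewrite expr2 ler_peMr//; lra.
  pose Q := Y `^ (2 * q).
  have YQ : Y ^+ 2 <= Q.
    rewrite -(@powR_mulrn R Y 2)//.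
    by apply: ler_powR; lra.
  have ylec : y <= (1 + 2 * c) * Y ^+ 2.
    have : c * Y <= c * Y ^+ 2 by rewrite ler_wpM2l; lra.
    by move: yd; rewrite ler_norml => /andP[_]; lra.
  have yqK : 0 <= y `^ q <= K * Q.
    rewrite powR_ge0/= /K /Q powRrM (@powR_mulrn R Y 2)// -powRM; last 2 first.
    - lra.
    - exact: sqr_ge0.
    apply: ge0_ler_powR; rewrite ?nnegrE; [lra|lra| |by []].
    by rewrite mulr_ge0 ?sqr_ge0//; lra.
  (* Since |tau| <= 1 and 2 q >= 2, |tau|^(2 q) <= tau^2. *)
  have QP : Q <= P * tau ^+ 2.
    rewrite /Q /Y powRM// -/P; last lra.
    rewrite mulrC ler_wpM2l//; first lra.
    rewrite -(real_normK (num_real tau)) -(@powR_mulrn R _ 2)//.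
    have [->|t0] := eqVneq `|tau| 0.
      by rewrite !powR0//; lra.
    apply: ger_powR; last lra.
    by rewrite t1 andbT lt_def t0/=.
  have e1 : `|tau * (q * y1)| <= q * c * Q.
    rewrite mulrCA normrM ger0_norm; last lra.
    rewrite -mulrA ler_wpM2l; [by []|lra|].
    by apply: (le_trans ty1); rewrite ler_wpM2l//; lra.
  have e2 : `|y `^ q - 1| <= (K + 1) * Q.
    have : 1 <= Q by lra.
    have : 0 <= K * Q by rewrite mulr_ge0; lra.
    by move=> ? ?; rewrite ler_norml; lra.
  have -> : y `^ q - 1 - tau * (q * y1) = (y `^ q - 1) - tau * (q * y1) by ring.
  apply: (le_trans (ler_normB _ _)).
  apply: (@le_trans _ _ (C' * Q)).
    apply: (le_trans (lerD e2 e1)); rewrite -mulrDl ler_wpM2r /C'; lra.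
  rewrite -mulrA ler_wpM2l// /C'; lra.
Qed.

(** Either x <= lambda, or x = x^p x^(1 - p) with x^(1 - p) <= lambda^(1 - p). It replaces the
    Hoelder and Jensen inequalities below: integrating it and choosing lambda bounds an integral by
    one of p-th powers. *)
Lemma le_young p x lambda : 1 <= p -> 0 <= x -> 0 < lambda ->
  x <= lambda + x `^ p * lambda `^ (1 - p).
Proof.
move=> p1 x0 l0; have [xl|lx] := leP x lambda.
  by rewrite ler_wpDr// mulr_ge0// powR_ge0.
have x1 : 0 < x by lra.
have : x <= x `^ p * lambda `^ (1 - p); last lra.
have {1}-> : x = x `^ p * x `^ (1 - p).
  by rewrite -powRD ?(gt_eqF x1) ?implybT// (_ : p + (1 - p) = 1) ?powRr1//; ring.
rewrite ler_wpM2l ?powR_ge0// (_ : 1 - p = - (p - 1)); last ring.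
rewrite !powRN lef_pV2 ?posrE ?powR_gt0//.
by apply: ge0_ler_powR; rewrite ?nnegrE; lra.
Qed.

Lemma powR_add_le p x y : 0 <= p -> 0 <= x -> 0 <= y ->
  (x + y) `^ p <= 2 `^ p * (x `^ p + y `^ p).
Proof.
move=> p0; wlog xy : x y / x <= y.
  move=> h x0 y0; case: (leP x y) => [xy|/ltW yx]; first exact: h.
  by rewrite addrC [X in _ * X]addrC h.
move=> x0 y0; apply: (@le_trans _ _ ((2 * y) `^ p)).
  by apply: ge0_ler_powR; rewrite ?nnegrE; lra.
by rewrite powRM// ler_wpM2l ?powR_ge0// lerDr powR_ge0.
Qed.

End RealPowers.

(** * Expansion of the energy density in tau *)

Section VectorExpansions.
Context {R : realType}.
Implicit Types (U V N : 'rV[R]_3) (c p tau Z : R).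

(** Passing to squared norms turns the ratios into polynomials in tau. *)
Lemma enorm_ratio_powR U V (e : R) :
  (enorm U / enorm V) `^ e = (dot U U / dot V V) `^ (e / 2).
Proof.
rewrite !enorm_sqrE -mulf_div.
set q := enorm U / enorm V; have q0 : 0 <= q by rewrite divr_ge0 ?enorm_ge0.
by rewrite -expr2 -powR_mulrn// -powRrM; congr (_ `^ _); field.
Qed.

Lemma inv_powR (x e : R) : 0 <= x -> x^-1 `^ e = x `^ (- e).
Proof. by move=> x0; rewrite -powR_inv1// -powRrM mulN1r. Qed.

(** The squared ratio is 1 + 2 tau (V . V') / |V|^2 + tau^2 |V'|^2 / |V|^2, and its coefficients are
    bounded because V' is at most c times as long as V. *)
Lemma approx1_side (e c : R) : 1 <= c -> exists C t0 : R, [/\ 1 <= C, 0 < t0 &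
  forall tau V V', `|tau| <= t0 -> 0 < enorm V -> enorm V' <= c * enorm V ->
  approx1 tau C ((enorm (V + tau *: V') / enorm V) `^ e)
    (e * (dot V V' / dot V V))].
Proof.
move=> c1; pose A := c ^+ 2 + 2 * c.
have c2 : 0 <= c ^+ 2 by exact: sqr_ge0.
have A1 : 1 <= A by rewrite /A; lra.
have [C C1 hC] := approx1_powR (e / 2) A1.
exists C, (4 * A)^-1; split => //; first by rewrite invr_gt0; lra.
move=> tau V V' tA V0 VV'; rewrite enorm_ratio_powR.
have -> : e * (dot V V' / dot V V) = e / 2 * (2 * (dot V V' / dot V V)).
  by set x := (_ / _ : R); field.
apply: hC => //; have VV : 0 < dot V V by rewrite enorm_sqrE mulr_gt0.
have VV'1 : `|dot V V' / dot V V| <= c.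
  rewrite normrM normfV (gtr0_norm VV) ler_pdivrMr// enorm_sqrE.
  apply: (le_trans (dot_le_enorm _ _)).
  by rewrite [leRHS]mulrCA ler_wpM2l// ltW.
split; last by rewrite normrM ger0_norm// /A; lra.
have -> : dot (V + tau *: V') (V + tau *: V') / dot V V - 1 -
   tau * (2 * (dot V V' / dot V V)) = dot V' V' / dot V V * tau ^+ 2.
  rewrite dotDl !dotDr !dotZl !dotZr (dotC V' V); field.
  by rewrite gt_eqF.
rewrite normrM (ger0_norm (sqr_ge0 tau)) ler_wpM2r ?sqr_ge0//.
rewrite ger0_norm ?divr_ge0 ?dot_ge0// ler_pdivrMr// -!enorm_sqr.
apply: (@le_trans _ _ ((c * enorm V) ^+ 2)).
  by rewrite lerXn2r// nnegrE ?enorm_ge0// (le_trans (enorm_ge0 _) VV').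
by rewrite exprMn ler_wpM2r ?sqr_ge0// /A; lra.
Qed.

(** The same expansion for the area vector, which is quadratic in tau and whose relative increments
    are only of size c Z. This calls for [approx1_powR_large] with exponent p/2, at least 1 because
    p >= 2. *)
Lemma approx1_numer p c : 2 <= p -> 1 <= c -> exists2 C, 1 <= C &
  forall tau Z N0 N1 N2, `|tau| <= 1 -> 1 <= Z -> 0 < enorm N0 ->
  enorm N1 <= c * Z * enorm N0 -> enorm N2 <= c * Z * enorm N0 ->
  approx1 tau (C * Z `^ p) ((enorm (N0 + tau *: N1 + tau ^+ 2 *: N2) / enorm N0) `^ p)
    (p * (dot N0 N1 / dot N0 N0)).
Proof.
move=> p2 c1; pose A := 6 * c ^+ 2.
have cc : c <= c ^+ 2 by rewrite expr2 ler_peMr//; lra.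
have A1 : 1 <= A by rewrite /A; lra.
have p21 : 1 <= p / 2 by lra.
have [C C1 hC] := approx1_powR_large p21 A1.
exists C => // tau Z N0 N1 N2 t1 Z1 n0 n1 n2.
rewrite enorm_ratio_powR (_ : p * (dot N0 N1 / dot N0 N0) = p / 2 * (2 * (dot N0 N1 / dot N0 N0))); last first.
  by set x := (dot _ _ / _ : R); field.
rewrite (_ : Z `^ p = Z `^ (2 * (p / 2))); last by congr (_ `^ _); field.
have nn : 0 < dot N0 N0 by rewrite enorm_sqrE mulr_gt0.
pose d V W := dot V W / dot N0 N0.
have dle V W k l : 0 <= k -> 0 <= l -> enorm V <= k * enorm N0 -> enorm W <= l * enorm N0 ->
    `|d V W| <= k * l.
  move=> k0 l0 hV hW; rewrite normrM normfV (gtr0_norm nn) ler_pdivrMr// enorm_sqrE.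
  apply: (le_trans (dot_le_enorm _ _)).
  by rewrite mulrACA ler_pM ?enorm_ge0.
have n0' : enorm N0 <= 1 * enorm N0 by rewrite mul1r.
have cZ0 : 0 <= c * Z by rewrite mulr_ge0; lra.
have d01 := dle _ _ _ _ ler01 cZ0 n0' n1.
have d02 := dle _ _ _ _ ler01 cZ0 n0' n2.
have d11 := dle _ _ _ _ cZ0 cZ0 n1 n1.
have d12 := dle _ _ _ _ cZ0 cZ0 n1 n2.
have d22 := dle _ _ _ _ cZ0 cZ0 n2 n2.
have cZ : c * Z <= c ^+ 2 * Z ^+ 2.
  by rewrite ler_pM//; [lra|lra|rewrite expr2 ler_peMr; lra].
apply: hC => //; first by rewrite divr_ge0 ?dot_ge0.
- have -> : dot (N0 + tau *: N1 + tau ^+ 2 *: N2) (N0 + tau *: N1 + tau ^+ 2 *: N2) /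
      dot N0 N0 - 1 - tau * (2 * (dot N0 N1 / dot N0 N0)) =
      (d N1 N1 + 2 * d N0 N2 + tau * (2 * d N1 N2) + tau ^+ 2 * d N2 N2) * tau ^+ 2.
    rewrite /d !dotDl !dotDr !dotZl !dotZr (dotC N1 N0) (dotC N2 N0) (dotC N2 N1); field.
    by rewrite gt_eqF.
  rewrite normrM (ger0_norm (sqr_ge0 tau)) ler_wpM2r ?sqr_ge0//.
  have t2 : `|tau ^+ 2| <= 1 by rewrite normrX exprn_ile1.
  have h1 : `|tau * (2 * d N1 N2)| <= 2 * (c ^+ 2 * Z ^+ 2).
    rewrite normrM; apply: (@le_trans _ _ (1 * `|2 * d N1 N2|)); first by rewrite ler_wpM2r.
    rewrite mul1r normrM ger0_norm// ler_wpM2l//.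
    by rewrite (_ : c ^+ 2 * Z ^+ 2 = c * Z * (c * Z)) //; ring.
  have h2 : `|tau ^+ 2 * d N2 N2| <= c ^+ 2 * Z ^+ 2.
    rewrite normrM; apply: (@le_trans _ _ (1 * `|d N2 N2|)); first by rewrite ler_wpM2r.
    by rewrite mul1r (_ : c ^+ 2 * Z ^+ 2 = c * Z * (c * Z)) //; ring.
  have h3 : `|d N1 N1| <= c ^+ 2 * Z ^+ 2.
    by rewrite (_ : c ^+ 2 * Z ^+ 2 = c * Z * (c * Z)) //; ring.
  have h4 : `|2 * d N0 N2| <= 2 * (c ^+ 2 * Z ^+ 2).
    rewrite normrM ger0_norm// ler_wpM2l//; rewrite mul1r in d02; exact: le_trans cZ.
  apply: (le_trans (ler_normD _ _)); apply: (le_trans (lerD (ler_normD _ _) (lexx _))).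
  apply: (le_trans (lerD (lerD (ler_normD _ _) (lexx _)) (lexx _))).
  by rewrite /A; clear -h1 h2 h3 h4; lra.
- rewrite normrM ger0_norm// -/(d N0 N1).
  apply: (@le_trans _ _ (2 * (c * Z))); first by rewrite ler_wpM2l//; rewrite mul1r in d01.
  by rewrite mulrA ler_wpM2r /A; lra.
Qed.

(* The integrand of the energy in terms of the two edges [A], [B] at a vertex
   and of the three velocities. *)
Definition edge_density p (A B T1 T2 T3 : 'rV[R]_3) : R :=
  (2 * enorm (cross A B) / (enorm A * enorm B * enorm (B - A))) `^ p *
  enorm T1 * enorm T2 * enorm T3.

(** The logarithmic derivative of [edge_density] when the edges move with velocities [A'], [B'] and
    the three tangent vectors with [G1], [G2], [G3]. *)
Definition edge_variation p (A B T1 T2 T3 A' B' G1 G2 G3 : 'rV[R]_3) : R :=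
  p * (dot (cross A B) (cross A' B + cross A B') / dot (cross A B) (cross A B)
       - dot A A' / dot A A - dot B B' / dot B B
       - dot (B - A) (B' - A') / dot (B - A) (B - A)) +
  (dot T1 G1 / dot T1 T1 + dot T2 G2 / dot T2 T2 + dot T3 G3 / dot T3 T3).

(** The density is a product of powers of norms, so the perturbed density is the original one times
    seven ratios that equal 1 at tau = 0. *)
Lemma edge_densityE p (A B T1 T2 T3 A' B' G1 G2 G3 : 'rV[R]_3) tau :
  let rt V V' := enorm (V + tau *: V') / enorm V in
  0 < enorm A -> 0 < enorm B -> 0 < enorm (B - A) -> 0 < enorm (cross A B) ->
  0 < enorm T1 -> 0 < enorm T2 -> 0 < enorm T3 ->
  edge_density p (A + tau *: A') (B + tau *: B') (T1 + tau *: G1) (T2 + tau *: G2)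
    (T3 + tau *: G3) =
  edge_density p A B T1 T2 T3 *
  ((enorm (cross A B + tau *: (cross A' B + cross A B') + tau ^+ 2 *: cross A' B')
     / enorm (cross A B)) `^ p *
   (rt A A' `^ (- p) * rt B B' `^ (- p) * rt (B - A) (B' - A') `^ (- p)) *
   (rt T1 G1 `^ 1 * rt T2 G2 `^ 1 * rt T3 G3 `^ 1)).
Proof.
move=> rt A0 B0 C0 N0 t1 t2 t3.
have -> : cross A B + tau *: (cross A' B + cross A B') + tau ^+ 2 *: cross A' B' =
    cross (A + tau *: A') (B + tau *: B').
  rewrite !crossDl !crossDr !crossZl !crossZr scalerDr scalerA -expr2 !addrA.
  by congr (_ + _); rewrite addrAC.
have rtE V V' : 0 < enorm V -> enorm (V + tau *: V') = enorm V * rt V V'.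
  by move=> V0; rewrite /rt mulrC divfK// gt_eqF.
rewrite /edge_density.
have -> : B + tau *: B' - (A + tau *: A') = (B - A) + tau *: (B' - A').
  by rewrite scalerBr opprD !addrA; congr (_ - _); rewrite addrAC.
set n := _ / enorm (cross A B).
have -> : enorm (cross (A + tau *: A') (B + tau *: B')) = enorm (cross A B) * n.
  by rewrite mulrC divfK// gt_eqF.
have n0 : 0 <= n by rewrite divr_ge0 ?enorm_ge0.
have rt0 V V' : 0 <= rt V V' by rewrite divr_ge0 ?enorm_ge0.
rewrite !rtE// !powRr1//.
set N := enorm (cross A B); set a := enorm A; set b := enorm B; set c := enorm (B - A).
have -> : 2 * (N * n) / (a * rt A A' * (b * rt B B') * (c * rt (B - A) (B' - A'))) =
    2 * N / (a * b * c) * n * (rt A A')^-1 * (rt B B')^-1 * (rt (B - A) (B' - A'))^-1.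
  by rewrite !invfM; ring.
have x0 : 0 <= 2 * N / (a * b * c).
  by rewrite divr_ge0// mulr_ge0// ?mulr_ge0// ?enorm_ge0.
have xn0 := mulr_ge0 x0 n0.
have i0 V V' : 0 <= (rt V V')^-1 by rewrite invr_ge0.
have xa0 := mulr_ge0 xn0 (i0 A A').
have xb0 := mulr_ge0 xa0 (i0 B B').
rewrite (powRM p xb0 (i0 _ _)) (powRM p xa0 (i0 _ _)) (powRM p xn0 (i0 _ _)) (powRM p x0 n0).
by rewrite !inv_powR//; ring.
Qed.

(** The seven expansions are multiplied by [approx1M]. Only the area factor depends on Z, so the
    total cost is a single Z^p. *)
Lemma edge_density_approx1 p c : 2 <= p -> 1 <= c ->
  exists K t0 : R, [/\ 1 <= K, 0 < t0 &
  forall tau Z (A B T1 T2 T3 A' B' G1 G2 G3 : 'rV[R]_3), `|tau| <= t0 -> 1 <= Z ->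
  0 < enorm A -> 0 < enorm B -> 0 < enorm (B - A) -> 0 < enorm (cross A B) ->
  0 < enorm T1 -> 0 < enorm T2 -> 0 < enorm T3 ->
  enorm A' <= c * enorm A -> enorm B' <= c * enorm B ->
  enorm (B' - A') <= c * enorm (B - A) ->
  enorm (cross A' B + cross A B') <= c * Z * enorm (cross A B) ->
  enorm (cross A' B') <= c * Z * enorm (cross A B) ->
  enorm G1 <= c * enorm T1 -> enorm G2 <= c * enorm T2 -> enorm G3 <= c * enorm T3 ->
  `|edge_density p (A + tau *: A') (B + tau *: B') (T1 + tau *: G1) (T2 + tau *: G2)
     (T3 + tau *: G3) - edge_density p A B T1 T2 T3 - tau *
     (edge_density p A B T1 T2 T3 * edge_variation p A B T1 T2 T3 A' B' G1 G2 G3)|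
  <= edge_density p A B T1 T2 T3 * (K * Z `^ p * tau ^+ 2)].
Proof.
move=> p2 c1.
have [C1 C1ge1 h1] := approx1_numer p2 c1.
have [C2 [t2 [C2ge1 t2gt0 h2]]] := approx1_side (- p) c1.
have [C3 [t3 [C3ge1 t3gt0 h3]]] := approx1_side 1 c1.
pose D2 := 6 * (6 * C2 * C2) * C2.
pose D3 := 6 * (6 * C3 * C3) * C3.
have mul6 (x y : R) : 1 <= x -> 1 <= y -> 1 <= 6 * x * y.
  move=> x1 y1; have : 1 <= x * y by rewrite (le_trans x1)// ler_peMr; lra.
  by rewrite -mulrA; lra.
have D2ge1 : 1 <= D2 by rewrite /D2 !mul6.
have D3ge1 : 1 <= D3 by rewrite /D3 !mul6.
exists (6 * (6 * C1 * D2) * D3), (Num.min 1 (Num.min t2 t3)); split.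
- by rewrite !mul6.
- by rewrite !lt_min ltr01 t2gt0.
move=> tau Z A B T1 T2 T3 A' B' G1 G2 G3 tt0 Z1 A0 B0 C0 N0
  q1 q2 q3 A'A B'B C'C N1N N2N g1 g2 g3.
have /and3P[ta tb tc] : [&& `|tau| <= 1, `|tau| <= t2 & `|tau| <= t3] by rewrite -!le_min.
rewrite edge_densityE//.
set E := edge_density p A B T1 T2 T3.
have E0 : 0 <= E by rewrite /E /edge_density !mulr_ge0 ?powR_ge0 ?enorm_ge0.
set Y := (X in E * X - _).
have -> : E * Y - E - tau * (E * edge_variation p A B T1 T2 T3 A' B' G1 G2 G3) =
  E * (Y - 1 - tau * edge_variation p A B T1 T2 T3 A' B' G1 G2 G3) by ring.
rewrite normrM ger0_norm// ler_wpM2l//.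
have ZP : 1 <= Z `^ p.
  apply: (@le_trans _ _ (Z `^ 0)); first by rewrite powRr0.
  by apply: ler_powR => //; lra.
have CZ : 1 <= C1 * Z `^ p by rewrite (le_trans C1ge1)// ler_peMr; lra.
have a1 := h1 tau Z _ _ _ ta Z1 N0 N1N N2N.
have a2 := approx1M ta (mul6 _ _ C2ge1 C2ge1) C2ge1
  (approx1M ta C2ge1 C2ge1 (h2 _ _ _ tb A0 A'A) (h2 _ _ _ tb B0 B'B)) (h2 _ _ _ tb C0 C'C).
have a3 := approx1M ta (mul6 _ _ C3ge1 C3ge1) C3ge1
  (approx1M ta C3ge1 C3ge1 (h3 _ _ _ tc q1 g1) (h3 _ _ _ tc q2 g2)) (h3 _ _ _ tc q3 g3).
have [] := approx1M ta (mul6 _ _ CZ D2ge1) D3ge1 (approx1M ta CZ D2ge1 a1 a2) a3.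
set v := (X in _ - _ * X) => hv _.
have -> : edge_variation p A B T1 T2 T3 A' B' G1 G2 G3 = v.
  by rewrite /edge_variation /v; ring.
apply: (le_trans hv); rewrite le_eqVlt; apply/orP; left; apply/eqP.
by rewrite -/D2 -/D3; ring.
Qed.

End VectorExpansions.

(** * Chord and arc estimates *)

Section Trigonometry.
Context {R : realType}.
Notation pi := (@pi R).
Implicit Types a b s x y : R.

Lemma le_cos_segment x y : 0 <= x <= pi -> 0 <= y <= pi -> cos x <= cos y -> y <= x.
Proof.
move=> xI yI; apply: contraLR; rewrite -!ltNge => xy.
by rewrite ltr_cos// in_itv.
Qed.

Lemma sin_norm_le x : `|sin x| <= `|x|.
Proof.
have := @mean_value_ineq R sin cos (- `|x|) `|x| 1 _ _ 0 x.
rewrite sin0 !subr0 mul1r; apply.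
- by move=> z _; exact: cos_max.
- by rewrite oppr_le0 normr_ge0.
- by rewrite lerNl -normrN ler_norm normrN ler_norm.
Qed.

(** By the double angle formula, sin x = 2 sin(x/2) cos(x/2) with x/2 at most pi/3, where the cosine
    is at least c = cos(pi/3). The mean value theorem gives sin(x/2) >= c x/2, hence k = c^2. *)
Lemma sin_norm_ge : exists2 k : R, 0 < k & forall x, `|x| <= 2 * (pi / 3) ->
  k * `|x| <= `|sin x|.
Proof.
have pi0 := @pi_gt0 R.
pose c : R := cos (pi / 3); have c0 : 0 < c by apply: cos_gt0_pihalf; lra.
exists (c ^+ 2); first exact: exprn_gt0.
move=> x xpi; wlog x0 : x xpi / 0 <= x.
  move=> h; case: (leP 0 x) => [|/ltW] x0; first exact: h.
  by rewrite -normrN -[leRHS]normrN -sinN h ?normrN// oppr_ge0.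
rewrite ger0_norm// in xpi *.
have cosge z : 0 <= z <= pi / 3 -> c <= cos z.
  move=> zI; rewrite leNgt; apply/negP; rewrite /c ltr_cos ?in_itv/=; lra.
have e1 : c * (x / 2) <= sin (x / 2).
  have [||z zI] := @MVT_segment R sin cos 0 (x / 2).
  - lra.
  - by apply: continuous_subspaceT => z; exact: continuous_sin.
  rewrite sin0 !subr0 => ->; rewrite ler_wpM2r; [by []|lra|].
  by apply: cosge; move: zI; rewrite in_itv/=; lra.
have -> : sin x = cos (x / 2) * sin (x / 2) * 2.
  rewrite mulr_natr -sin_mulr2n -mulr_natr.
  by congr sin; field.
rewrite ger0_norm; last first.
  by rewrite !mulr_ge0//; [apply: cos_ge0_pihalf|apply: sin_ge0_pi]; lra.
have c1 : c <= cos (x / 2) by apply: cosge; lra.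
have e2 : c * (c * (x / 2)) <= cos (x / 2) * sin (x / 2).
  by apply: ler_pM => //; rewrite ?mulr_ge0//; lra.
rewrite expr2; clear -e2; lra.
Qed.

(* On the circle [pair_dominates a b] says that the distance between the points
   at angles [a] and [b] is the largest side of the triangle they form with the
   point at angle [0]. *)
Definition pair_dominates a b := (cos (a - b) <= cos a) && (cos (a - b) <= cos b).

(** If a and b had the same sign, their difference would be a shorter arc than one of them, against
    the monotonicity of the cosine on [0, pi]. So the base point lies between the other two. When
    |a| + |b| exceeds pi, the complementary arc 2 pi - |a| - |b| dominates |a| and |b|, and adding
    the two inequalities gives 3 (|a| + |b|) <= 4 pi. *)
Lemma pair_dominates_opposite a b : - pi <= a <= pi -> - pi <= b <= pi ->
  a != 0 -> b != 0 -> pair_dominates a b ->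
  `|b - a| = `|a| + `|b| /\ `|a| + `|b| <= 4 * (pi / 3).
Proof.
have pi0 := @pi_gt0 R.
rewrite -!ler_norml => ha hb a0 b0 /andP[].
rewrite -(cos_norm (a - b)) -(cos_norm a) -(cos_norm b) => h1 h2.
have na : 0 < `|a| by rewrite normr_gt0.
have nb : 0 < `|b| by rewrite normr_gt0.
rewrite (distrC b a).
have key : `|a - b| = `|a| + `|b|.
  move: h1 h2 ha hb na nb; case: (ltrP 0 a) => [a1|a1]; case: (ltrP 0 b) => [b1|b1].
  - move=> h1 h2 ha hb na nb; rewrite (gtr0_norm a1) (gtr0_norm b1) in h1 h2 ha hb *.
    exfalso; have [ab|ba] := leP a b.
      rewrite ler0_norm in h2; last lra.
      have : b <= - (a - b) by apply: le_cos_segment h2; lra.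
      lra.
    rewrite gtr0_norm in h1; last lra.
    have : a <= a - b by apply: le_cos_segment h1; lra.
    lra.
  - by move=> *; rewrite ger0_norm ?(gtr0_norm a1) ?(ler0_norm b1); lra.
  - by move=> *; rewrite ler0_norm ?(gtr0_norm b1) ?(ler0_norm a1); lra.
  - move=> h1 h2 ha hb na nb; rewrite (ler0_norm a1) (ler0_norm b1) in h1 h2 ha hb na nb *.
    exfalso; have [ab|ba] := leP a b.
      rewrite ler0_norm in h1; last lra.
      have : - a <= - (a - b) by apply: le_cos_segment h1; lra.
      lra.
    rewrite gtr0_norm in h2; last lra.
    have : - b <= a - b by apply: le_cos_segment h2; lra.
    lra.
split => //; rewrite key in h1 h2.
have [|Lpi] := leP (`|a| + `|b|) pi; first lra.
have e : cos (`|a| + `|b|) = cos (pi *+ 2 - (`|a| + `|b|)).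
  by rewrite -[RHS]cosN opprB -(cosD2pi (_ - _)) subrK.
rewrite e mulr2n in h1 h2.
have h3 : `|a| <= pi + pi - (`|a| + `|b|) by apply: le_cos_segment h1; lra.
have h4 : `|b| <= pi + pi - (`|a| + `|b|) by apply: le_cos_segment h2; lra.
lra.
Qed.

End Trigonometry.

(** * The geometry of the circle *)

Section Circle.
Context {R : realType} (m u v : 'rV[R]_3) (r : R).
Hypotheses (hr : 0 < r) (huu : dot u u = 1) (hvv : dot v v = 1) (huv : dot u v = 0).
Implicit Types a b s x y : R.
Notation gam := (circle m u v r).

Definition tangent u v x : 'rV[R]_3 := - sin x *: u + cos x *: v.
Notation tg := (tangent u v).

Lemma dot_tangent x y : dot (tg x) (tg y) = cos (x - y).
Proof.
rewrite /tangent !dotDl !dotDr !dotZl !dotZr huu hvv (dotC v u) huv cosB; ring.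
Qed.

Lemma enorm_tangent x : enorm (tg x) = 1.
Proof. by rewrite /enorm dot_tangent subrr cos0 sqrtr1. Qed.

Lemma enorm_cross_uv : enorm (cross u v) = 1.
Proof. by rewrite /enorm dot_cross huu hvv huv mul0r subr0 mulr1 sqrtr1. Qed.

Lemma cross_tangent x y : cross (tg x) (tg y) = sin (y - x) *: cross u v.
Proof.
rewrite /tangent !crossDl !crossDr !crossZl !crossZr !crossvv (crossNC v u) sinB.
by apply/rowP => i; rewrite !mxE; ring.
Qed.

(** A chord is parallel to the tangent at the middle angle, by the sum-to-product formulas. All
    edges of inscribed triangles thus become multiples of [tangent]. *)
Lemma circle_sub x y :
  gam y - gam x = (2 * r * sin ((y - x) / 2)) *: tg ((x + y) / 2).
Proof.
have h (a d : R) : gam (a + d) - gam (a - d) = (2 * r * sin d) *: tg a.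
  rewrite /circle /tangent cosD cosB sinD sinB; apply/rowP => i; rewrite !mxE; ring.
by rewrite -h; congr (circle m u v r _ - circle m u v r _); field.
Qed.

Lemma enorm_circle_sub x y : enorm (gam y - gam x) = 2 * r * `|sin ((y - x) / 2)|.
Proof.
by rewrite circle_sub enormZ enorm_tangent mulr1 normrM gtr0_norm// mulr_gt0.
Qed.

Lemma cross_circle s a b :
  cross (gam (s + a) - gam s) (gam (s + b) - gam s) =
  (4 * r ^+ 2 * (sin (a / 2) * sin (b / 2) * sin ((b - a) / 2))) *: cross u v.
Proof.
rewrite !circle_sub crossZl crossZr cross_tangent !scalerA; congr (_ *: _).
have -> : (s + a - s) / 2 = a / 2 by field.
have -> : (s + b - s) / 2 = b / 2 by field.
have -> : (s + (s + b)) / 2 - (s + (s + a)) / 2 = (b - a) / 2 by field.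
ring.
Qed.

Lemma circle_periodic : periodic gam (pi *+ 2).
Proof. by move=> x; rewrite /circle cosD2pi sinD2pi. Qed.

Lemma is_derive_circle x : is_derive x 1 gam (r *: tg x).
Proof.
apply: is_derive_rV => i; rewrite !mxE.
rewrite (_ : (fun y => _) = fun y => m 0 i + r * (cos y * u 0 i + sin y * v 0 i)); last first.
  by apply/funext => y; rewrite !mxE.
rewrite -[X in is_derive _ _ _ X]add0r; apply: is_derive_add.
apply: is_derive_scale; apply: is_derive_add.
  rewrite -[X in is_derive _ _ _ X]addr0 -[X in _ + X](mulr0 (cos x)).
  exact: is_derive_mul.
rewrite -[X in is_derive _ _ _ X]addr0 -[X in _ + X](mulr0 (sin x)).
exact: is_derive_mul.
Qed.

Lemma derive1_circle x : derive1 gam x = r *: tg x.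
Proof. by rewrite derive1E; have [] := is_derive_circle x. Qed.

(** The three half-angle sines of the area cancel against those of the sides: the Menger curvature
    of an inscribed triangle is 1/r, and the speeds contribute r^3. *)
Lemma edge_density_circle p s a b :
  sin (a / 2) != 0 -> sin (b / 2) != 0 -> sin ((b - a) / 2) != 0 ->
  edge_density p (gam (s + a) - gam s) (gam (s + b) - gam s)
    (r *: tg s) (r *: tg (s + a)) (r *: tg (s + b)) = r^-1 `^ p * r ^+ 3.
Proof.
move=> sa sb sab; rewrite /edge_density !enormZ !enorm_tangent (gtr0_norm hr).
rewrite cross_circle enormZ enorm_cross_uv.
have -> : gam (s + b) - gam s - (gam (s + a) - gam s) = gam (s + b) - gam (s + a).
  by rewrite opprB addrA subrK.
rewrite !enorm_circle_sub.
have -> : (s + a - s) / 2 = a / 2 by field.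
have -> : (s + b - s) / 2 = b / 2 by field.
have -> : (s + b - (s + a)) / 2 = (b - a) / 2 by field.
have r2 : 0 <= 4 * r ^+ 2 by rewrite mulr_ge0// exprn_ge0// ltW.
rewrite (normrM (4 * r ^+ 2)) (ger0_norm r2) (normrM (sin _ * sin _)) (normrM (sin (a / 2))).
rewrite (_ : _ / _ = r^-1); last first.
  by field; rewrite !normr_eq0 sa sb sab gt_eqF.
by rewrite !mulr1; ring.
Qed.

(** Sine and cosine have 1-Lipschitz derivatives, so each of their secant slopes over a step a is
    within |a| of the derivative. *)
Lemma circle_quotient_le s a : a != 0 ->
  enorm (a^-1 *: (gam (s + a) - gam s) - r *: tg s) <= 2 * r * `|a|.
Proof.
move=> a0.
have h (f df : R -> R) : (forall z : R, is_derive z 1 f (df z)) ->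
    (forall x y, `|df y - df x| <= `|y - x|) -> `|(f (s + a) - f s) / a - df s| <= `|a|.
  move=> fd dfl; pose F z := f z - df s * z.
  have := @mean_value_ineq R F (fun z => df z - df s) (s - `|a|) (s + `|a|) `|a| _ _ s (s + a).
  rewrite /F => {}h.
  have e : (f (s + a) - f s) / a - df s =
     (f (s + a) - df s * (s + a) - (f s - df s * s)) / a by field.
  rewrite e normrM normfV ler_pdivrMr ?normr_gt0//.
  apply: le_trans (h _ _ _ _) _ => //.
  - move=> z _; apply: is_derive_sub => //; rewrite -[X in is_derive _ _ _ X]mulr1.
    exact: is_derive_scale.
  - by move=> z /andP[z1 z2]; apply: (le_trans (dfl _ _)); rewrite ler_norml; lra.
  - by rewrite lerBlDr lerDl; have := normr_ge0 a; lra.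
  - by rewrite lerD2l lerD2l lerNl -normrN ler_norm normrN ler_norm.
  - by rewrite addrAC subrr add0r.
have hc := h cos (fun z => - sin z) (fun z => is_derive_cos z).
have hs := h sin cos (fun z => is_derive_sin z).
have lipcos x y : `|cos y - cos x| <= `|y - x|.
  have := @mean_value_ineq R cos (fun z => - sin z) (Num.min x y) (Num.max x y) 1 _ _ x y.
  rewrite mul1r; apply.
  - by move=> z _; rewrite normrN; exact: sin_max.
  - by rewrite ge_min le_max lexx.
  - by rewrite ge_min le_max lexx !orbT.
have lipsin x y : `|- sin y - - sin x| <= `|y - x|.
  have := @mean_value_ineq R sin cos (Num.min x y) (Num.max x y) 1 _ _ x y.
  rewrite mul1r -opprD normrN; apply.
  - by move=> z _; exact: cos_max.
  - by rewrite ge_min le_max lexx.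
  - by rewrite ge_min le_max lexx !orbT.
have {}hc := hc lipsin; have {}hs := hs lipcos.
have -> : a^-1 *: (gam (s + a) - gam s) - r *: tg s =
    (r * ((cos (s + a) - cos s) / a - - sin s)) *: u +
    (r * ((sin (s + a) - sin s) / a - cos s)) *: v.
  by apply/rowP => i; rewrite /circle /tangent !mxE; ring.
apply: (le_trans (enormD _ _)).
rewrite !enormZ !normrM (gtr0_norm hr) /enorm huu hvv sqrtr1 !mulr1.
rewrite (_ : 2 * r * `|a| = r * `|a| + r * `|a|); last ring.
by rewrite lerD// ler_wpM2l// ltW.
Qed.

Lemma circle_quotient_norm s a : enorm (gam (s + a) - gam s) <= r * `|a|.
Proof.
rewrite enorm_circle_sub (_ : (s + a - s) / 2 = a / 2); last by field.
have := sin_norm_le (a / 2); rewrite (normrM a) (_ : `|2^-1| = 2^-1 :> R); [|by rewrite ger0_norm] => h.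
rewrite (_ : r * `|a| = 2 * r * (`|a| / 2)); last by field.
by rewrite ler_wpM2l// mulr_ge0// ltW.
Qed.

End Circle.

(** * Symmetry of the density in its three parameters *)

Section CurveDensity.
Context {R : realType}.
Implicit Types (c d T G : R -> 'rV[R]_3) (p tau s t x : R).

(** The velocity field is a separate argument, so a perturbation of the curve acts linearly on the
    pair (c, T). *)
Definition curve_density p c T s t x : R :=
  edge_density p (c t - c s) (c x - c s) (T s) (T t) (T x).

Definition curve_variation p c T d G s t x : R :=
  curve_density p c T s t x *
  edge_variation p (c t - c s) (c x - c s) (T s) (T t) (T x)
    (d t - d s) (d x - d s) (G s) (G t) (G x).

Definition curve_remainder p c T d G tau s t x : R :=
  `|curve_density p (fun y => c y + tau *: d y) (fun y => T y + tau *: G y) s t x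
    - curve_density p c T s t x - tau * curve_variation p c T d G s t x|.

Lemma curve_densityC p c T s t x :
  curve_density p c T s t x = curve_density p c T s x t.
Proof.
rewrite /curve_density /edge_density (crossNC (c x - c s)) enormN.
set A := c t - c s; set B := c x - c s.
by rewrite -(enormN (A - B)) (opprB A B) mulrAC (mulrC (enorm B) (enorm A)).
Qed.

(** Changing the base vertex replaces the edges A, B by -A, B - A, which keeps the area and permutes
    the sides. With the exchange of the last two parameters this generates all permutations of the
    vertices. *)
Lemma curve_densityCA p c T s t x :
  curve_density p c T s t x = curve_density p c T t s x.
Proof.
rewrite /curve_density /edge_density.
have -> : c s - c t = - (c t - c s) by rewrite opprB.
have -> : c x - c t = (c x - c s) - (c t - c s) by rewrite opprB addrA subrK.
set A := c t - c s; set B := c x - c s.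
have -> : B - A - - A = B by rewrite opprK subrK.
have -> : cross (- A) (B - A) = - cross A B.
  by apply: eq_rV3; rewrite !mxE; ring.
by rewrite !enormN (mulrAC _ (enorm (T s))) (mulrAC (enorm A)).
Qed.

Lemma curve_variationC p c T d G s t x :
  curve_variation p c T d G s t x = curve_variation p c T d G s x t.
Proof.
rewrite /curve_variation curve_densityC; congr (_ * _).
rewrite /edge_variation.
set A := c t - c s; set B := c x - c s; set A' := d t - d s; set B' := d x - d s.
rewrite (crossNC B A) (crossNC B' A) (crossNC B A') -opprD !dotNl !dotNr !opprK.
rewrite -(opprB B A) -(opprB B' A') !dotNl !dotNr !opprK.
by rewrite (addrC (cross A B')); ring.
Qed.

Lemma curve_variationCA p c T d G s t x :
  curve_variation p c T d G s t x = curve_variation p c T d G t s x.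
Proof.
rewrite /curve_variation curve_densityCA; congr (_ * _).
rewrite /edge_variation.
have -> : c s - c t = - (c t - c s) by rewrite opprB.
have -> : c x - c t = (c x - c s) - (c t - c s) by rewrite opprB addrA subrK.
have -> : d s - d t = - (d t - d s) by rewrite opprB.
have -> : d x - d t = (d x - d s) - (d t - d s) by rewrite opprB addrA subrK.
set A := c t - c s; set B := c x - c s; set A' := d t - d s; set B' := d x - d s.
have -> : B - A - - A = B by rewrite opprK subrK.
have -> : B' - A' - - A' = B' by rewrite opprK subrK.
have -> : cross (- A) (B - A) = - cross A B.
  by apply: eq_rV3; rewrite !mxE; ring.
have -> : cross (- A') (B - A) + cross (- A) (B' - A') = - (cross A' B + cross A B').
  by apply: eq_rV3; rewrite !mxE; ring.
by rewrite !dotNl !dotNr !opprK; ring.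
Qed.

Lemma curve_remainderC p c T d G tau s t x :
  curve_remainder p c T d G tau s t x = curve_remainder p c T d G tau s x t.
Proof.
by rewrite /curve_remainder curve_variationC curve_densityC (curve_densityC p c).
Qed.

Lemma curve_remainderCA p c T d G tau s t x :
  curve_remainder p c T d G tau s t x = curve_remainder p c T d G tau t s x.
Proof.
by rewrite /curve_remainder curve_variationCA curve_densityCA (curve_densityCA p c).
Qed.

(** A side vanishes, so the quotient takes the default value 0, and 0^p = 0 for nonzero p. *)
Lemma curve_density_degenerate p c T s t x : p != 0 ->
  c t = c s \/ c x = c s \/ c x = c t -> curve_density p c T s t x = 0.
Proof.
move=> p0 h; rewrite /curve_density /edge_density.
suff -> : enorm (c t - c s) * enorm (c x - c s) * enorm (c x - c s - (c t - c s)) = 0.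
  by rewrite invr0 mulr0 powR0// !mul0r.
by case: h => [->|[->|->]]; rewrite subrr enorm0 ?mul0r ?mulr0 ?mul0r.
Qed.

Lemma curve_remainder_degenerate p c T d G tau s t x : p != 0 ->
  t = s \/ x = s \/ x = t -> curve_remainder p c T d G tau s t x = 0.
Proof.
move=> p0 h; rewrite /curve_remainder /curve_variation !curve_density_degenerate//.
- by rewrite !(mul0r, mulr0, subr0) normr0.
- by case: h => [->|[->|->]]; tauto.
- by case: h => [->|[->|->]]; tauto.
Qed.

End CurveDensity.

(** * Pointwise bound on the second order remainder *)

Section CircleRemainder.
Context {R : realType} (m u v : 'rV[R]_3) (r : R).
Hypotheses (hr : 0 < r) (huu : dot u u = 1) (hvv : dot v v = 1) (huv : dot u v = 0).
Variables (Phi g : R -> 'rV[R]_3) (G p : R).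
Hypotheses (p2 : 2 <= p) (G0 : 0 <= G).
Hypothesis Phi_lip : forall x y, enorm (Phi y - Phi x) <= G * `|y - x|.
Hypothesis g_le : forall x, enorm (g x) <= G.
Notation gam := (circle m u v r).
Notation gam' := (fun x => r *: tangent u v x).
Implicit Types a b s : R.

(** How far the secant slope of [Phi] over [s, s + a] is from the derivative at s; [g] plays the
    role of the derivative. *)
Definition quotient_error (Phi g : R -> 'rV[R]_3) s a : R :=
  enorm (a^-1 *: (Phi (s + a) - Phi s) - g s).
Notation Dq := (quotient_error Phi g).

(* With difference quotients [qA], [qB] at a common point, [A /\ B = ab qA /\ (qB - qA)],
   and [qB - qA] is the quantity controlled by the errors of the quotients. *)
Lemma cross_first_order (A B A' B' w w' : 'rV[R]_3) a b : a != 0 -> b != 0 ->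
  enorm (cross A' B + cross A B') <= `|a| * `|b| *
    (enorm (a^-1 *: A') * (enorm (a^-1 *: A - w) + enorm (b^-1 *: B - w)) +
     enorm (a^-1 *: A) * (enorm (a^-1 *: A' - w') + enorm (b^-1 *: B' - w'))) /\
  enorm (cross A' B') <= `|a| * `|b| *
    (enorm (a^-1 *: A') * (enorm (a^-1 *: A' - w') + enorm (b^-1 *: B' - w'))).
Proof.
move=> a0 b0.
set qA := a^-1 *: A; set qB := b^-1 *: B; set qA' := a^-1 *: A'; set qB' := b^-1 *: B'.
have AE : A = a *: qA by rewrite scalerA divff// scale1r.
have BE : B = b *: qB by rewrite scalerA divff// scale1r.
have A'E : A' = a *: qA' by rewrite scalerA divff// scale1r.
have B'E : B' = b *: qB' by rewrite scalerA divff// scale1r.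
have -> : cross A' B + cross A B' =
    (a * b) *: (cross qA' (qB - qA) + cross qA (qB' - qA')).
  by rewrite {1}AE {1}BE {1}A'E {1}B'E; apply: eq_rV3; rewrite !mxE; ring.
have -> : cross A' B' = (a * b) *: cross qA' (qB' - qA').
  by rewrite {1}A'E {1}B'E; apply: eq_rV3; rewrite !mxE; ring.
have tri (x y z : 'rV[R]_3) : enorm (y - x) <= enorm (x - z) + enorm (y - z).
  have -> : y - x = (y - z) - (x - z) by rewrite opprB addrA subrK.
  by rewrite [leRHS]addrC enormB.
have cle (x y : 'rV[R]_3) (l : R) : enorm y <= l -> enorm (cross x y) <= enorm x * l.
  by move=> yl; apply: (le_trans (enorm_cross_le _ _)); rewrite ler_wpM2l ?enorm_ge0.
rewrite !(enormZ (a * b)) (normrM a b); split; apply: ler_wpM2l; rewrite ?mulr_ge0//.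
- by apply: (le_trans (enormD _ _)); apply: lerD; apply: cle; exact: tri.
- by apply: cle; exact: tri.
Qed.

(** When the side opposite s is the longest, the area of the triangle is comparable to |a| |b| (|a|
    + |b|). By [cross_first_order] the variation of the area vector is at most |a| |b| times the
    errors of the secant slopes. Dividing leaves (errors) / (|a| + |b|), which is the quantity Z
    required by [edge_density_approx1]. *)
Lemma circle_remainder_le : exists K t0 : R, [/\ 1 <= K, 0 < t0 &
  forall tau s a b, `|tau| <= t0 -> - pi <= a <= pi -> - pi <= b <= pi ->
    pair_dominates a b ->
    curve_remainder p gam gam' Phi g tau s (s + a) (s + b) <=
    K * (1 + (Dq s a + Dq s b) / (`|a| + `|b|)) `^ p * tau ^+ 2].
Proof.
have [k k0 sink] := @sin_norm_ge R.
have pi0 := @pi_gt0 R.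
(* Relative sizes of the perturbation: [c1] for the sides, [c2] and [c3] for the first and second
   order terms of the area vector, [c4] for the velocities. *)
pose c1 := G / (r * k); pose c2 := 2 * (2 * G + 1) / (r * k ^+ 3).
pose c3 := 2 * G / (r ^+ 2 * k ^+ 3); pose c4 := G / r.
have c10 : 0 <= c1 by rewrite divr_ge0// mulr_ge0// ltW.
have c20 : 0 <= c2.
  by rewrite divr_ge0 ?mulr_ge0 ?exprn_ge0 ?addr_ge0 ?mulr_ge0// ltW.
have c30 : 0 <= c3 by rewrite divr_ge0 ?mulr_ge0 ?exprn_ge0// ltW.
have c40 : 0 <= c4 by rewrite divr_ge0// ltW.
pose c := 1 + c1 + c2 + c3 + c4.
have [cge1 c1c' c2c c3c c4c] : [/\ 1 <= c, c1 <= c, c2 <= c, c3 <= c & c4 <= c].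
  by rewrite /c; split; lra.
have r0 : 0 <= r := ltW hr.
have G21 : 0 <= 2 * G + 1 by rewrite addr_ge0// mulr_ge0.
have [K [t0 [K1 t00 hK]]] := edge_density_approx1 p2 cge1.
pose E0 := r^-1 `^ p * r ^+ 3.
have E00 : 0 <= E0 by rewrite mulr_ge0 ?powR_ge0 ?exprn_ge0// ltW.
have K0 : 0 <= K by lra.
exists (1 + E0 * K), t0; split => //; first by rewrite lerDl mulr_ge0.
move=> tau s a b tt0 ha hb hE.
have p0 : p != 0 by rewrite gt_eqF// (lt_le_trans _ p2).
have RHS0 : 0 <= (1 + E0 * K) * (1 + (Dq s a + Dq s b) / (`|a| + `|b|)) `^ p * tau ^+ 2.
  rewrite mulr_ge0 ?sqr_ge0// mulr_ge0 ?powR_ge0//.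
  by rewrite addr_ge0// mulr_ge0.
have [a0|a0] := eqVneq a 0.
  by rewrite curve_remainder_degenerate// a0 addr0; left.
have [b0|b0] := eqVneq b 0.
  by rewrite curve_remainder_degenerate// b0 addr0; right; left.
(* All three half angles are now at most 2 pi/3 in absolute value, so [sin_norm_ge] makes each chord
   comparable to its arc. *)
have [ba LE] := pair_dominates_opposite ha hb a0 b0 hE.
set L := `|a| + `|b| in LE ba *.
have na : 0 < `|a| by rewrite normr_gt0.
have nb : 0 < `|b| by rewrite normr_gt0.
have L0 : 0 < L by rewrite addr_gt0.
have sin2 (x : R) : `|x| <= 4 * (pi / 3) -> k * `|x| <= 2 * `|sin (x / 2)|.
  move=> xL; have := sink (x / 2); rewrite (normrM x) (_ : `|2^-1| = 2^-1 :> R); last by rewrite ger0_norm.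
  by move=> /(_ ltac:(lra)); lra.
have sa := sin2 a ltac:(rewrite -ler_norml in ha; lra).
have sb := sin2 b ltac:(rewrite -ler_norml in hb; lra).
have sba : k * L <= 2 * `|sin ((b - a) / 2)| by rewrite -ba; apply: sin2; rewrite ba.
have pos (x y : R) : 0 < x -> k * x <= 2 * `|y| -> 0 < `|y|.
  by move=> x0 h; have h' := mulr_gt0 k0 x0; lra.
have ssa := pos _ _ na sa; have ssb := pos _ _ nb sb; have ssba := pos _ _ L0 sba.
set Z := 1 + _ / _.
have D0 x : 0 <= Dq s x by exact: enorm_ge0.
have Z1 : 1 <= Z by rewrite /Z lerDl divr_ge0 ?addr_ge0.
have Z0 : 0 <= Z := le_trans ler01 Z1.
have Zm1 : 0 <= Z - 1 by rewrite subr_ge0.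
pose A := gam (s + a) - gam s; pose B := gam (s + b) - gam s.
pose A' := Phi (s + a) - Phi s; pose B' := Phi (s + b) - Phi s.
have BA : B - A = gam (s + b) - gam (s + a) by rewrite /A /B opprB addrA subrK.
have BA' : B' - A' = Phi (s + b) - Phi (s + a) by rewrite /A' /B' opprB addrA subrK.
have nA : enorm A = 2 * r * `|sin (a / 2)|.
  by rewrite enorm_circle_sub// (_ : (s + a - s) / 2 = a / 2)//; field.
have nB : enorm B = 2 * r * `|sin (b / 2)|.
  by rewrite enorm_circle_sub// (_ : (s + b - s) / 2 = b / 2)//; field.
have nC : enorm (B - A) = 2 * r * `|sin ((b - a) / 2)|.
  by rewrite BA enorm_circle_sub// (_ : (s + b - (s + a)) / 2 = (b - a) / 2)//; field.
have r2 : 0 < 2 * r by rewrite mulr_gt0.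
pose S := `|sin (a / 2)| * `|sin (b / 2)| * `|sin ((b - a) / 2)|.
have nN : enorm (cross A B) = 4 * r ^+ 2 * S.
  rewrite cross_circle// enormZ enorm_cross_uv// mulr1 normrM ger0_norm.
    by rewrite 2!normrM.
  by rewrite mulr_ge0// exprn_ge0// ltW.
have S0 : 0 < S by rewrite !mulr_gt0.
have lenB (x y : R) : 0 <= x -> k * x <= 2 * y -> G * x <= c1 * (2 * r * y).
  move=> x0 h; have -> : G * x = c1 * (r * (k * x)).
    by rewrite /c1; field; rewrite !gt_eqF.
  rewrite ler_wpM2l// (_ : 2 * r * y = r * (2 * y)); last ring.
  by rewrite ler_wpM2l// ltW.
have c1c (x : R) : 0 <= x -> c1 * x <= c * x by move=> x0; rewrite ler_wpM2r.
have A'A : enorm A' <= c * enorm A.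
  apply: le_trans (c1c _ (enorm_ge0 _)); rewrite nA; apply: le_trans (lenB _ _ (ltW na) sa).
  by apply: (le_trans (Phi_lip _ _)); rewrite (addrC s) addrK.
have B'B : enorm B' <= c * enorm B.
  apply: le_trans (c1c _ (enorm_ge0 _)); rewrite nB; apply: le_trans (lenB _ _ (ltW nb) sb).
  by apply: (le_trans (Phi_lip _ _)); rewrite (addrC s) addrK.
have C'C : enorm (B' - A') <= c * enorm (B - A).
  apply: le_trans (c1c _ (enorm_ge0 _)); rewrite nC; apply: le_trans (lenB _ _ (ltW L0) sba).
  rewrite BA'; apply: (le_trans (Phi_lip _ _)).
  by rewrite (_ : s + b - (s + a) = b - a) ?ba//; ring.
have [N1le N2le] := cross_first_order A B A' B' (gam' s) (g s) a0 b0.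
have qA' : enorm (a^-1 *: A') <= G.
  rewrite enormZ normfV mulrC ler_pdivrMr//.
  by apply: (le_trans (Phi_lip _ _)); rewrite (addrC s) addrK.
have qA : enorm (a^-1 *: A) <= r.
  by rewrite enormZ normfV mulrC ler_pdivrMr//; exact: circle_quotient_norm.
have eA := circle_quotient_le m hr huu hvv s a0.
have eB := circle_quotient_le m hr huu hvv s b0.
have ZL : Dq s a + Dq s b <= (Z - 1) * L.
  rewrite (_ : (Z - 1) * L = Dq s a + Dq s b)// /Z (addrC 1) addrK divfK//.
  by rewrite gt_eqF.
have abL0 : 0 < `|a| * `|b| * L by rewrite !mulr_gt0.
have SL : k ^+ 3 * (`|a| * `|b| * L) <= 8 * S.
  have -> : 8 * S = (2 * `|sin (a / 2)|) * (2 * `|sin (b / 2)|) * (2 * `|sin ((b - a) / 2)|).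
    by rewrite /S; ring.
  have -> : k ^+ 3 * (`|a| * `|b| * L) = (k * `|a|) * (k * `|b|) * (k * L) by ring.
  by do 2 (apply: ler_pM => //; rewrite ?mulr_ge0//; try exact: ltW).
have NL : `|a| * `|b| * L <= 2 / (r ^+ 2 * k ^+ 3) * enorm (cross A B).
  rewrite nN (_ : 2 / (r ^+ 2 * k ^+ 3) * (4 * r ^+ 2 * S) = 8 * S / k ^+ 3); last first.
    by field; rewrite !gt_eqF.
  by rewrite ler_pdivlMr ?exprn_gt0// mulrC.
have ab0 : 0 <= `|a| * `|b| by rewrite mulr_ge0.
(* The slope errors of the circle add up to at most 2 r L, those of [Phi] to at most (Z - 1) L, so
   both are of order Z L. *)
have N1N : enorm (cross A' B + cross A B') <= c * Z * enorm (cross A B).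
  apply: (le_trans N1le).
  apply: (@le_trans _ _ (`|a| * `|b| * ((2 * G + 1) * r * Z * L))).
    rewrite ler_wpM2l//.
    apply: (@le_trans _ _ (G * (2 * r * L) + r * ((Z - 1) * L))).
      rewrite lerD// ler_pM ?addr_ge0 ?enorm_ge0//.
      by rewrite /L mulrDr lerD.
    rewrite -subr_ge0 [leRHS](_ : _ = 2 * (G * r * L * (Z - 1)) + r * L); last ring.
    have rL : 0 <= r * L := mulr_ge0 r0 (ltW L0).
    by rewrite addr_ge0// mulr_ge0// mulr_ge0// -mulrA mulr_ge0.
  rewrite [leLHS](_ : _ = (2 * G + 1) * r * Z * (`|a| * `|b| * L)); last ring.
  apply: (@le_trans _ _ ((2 * G + 1) * r * Z * (2 / (r ^+ 2 * k ^+ 3) * enorm (cross A B)))).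
    by rewrite ler_wpM2l// mulr_ge0// mulr_ge0.
  rewrite [leLHS](_ : _ = c2 * Z * enorm (cross A B)); last first.
    by rewrite /c2; field; rewrite !gt_eqF.
  by rewrite ler_wpM2r ?enorm_ge0// ler_wpM2r.
have N2N : enorm (cross A' B') <= c * Z * enorm (cross A B).
  apply: (le_trans N2le).
  apply: (@le_trans _ _ (`|a| * `|b| * (G * (Z * L)))).
    rewrite ler_wpM2l// ler_pM ?addr_ge0 ?enorm_ge0//.
    by apply: (le_trans ZL); rewrite ler_wpM2r ?gerBl// ltW.
  rewrite [leLHS](_ : _ = G * Z * (`|a| * `|b| * L)); last ring.
  apply: (@le_trans _ _ (G * Z * (2 / (r ^+ 2 * k ^+ 3) * enorm (cross A B)))).
    by rewrite ler_wpM2l// mulr_ge0.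
  rewrite [leLHS](_ : _ = c3 * Z * enorm (cross A B)); last first.
    by rewrite /c3; field; rewrite !gt_eqF.
  by rewrite ler_wpM2r ?enorm_ge0// ler_wpM2r.
have nT x : enorm (r *: tangent u v x) = r.
  by rewrite enormZ enorm_tangent// mulr1 gtr0_norm.
have gT x : enorm (g x) <= c * enorm (r *: tangent u v x).
  rewrite nT; apply: (le_trans (g_le x)).
  by have -> : G = c4 * r; [rewrite /c4 divfK// gt_eqF|rewrite ler_wpM2r].
have A0 : 0 < enorm A by rewrite nA mulr_gt0.
have B0 : 0 < enorm B by rewrite nB mulr_gt0.
have C0 : 0 < enorm (B - A) by rewrite nC mulr_gt0.
have N0 : 0 < enorm (cross A B) by rewrite nN !mulr_gt0// exprn_gt0.
have T0 x : 0 < enorm (r *: tangent u v x) by rewrite nT.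
have := hK tau Z A B _ _ _ A' B' _ _ _ tt0 Z1 A0 B0 C0 N0 (T0 s) (T0 (s + a)) (T0 (s + b))
  A'A B'B C'C N1N N2N (gT s) (gT (s + a)) (gT (s + b)).
rewrite /A /B edge_density_circle//; last 3 first.
- by rewrite -normr_gt0.
- by rewrite -normr_gt0.
- by rewrite -normr_gt0.
rewrite -/A -/B -/E0 /curve_remainder /curve_variation /curve_density => h.
rewrite (_ : gam (s + a) + tau *: Phi (s + a) - _ = A + tau *: A'); last first.
  by rewrite /A /A' scalerBr opprD !addrA; congr (_ - _); rewrite addrAC.
rewrite (_ : gam (s + b) + tau *: Phi (s + b) - _ = B + tau *: B'); last first.
  by rewrite /B /B' scalerBr opprD !addrA; congr (_ - _); rewrite addrAC.
rewrite edge_density_circle//; last 3 first.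
- by rewrite -normr_gt0.
- by rewrite -normr_gt0.
- by rewrite -normr_gt0.
rewrite -/A -/B -/E0; apply: (le_trans h).
rewrite (_ : E0 * _ = E0 * K * Z `^ p * tau ^+ 2); last ring.
by rewrite ler_wpM2r ?sqr_ge0// ler_wpM2r ?powR_ge0// lerDr.
Qed.

End CircleRemainder.

(** * Triple integrals over triangles; reduction to the longest opposite side *)

Section TripleIntegrals.
Local Open Scope ereal_scope.
Context {R : realType}.
Notation mu := (@lebesgue_measure R).
Notation I := (`[0%R, (pi *+ 2)%R : R]%classic).
Notation J := (`[(- pi)%R, pi%R : R]%classic).
Implicit Types f h : R -> R -> R -> \bar R.

Definition measurable3 f := measurable_fun [set: R * R * R] (fun z => f z.1.1 z.1.2 z.2).

Lemma measurable3_comp d (X : measurableType d) f (a b c : X -> R) : measurable3 f ->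
  measurable_fun [set: X] a -> measurable_fun [set: X] b -> measurable_fun [set: X] c ->
  measurable_fun [set: X] (fun x => f (a x) (b x) (c x)).
Proof.
move=> mf ma mb mc.
apply: (measurableT_comp mf (g := fun x => (a x, b x, c x))).
by apply: measurable_fun_pair => //; exact: measurable_fun_pair.
Qed.

Lemma measurable3_integral f (D : set R) : measurable D -> measurable3 f ->
  (forall s t x, 0 <= f s t x) ->
  measurable_fun [set: R * R] (fun z => \int[mu]_(x in D) f z.1 z.2 x).
Proof. by move=> mD mf f0; exact: (measurable_integral_ge0 mD mf). Qed.

(** The inner two parameters are recentred at s, so they become the offsets a and b. *)
Lemma ge0_integral3_shift f : measurable3 f -> (forall s t x, 0 <= f s t x) ->
  (forall s t x, f s (t + pi *+ 2)%R x = f s t x) ->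
  (forall s t x, f s t (x + pi *+ 2)%R = f s t x) ->
  \int[mu]_(s in I) \int[mu]_(t in I) \int[mu]_(x in I) f s t x =
  \int[mu]_(s in I) \int[mu]_(a in J) \int[mu]_(b in J) f s (s + a)%R (s + b)%R.
Proof.
move=> mf f0 pt px; apply: eq_integral => s _.
have mI := measurable3_integral (measurable_itv `[0%R, (pi *+ 2)%R : R]) mf f0.
rewrite -(@ge0_periodic_integral_center _ _ s); [|exact: pi_gt0| | |]; last 3 first.
- exact: (measurable_fun_pair2 s mI).
- by move=> t; apply: integral_ge0 => x _.
- by move=> t; apply: eq_integral => x _; rewrite pt.
apply: eq_integral => a _.
rewrite -[LHS](@ge0_periodic_integral_center _ _ s)//; first exact: pi_gt0.
exact: measurable3_comp.
Qed.

Lemma ge0_integral3_rotate f (A B C : set R) :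
  measurable A -> measurable B -> measurable C ->
  measurable3 f -> (forall s t x, 0 <= f s t x) ->
  \int[mu]_(s in A) \int[mu]_(t in B) \int[mu]_(x in C) f s t x =
  \int[mu]_(t in B) \int[mu]_(x in C) \int[mu]_(s in A) f s t x.
Proof.
move=> mA mB mC mf f0.
have m2 := measurable3_integral mC mf f0.
have i2 s t : 0 <= \int[mu]_(x in C) f s t x by apply: integral_ge0.
apply: (eq_trans (@ge0_integral_swap _ A B _ mA mB m2 i2)).
apply: eq_integral => t _.
by apply: (@ge0_integral_swap _ A C (fun s x => f s t x) mA mC); [exact: measurable3_comp|].
Qed.

Lemma mule3 (x : \bar R) : 0 <= x -> 3%:E * x = x + x + x.
Proof.
case: x => [x| |]//= x0; last by rewrite gt0_muley ?lte_fin.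
by rewrite -EFinM -!EFinD; congr EFin; ring.
Qed.

(** One of the three numbers is the least, so at least one of the three summands is y. The numbers
    will be the cosines of the three angle differences, the least belonging to the longest side. *)
Lemma le_dominates_split (A B C : R) (y : \bar R) : 0 <= y ->
  y <= (if (C <= A)%R && (C <= B)%R then y else 0) +
       (if (B <= A)%R && (B <= C)%R then y else 0) +
       (if (A <= B)%R && (A <= C)%R then y else 0).
Proof.
move=> y0; case: (leP C A) => CA; case: (leP C B) => CB /=.
- by rewrite -addeA leeDl//; apply: adde_ge0; case: ifP.
- by rewrite (ltW (lt_le_trans CB CA)) (ltW CB) /= add0e leeDl//; case: ifP.
- by rewrite (ltW CA) (ltW (lt_le_trans CA CB)) /= leeDr// add0e; case: ifP.
- case: (leP A B) => AB /=.
    by rewrite (ltW CA) /= leeDr// add0e; case: ifP.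
  by rewrite (ltW AB) (ltW CB)/= add0e leeDl.
Qed.

(** Every triangle has a longest side, opposite one of its three vertices. Since f is symmetric, the
    three cases have the same integral, hence the factor 3. *)
Lemma ge0_integral3_dominates f : measurable3 f -> (forall s t x, 0 <= f s t x) ->
  (forall s t x, f s t x = f s x t) -> (forall s t x, f s t x = f t s x) ->
  (forall s t x, f s (t + pi *+ 2)%R x = f s t x) ->
  \int[mu]_(s in I) \int[mu]_(t in I) \int[mu]_(x in I) f s t x <=
  3%:E * \int[mu]_(s in I) \int[mu]_(a in J) \int[mu]_(b in J)
     (if pair_dominates a b then f s (s + a)%R (s + b)%R else 0).
Proof.
move=> mf f0 fC fCA fp.
(* The cut-off is written in the curve parameters rather than the offsets, so that its permuted
   copies can be compared by Tonelli. *)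
pose h s t x := if pair_dominates (t - s) (x - s) then f s t x else 0.
have h0 s t x : 0 <= h s t x by rewrite /h; case: ifP.
have mh : measurable3 h.
  apply: measurable_fun_ifT => //.
  have m1 : measurable_fun [set: R * R * R] (fun z => z.1.1) by apply: measurableT_comp.
  have m2 : measurable_fun [set: R * R * R] (fun z => z.1.2) by apply: measurableT_comp.
  have mcos d (X : measurableType d) (k : X -> R) : measurable_fun [set: X] k ->
      measurable_fun [set: X] (fun x => cos (k x)).
    by apply: measurableT_comp; apply: continuous_measurable_fun; exact: continuous_cos.
  apply: measurable_and; apply: measurable_fun_ler; apply: mcos;
    do ?apply: measurable_funB => //; exact: measurable_funB.
have hp1 s t x : h s (t + pi *+ 2)%R x = h s t x.
  rewrite /h fp /pair_dominates (_ : t + pi *+ 2 - s = t - s + pi *+ 2)%R; last ring.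
  by rewrite [(_ + _ - (x - s))%R]addrAC !cosD2pi.
have hp2 s t x : h s t (x + pi *+ 2)%R = h s t x.
  rewrite /h fC fp -fC /pair_dominates (_ : x + pi *+ 2 - s = x - s + pi *+ 2)%R; last ring.
  have -> : cos (t - s - (x - s + pi *+ 2))%R = cos (t - s - (x - s))%R.
    by rewrite -[LHS]cosD2pi; congr cos; ring.
  by rewrite cosD2pi.
have -> : \int[mu]_(s in I) \int[mu]_(a in J) \int[mu]_(b in J)
     (if pair_dominates a b then f s (s + a)%R (s + b)%R else 0) =
   \int[mu]_(s in I) \int[mu]_(t in I) \int[mu]_(x in I) h s t x.
  apply/esym/(eq_trans (ge0_integral3_shift mh h0 hp1 hp2)).
  apply: eq_integral => s _; apply: eq_integral => a _; apply: eq_integral => b _.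
  by rewrite /h !(addrC s) !addrK.
set H := \int[mu]_(s in I) \int[mu]_(t in I) \int[mu]_(x in I) h s t x.
have mI := measurable_itv `[0%R, (pi *+ 2)%R : R].
have mh2 : measurable3 (fun s t x => h t s x).
  by apply: (measurable3_comp mh); do ?apply: measurableT_comp.
have mh3 : measurable3 (fun s t x => h x s t).
  by apply: (measurable3_comp mh); do ?apply: measurableT_comp.
have mh12 : measurable3 (fun s t x => h s t x + h t s x) by exact: emeasurable_funD.
have mh123 : measurable3 (fun s t x => h s t x + h t s x + h x s t) by exact: emeasurable_funD.
have H2 : \int[mu]_(s in I) \int[mu]_(t in I) \int[mu]_(x in I) h t s x = H.
  apply: (@ge0_integral_swap _ I I (fun s t => \int[mu]_(x in I) h t s x)) => //.
    exact: (measurable3_integral mI mh2).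
  by move=> s t; apply: integral_ge0.
have H3 : \int[mu]_(s in I) \int[mu]_(t in I) \int[mu]_(x in I) h x s t = H.
  exact/esym/(ge0_integral3_rotate mI mI mI mh h0).
have sumE : \int[mu]_(s in I) \int[mu]_(t in I) \int[mu]_(x in I)
    (h s t x + h t s x + h x s t) = H + H + H.
  have m1 (k : R -> R -> R -> \bar R) : measurable3 k -> (forall s t x, 0 <= k s t x) -> forall s, measurable_fun I
      (fun t => \int[mu]_(x in I) k s t x).
    move=> mk k0 s; apply: measurable_funTS.
    exact: (measurable_fun_pair2 s (measurable3_integral mI mk k0)).
  have m2 (k : R -> R -> R -> \bar R) : measurable3 k -> (forall s t x, 0 <= k s t x) -> measurable_fun I
      (fun s => \int[mu]_(t in I) \int[mu]_(x in I) k s t x).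
    move=> mk k0; apply: measurable_funTS.
    apply: (measurable_integral_ge0 mI (measurable3_integral mI mk k0)) => z.
    by apply: integral_ge0.
  have m0 (k : R -> R -> R -> \bar R) : measurable3 k -> forall s t, measurable_fun I (k s t).
    by move=> mk s t; apply: measurable_funTS; exact: measurable3_comp.
  have i1 (k : R -> R -> R -> \bar R) : (forall s t x, 0 <= k s t x) -> forall s t, 0 <= \int[mu]_(x in I) k s t x.
    by move=> k0 s t; apply: integral_ge0.
  have i2 (k : R -> R -> R -> \bar R) : (forall s t x, 0 <= k s t x) -> forall s,
      0 <= \int[mu]_(t in I) \int[mu]_(x in I) k s t x.
    by move=> k0 s; apply: integral_ge0 => t _; exact: i1.
  have add k1 k2 : measurable3 k1 -> measurable3 k2 ->
     (forall s t x, 0 <= k1 s t x) -> (forall s t x, 0 <= k2 s t x) ->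
     \int[mu]_(s in I) \int[mu]_(t in I) \int[mu]_(x in I) (k1 s t x + k2 s t x) =
     \int[mu]_(s in I) \int[mu]_(t in I) \int[mu]_(x in I) k1 s t x +
     \int[mu]_(s in I) \int[mu]_(t in I) \int[mu]_(x in I) k2 s t x.
    move=> mk1 mk2 k10 k20.
    rewrite -[RHS](@ge0_integralD _ _ _ mu I mI _ _ (fun s _ => i2 _ k10 s) (m2 _ mk1 k10)
      (fun s _ => i2 _ k20 s) (m2 _ mk2 k20)).
    apply: eq_integral => s _.
    rewrite -[RHS](@ge0_integralD _ _ _ mu I mI _ _ (fun t _ => i1 _ k10 s t) (m1 _ mk1 k10 s)
      (fun t _ => i1 _ k20 s t) (m1 _ mk2 k20 s)).
    apply: eq_integral => t _.
    exact: (@ge0_integralD _ _ _ mu I mI _ _ (fun x _ => k10 s t x) (m0 _ mk1 s t)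
      (fun x _ => k20 s t x) (m0 _ mk2 s t)).
  have h120 s t x : 0 <= h s t x + h t s x by exact: adde_ge0.
  apply: (eq_trans (add _ _ mh12 mh3 h120 (fun s t x => h0 x s t))); rewrite H3; congr (_ + _).
  by apply: (eq_trans (add _ _ mh mh2 h0 (fun s t x => h0 t s x))); rewrite H2.
have -> : 3%:E * H = H + H + H.
  have H0 : 0 <= H.
    by apply: integral_ge0 => s _; apply: integral_ge0 => t _; apply: integral_ge0.
  exact: mule3.
rewrite -sumE.
have hs0 s t x : 0 <= h s t x + h t s x + h x s t by rewrite !adde_ge0.
apply: ge0_le_integral; [exact: mI| | | |].
- by move=> s _; apply: integral_ge0 => t _; apply: integral_ge0.
- apply: measurable_funTS; apply: (measurable_integral_ge0 mI (measurable3_integral mI mf f0)) => z.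
  by apply: integral_ge0.
- apply: measurable_funTS; apply: (measurable_integral_ge0 mI (measurable3_integral mI mh123 hs0)) => z.
  by apply: integral_ge0.
move=> s _; apply: ge0_le_integral; [exact: mI| | | |].
- by move=> t _; apply: integral_ge0.
- by apply: measurable_funTS; exact: (measurable_fun_pair2 s (measurable3_integral mI mf f0)).
- by apply: measurable_funTS; exact: (measurable_fun_pair2 s (measurable3_integral mI mh123 hs0)).
move=> t _; apply: ge0_le_integral; [exact: mI|by []| | |].
- by apply: measurable_funTS; exact: measurable3_comp.
- by apply: measurable_funTS; exact: (measurable3_comp mh123).
move=> x _.
have e1 : h s t x = if pair_dominates (t - s) (x - s) then f s t x else 0 by [].
have e2 : h t s x = if pair_dominates (s - t) (x - t) then f s t x else 0.
  by rewrite /h -fCA.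
have e3 : h x s t = if pair_dominates (s - x) (t - x) then f s t x else 0.
  by rewrite /h fCA fC.
rewrite e1 e2 e3 /pair_dominates.
have s1 (y z w : R) : (y - w - (z - w) = y - z)%R by ring.
rewrite !s1.
have c1 : cos (s - t)%R = cos (t - s)%R by rewrite -cosN opprB.
have c2 : cos (s - x)%R = cos (x - s)%R by rewrite -cosN opprB.
have c3 : cos (t - x)%R = cos (x - t)%R by rewrite -cosN opprB.
rewrite c1 c2 c3.
set A := cos (t - s)%R; set B := cos (x - s)%R; set C := cos (x - t)%R.
exact: le_dominates_split.
Qed.

End TripleIntegrals.

(** * Linearity and monotonicity of iterated integrals of nonnegative functions *)

Section TripleIntegralAlgebra.
Local Open Scope ereal_scope.
Context {R : realType}.
Notation mu := (@lebesgue_measure R).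
Variables (A B C : set R).
Hypotheses (mA : measurable A) (mB : measurable B) (mC : measurable C).
Implicit Types f h : R -> R -> R -> \bar R.

Definition integral3 f := \int[mu]_(s in A) \int[mu]_(t in B) \int[mu]_(x in C) f s t x.

Let m1 f s : measurable3 f -> (forall s t x, 0 <= f s t x) ->
  measurable_fun B (fun t => \int[mu]_(x in C) f s t x).
Proof.
move=> mf f0; apply: measurable_funTS.
exact: (measurable_fun_pair2 s (measurable3_integral mC mf f0)).
Qed.

Let m2 f : measurable3 f -> (forall s t x, 0 <= f s t x) ->
  measurable_fun A (fun s => \int[mu]_(t in B) \int[mu]_(x in C) f s t x).
Proof.
move=> mf f0; apply: measurable_funTS.
apply: (measurable_integral_ge0 mB (measurable3_integral mC mf f0)) => z.
by apply: integral_ge0.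
Qed.

Let m0 f s t : measurable3 f -> measurable_fun C (f s t).
Proof. by move=> mf; apply: measurable_funTS; exact: measurable3_comp. Qed.

Let i1 f s t : (forall s t x, 0 <= f s t x) -> 0 <= \int[mu]_(x in C) f s t x.
Proof. by move=> f0; apply: integral_ge0. Qed.

Let i2 f s : (forall s t x, 0 <= f s t x) ->
  0 <= \int[mu]_(t in B) \int[mu]_(x in C) f s t x.
Proof. by move=> f0; apply: integral_ge0 => t _; exact: i1. Qed.

Lemma integral3_ge0 f : (forall s t x, 0 <= f s t x) -> 0 <= integral3 f.
Proof. by move=> f0; apply: integral_ge0 => s _; exact: i2. Qed.

Lemma ge0_integral3D f h : measurable3 f -> measurable3 h ->
  (forall s t x, 0 <= f s t x) -> (forall s t x, 0 <= h s t x) ->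
  integral3 (fun s t x => f s t x + h s t x) = integral3 f + integral3 h.
Proof.
move=> mf mh f0 h0; rewrite /integral3.
rewrite -[RHS](@ge0_integralD _ _ _ mu A mA _ _ (fun s _ => i2 s f0) (m2 mf f0)
  (fun s _ => i2 s h0) (m2 mh h0)).
apply: eq_integral => s _.
rewrite -[RHS](@ge0_integralD _ _ _ mu B mB _ _ (fun t _ => i1 s t f0) (m1 s mf f0)
  (fun t _ => i1 s t h0) (m1 s mh h0)).
apply: eq_integral => t _.
exact: (@ge0_integralD _ _ _ mu C mC _ _ (fun x _ => f0 s t x) (m0 s t mf)
  (fun x _ => h0 s t x) (m0 s t mh)).
Qed.

Lemma ge0_integral3Zl f (k : R) : measurable3 f -> (forall s t x, 0 <= f s t x) ->
  (0 <= k)%R -> integral3 (fun s t x => k%:E * f s t x) = k%:E * integral3 f.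
Proof.
move=> mf f0 k0; rewrite /integral3.
rewrite -[RHS](@ge0_integralZl_EFin _ _ _ mu A mA _ (fun s _ => i2 s f0) (m2 mf f0) k k0).
apply: eq_integral => s _.
rewrite -[RHS](@ge0_integralZl_EFin _ _ _ mu B mB _ (fun t _ => i1 s t f0) (m1 s mf f0) k k0).
apply: eq_integral => t _.
exact: (@ge0_integralZl_EFin _ _ _ mu C mC _ (fun x _ => f0 s t x) (m0 s t mf) k k0).
Qed.

Lemma ge0_le_integral3 f h : measurable3 f -> measurable3 h ->
  (forall s t x, 0 <= f s t x) -> (forall s t x, 0 <= h s t x) ->
  (forall s t x, A s -> B t -> C x -> f s t x <= h s t x) -> integral3 f <= integral3 h.
Proof.
move=> mf mh f0 h0 fh.
apply: ge0_le_integral; [exact: mA|by move=> s _; exact: i2|exact: m2|exact: m2|].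
move=> s As; apply: ge0_le_integral; [exact: mB|by move=> t _; exact: i1|exact: m1|exact: m1|].
move=> t Bt; apply: ge0_le_integral; [exact: mC|by []|exact: m0|exact: m0|].
by move=> x Cx; exact: fh.
Qed.

End TripleIntegralAlgebra.

(** * A Hardy inequality for local averages *)

Section Hardy.
Local Open Scope ereal_scope.
Context {R : realType}.
Notation mu := (@lebesgue_measure R).
Notation I := (`[0%R, (pi *+ 2)%R : R]%classic).
Notation J := (`[(- pi)%R, pi%R : R]%classic).

(** The antiderivative is atan(x / c) / c, and the arctangent stays below pi/2. *)
Lemma integral_cauchy_kernel (c : R) : (0 < c)%R ->
  \int[mu]_(x in J) ((c ^+ 2 + x ^+ 2)^-1)%:E <= (pi / c)%:E.
Proof.
move=> c0; have c2 : (c != 0)%R by rewrite gt_eqF.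
have cx x : (0 < c ^+ 2 + x ^+ 2)%R by rewrite ltr_wpDr ?sqr_ge0// exprn_gt0.
pose F x := (c^-1 * atan (c^-1 * x))%R.
have dF (x : R) : is_derive x 1%R F ((c ^+ 2 + x ^+ 2)^-1)%R.
  apply: (@is_derive_eq1 _ _ _ (c^-1 * ((1 + (c^-1 * x) ^+ 2)^-1 * (c^-1 * 1)))%R).
  by field; rewrite c2 gt_eqF.
have cf : continuous (fun x : R => (c ^+ 2 + x ^+ 2)^-1)%R.
  move=> x; apply: (@continuousV _ _ (fun x : R => c ^+ 2 + x ^+ 2)%R); first by rewrite gt_eqF.
  apply: continuousD; first exact: cst_continuous.
  exact: exprn_continuous.
rewrite (@continuous_FTC2 _ _ F).
- rewrite -EFinB lee_fin /F mulrN atanN mulrN opprK.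
  have := atan_ltpi2 (c^-1 * pi)%R => h.
  rewrite -mulrDr mulrC ler_wpM2r ?invr_ge0 ?(ltW c0)//.
  by rewrite [leRHS]splitr lerD// ltW.
- by have := @pi_gt0 R; lra.
- exact: continuous_subspaceT.
- split.
  + by move=> x _; have [] := dF x.
  + by apply: cvg_at_right_filter; exact: (is_derive_continuous (dF _)).
  + by apply: cvg_at_left_filter; exact: (is_derive_continuous (dF _)).
- by move=> x _; rewrite derive1E; have [_ ->] := dF x.
Qed.

Variables (p : R) (G : R -> R -> R).
Implicit Types a b s w : R.
Hypotheses (p2 : (2 <= p)%R) (mG : measurable_fun [set: R * R] (fun z => G z.1 z.2)).
Hypotheses (G_ge0 : forall s w, (0 <= G s w)%R) (G0 : forall s, G s 0%R = 0%R).

(** The mass of G(s, .) within distance |a| of 0. Divided by |a| it bounds the p-th power of a slope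
    error. *)
Definition local_mass (s a : R) : \bar R :=
  \int[mu]_(w in J) (if (`|w| <= `|a|)%R then (G s w)%:E else 0).

(** A majorant of 1 / (|a| (|a| + |b|)^p) for p >= 2, chosen because it is integrated in b by an
    arctangent. *)
Definition hardy_kernel (a b : R) : R := (`|a| `^ (1 - p) / (a ^+ 2 + b ^+ 2))%R.

Lemma local_mass_ge0 s a : 0 <= local_mass s a.
Proof. by apply: integral_ge0 => w _; case: ifP => // _; rewrite lee_fin. Qed.

Lemma hardy_kernel_ge0 a b : (0 <= hardy_kernel a b)%R.
Proof. by rewrite divr_ge0 ?powR_ge0// addr_ge0 ?sqr_ge0. Qed.

Lemma measurable_inv_ge0 d (X : measurableType d) (f : X -> R) :
  (forall x, 0 <= f x)%R -> measurable_fun [set: X] f ->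
  measurable_fun [set: X] (fun x => (f x)^-1)%R.
Proof.
move=> f0 mf; under eq_fun do rewrite -powR_inv1//.
exact: (measurableT_comp (@measurable_powR R _) mf).
Qed.

Lemma measurable_hardy_kernel : measurable_fun [set: R * R] (fun z => hardy_kernel z.1 z.2).
Proof.
apply: measurable_funM.
  apply: (measurableT_comp (@measurable_powR R (1 - p))).
  exact: measurableT_comp.
apply: measurable_inv_ge0; first by move=> z; rewrite addr_ge0 ?sqr_ge0.
by apply: measurable_funD; apply: measurable_funX.
Qed.

Lemma measurable_local_mass : measurable_fun [set: R * R] (fun z => local_mass z.1 z.2).
Proof.
apply: (@measurable_integral_ge0 _ _ _ J
  (fun z : (R * R) * R => if (`|z.2| <= `|z.1.2|)%R then (G z.1.1 z.2)%:E else 0)) => //.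
- apply: measurable_fun_ifT => //.
  + apply: measurable_fun_ler; apply: measurableT_comp => //.
    exact: measurableT_comp.
  + apply/measurable_EFinP.
    apply: (measurableT_comp mG (g := fun z : (R * R) * R => (z.1.1, z.2))).
    by apply: measurable_fun_pair => //; apply: measurableT_comp.
- by move=> z; case: ifP => // _; rewrite lee_fin.
Qed.

Let inner_kernel (a : R) : \int[mu]_(b in J) (hardy_kernel a b)%:E <= (pi * `|a| `^ (- p))%:E.
Proof.
(* For a = 0 the kernel vanishes identically, since 0 to the power 1 - p is 0 when p differs from
   1. *)
have [->|a0] := eqVneq a 0%R.
  rewrite integral0_eq ?lee_fin ?mulr_ge0 ?powR_ge0 ?pi_ge0//.
  by move=> b _; rewrite /hardy_kernel normr0 powR0 ?mul0r// subr_eq0 lt_eqF// (lt_le_trans _ p2)// ltr1n.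
have na : (0 < `|a|)%R by rewrite normr_gt0.
under eq_integral do rewrite EFinM -(real_normK (num_real a)).
rewrite ge0_integralZl//=; last 2 first.
- apply: measurable_funTS; apply/measurable_EFinP; apply: measurable_inv_ge0.
  + by move=> b; rewrite addr_ge0 ?sqr_ge0.
  + by apply: measurable_funD => //; exact: measurable_funX.
- by move=> b _; rewrite lee_fin invr_ge0 addr_ge0 ?sqr_ge0.
apply: (le_trans (lee_wpmul2l _ (integral_cauchy_kernel na))); first by rewrite lee_fin powR_ge0.
rewrite -EFinM lee_fin mulrCA ler_wpM2l ?pi_ge0//.
rewrite -(powR_inv1 (ltW na)) -powRD; last by rewrite (gt_eqF na) implybT.
by rewrite (_ : 1 - p + -1 = - p)%R//; ring.
Qed.

(** For |a| >= |w| one has |a|^(2 - p) <= |w|^(2 - p) and w^2 + a^2 <= 2 a^2, so |a|^(-p) is at most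
    2 |w|^(2 - p) / (w^2 + a^2). Integrating the Cauchy kernel then yields |w|^(1 - p). *)
Let outer_kernel (s w : R) : \int[mu]_(a in J)
   (if (`|w| <= `|a|)%R then (`|a| `^ (- p) * G s w)%:E else 0) <=
   (2 * pi * (G s w / `|w| `^ (p - 1)))%:E.
Proof.
have [->|w0] := eqVneq w 0%R.
  rewrite integral0_eq; last by move=> a _; rewrite G0 mulr0 if_same.
  by rewrite G0 mul0r mulr0.
have nw : (0 < `|w|)%R by rewrite normr_gt0.
pose c := (G s w * (2 * `|w| `^ (2 - p)))%R.
have c0 : (0 <= c)%R by rewrite mulr_ge0// mulr_ge0// powR_ge0.
apply: (@le_trans _ _ (\int[mu]_(a in J) (c%:E * ((`|w| ^+ 2 + a ^+ 2)^-1)%:E))).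
  apply: ge0_le_integral => //.
  - by move=> a _; case: ifP => // _; rewrite lee_fin mulr_ge0 ?powR_ge0.
  - apply: measurable_funTS; apply: measurable_fun_ifT => //.
      apply: measurable_fun_ler => //; exact: measurableT_comp.
    apply/measurable_EFinP; apply: measurable_funM => //.
    by apply: (measurableT_comp (@measurable_powR R (- p))).
  - apply: measurable_funTS; apply/measurable_EFinP; apply: measurable_funM => //.
    apply: measurable_inv_ge0.
    + by move=> b; rewrite addr_ge0 ?sqr_ge0.
    + by apply: measurable_funD => //; exact: measurable_funX.
  move=> a _; case: ifPn => [wa|_]; last first.
    by rewrite -EFinM lee_fin mulr_ge0// invr_ge0 addr_ge0 ?sqr_ge0.
  rewrite -EFinM lee_fin /c mulrC -[leRHS]mulrA ler_wpM2l//.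
  have na : (0 < `|a|)%R by exact: lt_le_trans wa.
  rewrite ler_pdivlMr; last by rewrite ltr_wpDr ?sqr_ge0// exprn_gt0.
  apply: (@le_trans _ _ (`|a| `^ (- p) * (2 * `|a| ^+ 2)))%R.
    rewrite ler_wpM2l ?powR_ge0// -[in leLHS](real_normK (num_real a)) mulrDl mul1r lerD2r.
    by rewrite lerXn2r// nnegrE.
  rewrite -(powR_mulrn 2 (ltW na)) mulrCA ler_wpM2l// -powRD; last by rewrite (gt_eqF na) implybT.
  rewrite (_ : - p + 2 = - (p - 2))%R; last ring.
  rewrite (_ : 2 - p = - (p - 2))%R; last ring.
  rewrite !powRN lef_pV2 ?posrE ?powR_gt0//.
  by apply: ge0_ler_powR; rewrite ?nnegrE ?subr_ge0.
rewrite ge0_integralZl//=; last 2 first.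
- apply: measurable_funTS; apply/measurable_EFinP; apply: measurable_inv_ge0.
  + by move=> b; rewrite addr_ge0 ?sqr_ge0.
  + by apply: measurable_funD => //; exact: measurable_funX.
- by move=> b _; rewrite lee_fin invr_ge0 addr_ge0 ?sqr_ge0.
apply: (le_trans (lee_wpmul2l _ (integral_cauchy_kernel nw))) => //.
rewrite -EFinM lee_fin /c le_eqVlt; apply/orP; left; apply/eqP.
rewrite -powRN.
have -> : (`|w| `^ (- (p - 1)) = `|w| `^ (2 - p) * `|w|^-1)%R.
  rewrite -(powR_inv1 (ltW nw)) -powRD; last by rewrite (gt_eqF nw) implybT.
  by congr (_ `^ _)%R; ring.
by ring.
Qed.

(** Integrating b out leaves pi |a|^(-p). Exchanging a with the variable w of the local mass leaves
    the integral of |a|^(-p) over |a| >= |w|, which produces the Slobodeckii weight |w|^(1 - p). *)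
Lemma hardy_slice s :
  \int[mu]_(a in J) \int[mu]_(b in J) ((hardy_kernel a b)%:E * local_mass s a) <=
  (2 * pi ^+ 2)%:E * \int[mu]_(w in J) (G s w / `|w| `^ (p - 1))%:E.
Proof.
have mker a : measurable_fun [set: R] (fun b => (hardy_kernel a b)%:E).
  by apply/measurable_EFinP; exact: (measurable_fun_pair2 a measurable_hardy_kernel).
have mloc : measurable_fun [set: R] (fun a => local_mass s a).
  exact: (measurable_fun_pair2 s measurable_local_mass).
have mp (e : R) : measurable_fun [set: R] (fun a : R => `|a| `^ e)%R.
  by apply: (measurableT_comp (@measurable_powR R e)).
have mGs : measurable_fun [set: R] (G s) := measurable_fun_pair2 s mG.
apply: (@le_trans _ _ (\int[mu]_(a in J) (pi%:E * ((`|a| `^ (- p))%:E * local_mass s a)))).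
  apply: ge0_le_integral => //.
  - move=> a _; apply: integral_ge0 => b _.
    by rewrite mule_ge0 ?lee_fin ?hardy_kernel_ge0 ?local_mass_ge0.
  - apply: measurable_funTS; apply: (@measurable_integral_ge0 _ _ _ J
      (fun z : R * R => (hardy_kernel z.1 z.2)%:E * local_mass s z.1)) => //.
    + apply: emeasurable_funM; first by apply/measurable_EFinP; exact: measurable_hardy_kernel.
      exact: measurableT_comp.
    + by move=> z; rewrite mule_ge0 ?lee_fin ?hardy_kernel_ge0 ?local_mass_ge0.
  - apply: measurable_funTS; apply: measurable_funeM; apply: emeasurable_funM => //.
    by apply/measurable_EFinP; exact: mp.
  move=> a _; under eq_integral do rewrite muleC.
  rewrite ge0_integralZl ?local_mass_ge0//; last 2 first.
  - by apply: measurable_funTS; exact: mker.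
  - by move=> b _; rewrite lee_fin hardy_kernel_ge0.
  rewrite muleA -EFinM muleC lee_wpmul2r ?local_mass_ge0//.
rewrite ge0_integralZl//=; last 3 first.
- by apply: measurable_funTS; apply: emeasurable_funM => //; apply/measurable_EFinP; exact: mp.
- by move=> a _; rewrite mule_ge0 ?lee_fin ?powR_ge0 ?local_mass_ge0.
- by rewrite lee_fin pi_ge0.
rewrite (_ : 2 * pi ^+ 2 = pi * (2 * pi))%R; last ring.
rewrite EFinM -muleA lee_wpmul2l ?lee_fin ?pi_ge0//.
pose k (a w : R) : \bar R := if (`|w| <= `|a|)%R then (`|a| `^ (- p) * G s w)%:E else 0.
have k0 a w : 0 <= k a w by rewrite /k; case: ifP => // _; rewrite lee_fin mulr_ge0 ?powR_ge0.
have mk : measurable_fun [set: R * R] (fun z => k z.1 z.2).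
  apply: measurable_fun_ifT => //.
    by apply: measurable_fun_ler; apply: measurableT_comp.
  apply/measurable_EFinP; apply: measurable_funM.
    by apply: (measurableT_comp (mp (- p)%R)).
  exact: (measurableT_comp mGs).
have -> : \int[mu]_(a in J) ((`|a| `^ (- p))%:E * local_mass s a) =
    \int[mu]_(a in J) \int[mu]_(w in J) k a w.
  apply: eq_integral => a _; rewrite /local_mass -ge0_integralZl ?lee_fin ?powR_ge0//; last 2 first.
  - apply: measurable_funTS; apply: measurable_fun_ifT => //; last by apply/measurable_EFinP.
    by apply: measurable_fun_ler => //; exact: measurableT_comp.
  - by move=> w _; case: ifP => // _; rewrite lee_fin.
  by apply: eq_integral => w _; rewrite /k; case: ifP => _; rewrite ?mule0 ?EFinM.
rewrite -ge0_integralZl//; last 3 first.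
- apply: measurable_funTS; apply/measurable_EFinP; apply: measurable_funM => //.
  by apply: measurable_inv_ge0; [move=> w; exact: powR_ge0|exact: mp].
- by move=> w _; rewrite lee_fin divr_ge0 ?powR_ge0.
- by rewrite lee_fin mulr_ge0 ?pi_ge0.
rewrite (@ge0_integral_swap _ J J k)//; apply: ge0_le_integral => //.
- by move=> w _; apply: integral_ge0.
- apply: measurable_funTS; apply: (@measurable_integral_ge0 _ _ _ J (fun z : R * R => k z.2 z.1)) => //.
  exact: (measurableT_comp mk (@measurable_swap _ _ _ _)).
- apply: measurable_funTS; apply: measurable_funeM; apply/measurable_EFinP.
  by apply: measurable_funM => //; apply: measurable_inv_ge0; [move=> w; exact: powR_ge0|exact: mp].
by move=> w _; rewrite -EFinM; exact: outer_kernel.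
Qed.

Lemma hardy_integral :
  \int[mu]_(s in I) \int[mu]_(a in J) \int[mu]_(b in J) ((hardy_kernel a b)%:E * local_mass s a) <=
  (2 * pi ^+ 2)%:E * \int[mu]_(s in I) \int[mu]_(w in J) (G s w / `|w| `^ (p - 1))%:E.
Proof.
have mq : measurable_fun [set: R * R] (fun z : R * R => (G z.1 z.2 / `|z.2| `^ (p - 1))%:E).
  apply/measurable_EFinP; apply: measurable_funM => //.
  apply: measurable_inv_ge0; first by move=> z; exact: powR_ge0.
  apply: (measurableT_comp (@measurable_powR R (p - 1))); exact: measurableT_comp.
have q0 (z : R * R) : 0 <= (G z.1 z.2 / `|z.2| `^ (p - 1))%:E.
  by rewrite lee_fin divr_ge0 ?powR_ge0.
have mJ := measurable_itv `[(- pi)%R, pi%R : R].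
have mI := measurable_itv `[0%R, (pi *+ 2)%R : R].
have m1 := measurable_integral_ge0 mJ mq q0.
rewrite -ge0_integralZl; [|exact: mI|exact: measurable_funTS| |]; last 2 first.
- by move=> s _; apply: integral_ge0 => w _; exact: (q0 (s, w)).
- by rewrite lee_fin mulr_ge0// exprn_ge0// pi_ge0.
have mh : measurable3 (fun s a b => (hardy_kernel a b)%:E * local_mass s a).
  apply: emeasurable_funM.
    apply/measurable_EFinP.
    apply: (measurableT_comp measurable_hardy_kernel (g := fun z : R * R * R => (z.1.2, z.2))).
    by apply: measurable_fun_pair => //; exact: measurableT_comp.
  apply: (measurableT_comp measurable_local_mass (g := fun z : R * R * R => (z.1.1, z.1.2))).
  by apply: measurable_fun_pair => //; exact: measurableT_comp.
have h0 s a b : 0 <= (hardy_kernel a b)%:E * local_mass s a.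
  by rewrite mule_ge0 ?lee_fin ?hardy_kernel_ge0 ?local_mass_ge0.
apply: ge0_le_integral; [exact: mI| | | |].
- by move=> s _; apply: integral_ge0 => a _; apply: integral_ge0 => b _.
- apply: measurable_funTS; apply: (measurable_integral_ge0 mJ (measurable3_integral mJ mh h0)) => z.
  by apply: integral_ge0.
- by apply: measurable_funTS; apply: measurable_funeM.
- by move=> s _; exact: hardy_slice.
Qed.

End Hardy.

(** * Measurability of vector expressions *)

Section VectorMeasurability.
Context {R : realType} d (X : measurableType d).
Implicit Types f h : X -> 'rV[R]_3.

Definition measurable_vec f := forall i, measurable_fun [set: X] (fun x => f x 0 i).

Lemma measurable_vecD f h : measurable_vec f -> measurable_vec h ->
  measurable_vec (fun x => f x + h x).
Proof. by move=> mf mh i; under eq_fun do rewrite mxE; exact: measurable_funD. Qed.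

Lemma measurable_vecB f h : measurable_vec f -> measurable_vec h ->
  measurable_vec (fun x => f x - h x).
Proof.
move=> mf mh i; under eq_fun do rewrite mxE [X in _ + X]mxE.
exact: measurable_funB.
Qed.

Lemma measurable_vecZ (k : R) f : measurable_vec f -> measurable_vec (fun x => k *: f x).
Proof. by move=> mf i; under eq_fun do rewrite mxE; exact: measurable_funM. Qed.

Lemma measurable_dot f h : measurable_vec f -> measurable_vec h ->
  measurable_fun [set: X] (fun x => dot (f x) (h x)).
Proof.
move=> mf mh; under eq_fun do rewrite dotE.
by do ?apply: measurable_funD; apply: measurable_funM.
Qed.

Lemma measurable_enorm f : measurable_vec f -> measurable_fun [set: X] (fun x => enorm (f x)).
Proof.
move=> mf; rewrite /enorm; under eq_fun do rewrite -powR12_sqrt ?dot_ge0//.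
by apply: (measurableT_comp (@measurable_powR R 2^-1)); exact: measurable_dot.
Qed.

Lemma measurable_cross f h : measurable_vec f -> measurable_vec h ->
  measurable_vec (fun x => cross (f x) (h x)).
Proof.
move=> mf mh i; under eq_fun do rewrite mxE.
by apply: measurable_funB; apply: measurable_funM.
Qed.

Lemma measurable_edge_density (p : R) A B T1 T2 T3 :
  measurable_vec A -> measurable_vec B -> measurable_vec T1 -> measurable_vec T2 ->
  measurable_vec T3 ->
  measurable_fun [set: X] (fun x => edge_density p (A x) (B x) (T1 x) (T2 x) (T3 x)).
Proof.
move=> mA mB m1 m2 m3.
do 3 (apply: measurable_funM; last exact: measurable_enorm).
apply: (measurableT_comp (@measurable_powR R p)).
apply: measurable_funM.
  by apply: measurable_funM => //; apply/measurable_enorm/measurable_cross.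
apply: measurable_inv_ge0; first by move=> x; rewrite !mulr_ge0 ?enorm_ge0.
do 2 (apply: measurable_funM; last by apply: measurable_enorm; do ?apply: measurable_vecB).
exact: measurable_enorm.
Qed.

Lemma measurable_edge_variation (p : R) A B T1 T2 T3 A' B' G1 G2 G3 :
  measurable_vec A -> measurable_vec B -> measurable_vec T1 -> measurable_vec T2 ->
  measurable_vec T3 -> measurable_vec A' -> measurable_vec B' -> measurable_vec G1 ->
  measurable_vec G2 -> measurable_vec G3 ->
  measurable_fun [set: X] (fun x => edge_variation p (A x) (B x) (T1 x) (T2 x) (T3 x)
    (A' x) (B' x) (G1 x) (G2 x) (G3 x)).
Proof.
move=> mA mB m1 m2 m3 mA' mB' n1 n2 n3.
have mdiv V W : measurable_vec V -> measurable_vec W ->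
    measurable_fun [set: X] (fun x => dot (V x) (W x) / dot (V x) (V x)).
  move=> mV mW; apply: measurable_funM; first exact: measurable_dot.
  by apply: measurable_inv_ge0; [move=> x; exact: dot_ge0|exact: measurable_dot].
have mAB := measurable_cross mA mB.
apply: measurable_funD.
  apply: measurable_funM => //; do ?apply: measurable_funB; apply: mdiv => //;
    do ?[exact: measurable_vecB|apply: measurable_vecD; exact: measurable_cross].
by do ?apply: measurable_funD; apply: mdiv.
Qed.

End VectorMeasurability.


(** * Slope errors bounded by local oscillation of the derivative *)

Section QuotientError.
Context {R : realType}.
Notation mu := (@lebesgue_measure R).
Notation J := (`[(- pi)%R, pi%R : R]%classic).

Lemma integral_derivative (f df : R -> R) (a b : R) : a < b ->
  (forall x : R, is_derive x 1 f (df x)) -> continuous df ->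
  (\int[mu]_(x in `[a, b]) (df x)%:E = (f b - f a)%:E)%E.
Proof.
move=> ab fd cdf; rewrite EFinB; apply: continuous_FTC2 => //.
- exact: continuous_subspaceT.
- split.
  + by move=> x _; have [] := fd x.
  + by apply: cvg_at_right_filter; exact: (is_derive_continuous (fd _)).
  + by apply: cvg_at_left_filter; exact: (is_derive_continuous (fd _)).
- by move=> x _; rewrite derive1E; have [_ ->] := fd x.
Qed.

Lemma le_integral_derivative (f df : R -> R) (a b : R) : a <= b ->
  (forall x : R, is_derive x 1 f (df x)) -> continuous df ->
  (`|f b - f a|%:E <= \int[mu]_(x in `[a, b]) `|df x|%:E)%E.
Proof.
rewrite le_eqVlt => /orP[/eqP ->|ab] fd cdf.
  by rewrite subrr normr0; apply: integral_ge0 => x _; rewrite lee_fin.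
rewrite -[leLHS]/(`|(f b - f a)%:E|)%E -(integral_derivative ab fd cdf).
apply: (le_abse_integral mu) => //.
by apply/measurable_EFinP; apply: measurable_funTS; exact: continuous_measurable_fun.
Qed.

Variables (Phi g : R -> 'rV[R]_3) (p : R).
Hypothesis p1 : 1 <= p.
Hypothesis dPhi : forall x : R, is_derive x 1 Phi (g x).
Hypothesis cg : forall i, continuous (fun x => g x 0 i).

(** The numerator of the Slobodeckii integrand; it takes the place of G in the Hardy inequality. *)
Definition jump_power (g : R -> 'rV[R]_3) (s w : R) : R := enorm (g (s + w) - g s) `^ p.

Lemma measurable_jump_power :
  measurable_fun [set: R * R] (fun z => jump_power g z.1 z.2).
Proof.
have mg i : measurable_fun [set: R] (fun x => g x 0 i).
  exact: continuous_measurable_fun.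
apply: (measurableT_comp (@measurable_powR R p)); apply: measurable_enorm.
apply: measurable_vecB => i; apply: (measurableT_comp (mg i)) => //.
exact: measurable_funD.
Qed.

(** Coordinatewise, the slope error is the mean of g(s + w) - g(s) over w between 0 and a. Young's
    inequality is applied under the integral, and [enorm_le_coord] contributes the factor 2. *)
Lemma quotient_error_young (s a lambda : R) : - pi <= a <= pi -> a != 0 -> 0 < lambda ->
  ((quotient_error Phi g s a)%:E <=
   (2 * lambda)%:E + (2 * lambda `^ (1 - p) / `|a|)%:E * local_mass (jump_power g) s a)%E.
Proof.
move=> aJ a0 l0.
set m := local_mass _ _ _.
have m0 : (0 <= m)%E by apply: local_mass_ge0 => *; exact: powR_ge0.
have na : 0 < `|a| by rewrite normr_gt0.
have lp0 : 0 <= lambda `^ (1 - p) by exact: powR_ge0.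
have [mfin|] := boolP (m \is a fin_num); last first.
  rewrite ge0_fin_numE// -leNgt leye_eq => /eqP ->.
  by rewrite gt0_muley ?lte_fin ?divr_gt0 ?mulr_gt0 ?powR_gt0// addey// leey.
rewrite -(fineK mfin) -EFinM -EFinD lee_fin.
have -> : 2 * lambda + 2 * lambda `^ (1 - p) / `|a| * fine m =
    2 * (lambda + lambda `^ (1 - p) * fine m / `|a|) by field; rewrite gt_eqF.
apply: enorm_le_coord => i; rewrite !mxE.
(* The antiderivative of the jump: psi(a) - psi(0) is a times the coordinate of the slope error. *)
pose psi w := Phi (s + w) 0 i - g s 0 i * w.
pose dpsi w := g (s + w) 0 i - g s 0 i.
have dpsiP (w : R) : is_derive w 1 psi (dpsi w).
  have ds : is_derive w 1 (fun w => s + w) 1.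
    by apply: (@is_derive_eq1 _ _ _ (0 + 1)); rewrite add0r.
  have d1 := is_derive_comp (is_derive_coord i (dPhi (s + w))) ds.
  have d2 : is_derive w 1 (fun w => g s 0 i * w) (g s 0 i).
    by apply: (@is_derive_eq1 _ _ _ (g s 0 i * 1)); rewrite mulr1.
  by rewrite mulr1 in d1; exact: is_derive_sub.
have cdpsi : continuous dpsi.
  move=> w; apply: continuousB; last exact: cst_continuous.
  apply: (@continuous_comp _ _ _ (fun w => s + w) (fun x => g x 0 i)); last exact: cg.
  by apply: continuousD; [exact: cst_continuous|exact: cvg_id].
(* The endpoints 0 and a in increasing order, so that both signs of a are treated at once. *)
pose c : R := Num.min 0 a; pose e : R := Num.max 0 a.
have [c0 ce ecE] : [/\ - pi <= c /\ e <= pi, c <= e & e - c = `|a|].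
  rewrite /c /e; have := @pi_ge0 R; case: (ltP 0 a) => a1 pi0.
    by rewrite (gtr0_norm a1) subr0; split; [split|lra|]; lra.
  by rewrite (ler0_norm a1); split; [split|lra|]; lra.
have absw w : c <= w <= e -> `|w| <= `|a|.
  rewrite /c /e ler_norml; case: (ltP 0 a) => a1.
    by rewrite (gtr0_norm a1); lra.
  by rewrite (ler0_norm a1); lra.
have psiE : `|psi a - psi 0| = `|psi e - psi c|.
  by rewrite /c /e; case: (ltP 0 a) => a1 //; rewrite distrC.
have bnd : (`|psi e - psi c|%:E <=
    \int[mu]_(w in `[c, e]) (lambda%:E + (lambda `^ (1 - p))%:E * (jump_power g s w)%:E))%E.
  have mj : measurable_fun [set: R] (jump_power g s) := measurable_fun_pair2 s measurable_jump_power.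
  apply: (le_trans (le_integral_derivative ce dpsiP cdpsi)).
  apply: ge0_le_integral => //.
  - apply/measurable_EFinP; apply: measurable_funTS; apply: measurableT_comp => //.
    exact: continuous_measurable_fun.
  - apply: measurable_funTS; apply: emeasurable_funD => //.
    by apply: measurable_funeM; apply/measurable_EFinP.
  move=> w _; rewrite -EFinM -EFinD lee_fin mulrC.
  have := coord_le_enorm (g (s + w) - g s) i; rewrite !mxE => h.
  by apply: (le_trans h); apply: le_young => //; exact: enorm_ge0.
have jint : (\int[mu]_(w in `[c, e]) (jump_power g s w)%:E <= m)%E.
  have mj : measurable_fun [set: R] (jump_power g s) := measurable_fun_pair2 s measurable_jump_power.
  have -> : (\int[mu]_(w in `[c, e]) (jump_power g s w)%:E =
      \int[mu]_(w in `[c, e]) (if (`|w| <= `|a|)%R then (jump_power g s w)%:E else 0))%E.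
    apply: eq_integral => w; rewrite inE/= in_itv/= => wI.
    by rewrite absw.
  apply: ge0_subset_integral => //.
  - apply: measurable_funTS; apply: measurable_fun_ifT => //; last by apply/measurable_EFinP.
    by apply: measurable_fun_ler => //; exact: measurableT_comp.
  - by move=> w _; case: ifP => // _; rewrite lee_fin powR_ge0.
  - move=> w /=; rewrite !in_itv/= => /andP[cw we].
    by rewrite (le_trans c0.1 cw) (le_trans we c0.2).
have main : `|psi a - psi 0| <= lambda * `|a| + lambda `^ (1 - p) * fine m.
  rewrite psiE -lee_fin; apply: (le_trans bnd).
  have mj : measurable_fun [set: R] (jump_power g s) := measurable_fun_pair2 s measurable_jump_power.
  rewrite ge0_integralD//; last 3 first.
  - by move=> w _; rewrite lee_fin ltW.
  - by move=> w _; rewrite -EFinM lee_fin mulr_ge0// powR_ge0.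
  - by apply: measurable_funTS; apply: measurable_funeM; apply/measurable_EFinP.
  rewrite ge0_integralZl//; last 2 first.
  - by apply: measurable_funTS; apply/measurable_EFinP.
  - by move=> w _; rewrite lee_fin powR_ge0.
  rewrite integral_cst//= lebesgue_measure_itv/= EFinD EFinM EFinM fineK// leeD//.
    have [ce'|ce'] := ltP c%:E e%:E; last by rewrite mule0 -EFinM lee_fin mulr_ge0// ltW.
    by rewrite -EFinB ecE.
  by rewrite lee_wpmul2l// lee_fin.
have -> : a^-1 * (Phi (s + a) 0 i - Phi s 0 i) - g s 0 i = (psi a - psi 0) / a.
  by rewrite /psi addr0 mulr0 subr0; field.
rewrite normrM normfV ler_pdivrMr//; apply: (le_trans main).
by rewrite mulrDl divfK// gt_eqF.
Qed.

(** Jensen's inequality up to the constant 4^p, obtained by optimising the previous bound in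
    lambda. *)
Lemma quotient_error_powR (s a : R) : - pi <= a <= pi -> a != 0 ->
  ((quotient_error Phi g s a `^ p)%:E <=
   (4 `^ p / `|a|)%:E * local_mass (jump_power g) s a)%E.
Proof.
move=> aJ a0; set D := quotient_error Phi g s a; set m := local_mass _ _ _.
have D0 : 0 <= D by exact: enorm_ge0.
have m0 : (0 <= m)%E by apply: local_mass_ge0 => *; exact: powR_ge0.
have na : 0 < `|a| by rewrite normr_gt0.
have p0 : 0 < p by exact: lt_le_trans p1.
have [D1|D1] := eqVneq D 0.
  by rewrite D1 powR0 ?gt_eqF// mule_ge0// lee_fin divr_ge0 ?powR_ge0.
have {}D1 : 0 < D by rewrite lt_def D1.
have [mfin|] := boolP (m \is a fin_num); last first.
  rewrite ge0_fin_numE// -leNgt leye_eq => /eqP ->.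
  by rewrite gt0_muley ?lte_fin ?divr_gt0 ?powR_gt0// leey.
(* With lambda = D/4 the term 2 lambda is half of D and is absorbed on the left, leaving l^p <= m /
   |a|. *)
pose l := D / 4; have l0 : 0 < l by rewrite divr_gt0.
have := quotient_error_young s aJ a0 l0; rewrite -/m -/D.
rewrite -(fineK mfin) -!EFinM -EFinD !lee_fin => h.
have lp : 0 < l `^ (p - 1) by rewrite powR_gt0.
have lE : l `^ (1 - p) = (l `^ (p - 1))^-1 by rewrite -powRN opprB.
have h2 : l <= (l `^ (p - 1))^-1 * (fine m / `|a|).
  rewrite lE in h; have DE : D = 4 * l by rewrite /l mulrC divfK.
  move: h; rewrite {1}DE; set x := (l `^ _)^-1.
  rewrite (_ : 2 * x / `|a| * fine m = 2 * (x * (fine m / `|a|))); last by ring.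
  by lra.
have h3 : l `^ p <= fine m / `|a|.
  rewrite -(mulr_powRB1 (ltW l0) p0).
  by move: h2; rewrite mulrC ler_pdivlMr.
have -> : D = 4 * l by rewrite /l mulrC divfK.
by rewrite powRM// ?(ltW l0)// -mulrA ler_wpM2l ?powR_ge0// mulrC.
Qed.

End QuotientError.

(** * Bounds for periodic functions *)

Section PeriodicBounds.
Context {R : realType}.

Lemma periodic_bounded (f : R -> R) (T : R) : 0 < T -> continuous f -> periodic f T ->
  exists2 M, 0 <= M & forall x, `|f x| <= M.
Proof.
move=> T0 cf pf.
have [||c cI hc] := @EVT_max R (fun x => `|f x|) 0 T; first exact: ltW.
  apply: continuous_subspaceT => x.
  by apply: cvg_norm; exact: cf.
exists `|f c| => // x.
have pz (z : int) y : f (y + T *~ z) = f y.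
  case: z => n; first exact: periodicn.
  by rewrite NegzE mulrNz -pmulrn -[in RHS](subrK (T *+ n.+1) y) periodicn.
rewrite -(pz (- Num.floor (x / T))) mulrNz; apply: hc; rewrite in_itv/=.
have := floor_itv (x / T); set z := Num.floor _ => /andP[h1 h2].
have xE : x = (x / T * T) by rewrite divfK// gt_eqF.
have cB : x - T *~ z = (x / T - z%:~R) * T by rewrite mulrBl -xE mulrzl.
rewrite intrD -ltrBlDl in h2; rewrite cB; apply/andP; split.
  by apply: mulr_ge0; [rewrite subr_ge0|exact: ltW].
by apply: (le_trans (ler_wpM2r (ltW T0) (ltW h2))); rewrite mul1r.
Qed.

Lemma periodic_rV_bounded (g : R -> 'rV[R]_3) (T : R) : 0 < T ->
  (forall i, continuous (fun x => g x 0 i)) -> periodic g T ->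
  exists2 M, 0 <= M & forall x i, `|g x 0 i| <= M.
Proof.
move=> T0 cg pg.
have h i : exists2 M, 0 <= M & forall x, `|g x 0 i| <= M.
  by apply: (periodic_bounded T0 (@cg i)) => x; rewrite pg.
have [M1 ? h1] := h 0; have [M2 ? h2] := h 1; have [M3 ? h3] := h 2%:R.
exists (M1 + M2 + M3); first by rewrite !addr_ge0.
move=> x [[|[|[|//]]] i].
- rewrite (_ : Ordinal i = 0); last exact/val_inj.
  by apply: (le_trans (h1 x)); rewrite -addrA lerDl addr_ge0.
- rewrite (_ : Ordinal i = 1); last exact/val_inj.
  by apply: (le_trans (h2 x)); rewrite addrAC lerDr addr_ge0.
- rewrite (_ : Ordinal i = 2%:R); last exact/val_inj.
  by apply: (le_trans (h3 x)); rewrite lerDr addr_ge0.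
Qed.

Lemma periodic_derivative (Phi g : R -> 'rV[R]_3) (T : R) :
  (forall x : R, is_derive x 1 Phi (g x)) -> periodic Phi T -> periodic g T.
Proof.
move=> dPhi pPhi x; apply/rowP => i.
have ds : is_derive x 1 (fun y : R => y + T) 1.
  by apply: (@is_derive_eq1 _ _ _ (1 + 0)); rewrite addr0.
have := @is_derive_comp R _ (fun y => y + T) x _ _ (is_derive_coord i (dPhi (x + T))) ds.
under eq_fun do rewrite pPhi.
by move=> [_]; have [_ ->] := is_derive_coord i (dPhi x); rewrite mulr1.
Qed.

Lemma lipschitz_of_derivative (Phi g : R -> 'rV[R]_3) (M : R) :
  (forall x : R, is_derive x 1 Phi (g x)) -> (forall x i, `|g x 0 i| <= M) ->
  forall x y, enorm (Phi y - Phi x) <= 2 * M * `|y - x|.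
Proof.
move=> dPhi gM x y; rewrite -mulrA; apply: enorm_le_coord => i; rewrite !mxE.
apply: (@mean_value_ineq R (fun z => Phi z 0 i) (fun z => g z 0 i)
  (Num.min x y) (Num.max x y)).
- by move=> z _; exact: is_derive_coord.
- by move=> z _.
- by rewrite ge_min le_max lexx.
- by rewrite ge_min le_max lexx !orbT.
Qed.

End PeriodicBounds.

(** * The remainder dominated by Hardy kernels *)

Section RemainderIntegral.
Context {R : realType} (m u v : 'rV[R]_3) (r : R).
Hypotheses (hr : 0 < r) (huu : dot u u = 1) (hvv : dot v v = 1) (huv : dot u v = 0).
Variables (Phi g : R -> 'rV[R]_3) (p : R).
Hypothesis p2 : 2 <= p.
Hypothesis dPhi : forall x : R, is_derive x 1 Phi (g x).
Hypothesis cg : forall i, continuous (fun x => g x 0 i).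
Hypothesis pPhi : periodic Phi (pi *+ 2).
Hypothesis slob : (slobodeckii p g < +oo)%E.
Notation mu := (@lebesgue_measure R).
Notation I := (`[0%R, (pi *+ 2)%R : R]%classic).
Notation J := (`[(- pi)%R, pi%R : R]%classic).
Notation gam := (circle m u v r).
Notation gam' := (fun x => r *: tangent u v x).
Notation rem tau := (curve_remainder p gam gam' Phi g tau).

(** Z^p is split into 1 and the p-th powers of the two slope errors over L = |a| + |b|.
    [quotient_error_powR] bounds these by local masses, and the weights 1 / (|a| L^p) and 1 / (|b|
    L^p) by the Hardy kernel. *)
Lemma remainder_kernel_le : exists K t0 : R, [/\ 0 <= K, 0 < t0 &
  forall tau s a b, `|tau| <= t0 -> - pi <= a <= pi -> - pi <= b <= pi ->
    pair_dominates a b ->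
    ((rem tau s (s + a) (s + b))%:E <= (K * tau ^+ 2)%:E *
     (1 + ((hardy_kernel p a b)%:E * local_mass (jump_power p g) s a +
           (hardy_kernel p b a)%:E * local_mass (jump_power p g) s b)))%E].
Proof.
have pi2 : 0 < pi *+ 2 :> R by rewrite pmulrn_lgt0// pi_gt0.
have pg := periodic_derivative dPhi pPhi.
have [M M0 gM] := periodic_rV_bounded pi2 cg pg.
have G0 : 0 <= 2 * M by rewrite mulr_ge0.
have lip := lipschitz_of_derivative dPhi gM.
have gle x : enorm (g x) <= 2 * M by exact: enorm_le_coord.
have [K [t0 [K1 t00 hK]]] := circle_remainder_le m hr huu hvv huv p2 G0 lip gle.
have p1 : 1 <= p by apply: le_trans p2; rewrite ler1n.
have p0 : 0 <= p by exact: le_trans p1.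
have pn0 : p != 0 by rewrite gt_eqF// (lt_le_trans _ p1).
pose k1 := 2 `^ p; pose k2 := 4 `^ p : R.
have ge1 (x : R) : 1 <= x -> 1 <= x `^ p.
  move=> x1; apply: (@le_trans _ _ (x `^ 0)); first by rewrite powRr0.
  exact: ler_powR.
have k1ge1 : 1 <= k1 by apply: ge1; rewrite ler1n.
have k2ge1 : 1 <= k2 by apply: ge1; rewrite ler1n.
have K0 : 0 <= K by exact: le_trans K1.
have kk0 : 0 <= k1 * k2 by rewrite mulr_ge0// powR_ge0.
have kk1 : 1 <= k1 * k2 by rewrite -[leLHS]mulr1 ler_pM.
have KK0 : 0 <= K * (k1 * (k1 * k2)).
  by apply: mulr_ge0 => //; apply: mulr_ge0 => //; exact: powR_ge0.
exists (K * (k1 * (k1 * k2))), t0; split => //.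
move=> tau s a b tt0 ha hb hE.
have jp0 s' w : 0 <= jump_power p g s' w by exact: powR_ge0.
have RHS0 : (0 <= (K * (k1 * (k1 * k2)) * tau ^+ 2)%:E *
     (1 + ((hardy_kernel p a b)%:E * local_mass (jump_power p g) s a +
           (hardy_kernel p b a)%:E * local_mass (jump_power p g) s b)))%E.
  rewrite mule_ge0//; first by rewrite lee_fin; apply: mulr_ge0 => //; exact: sqr_ge0.
  by rewrite !adde_ge0// mule_ge0 ?lee_fin ?hardy_kernel_ge0 ?local_mass_ge0.
have [a0|a0] := eqVneq a 0.
  by rewrite curve_remainder_degenerate// a0 addr0; left.
have [b0|b0] := eqVneq b 0.
  by rewrite curve_remainder_degenerate// b0 addr0; right; left.
have na : 0 < `|a| by rewrite normr_gt0.
have nb : 0 < `|b| by rewrite normr_gt0.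
set L := `|a| + `|b|; have L0 : 0 < L by rewrite addr_gt0.
set Da := quotient_error Phi g s a; set Db := quotient_error Phi g s b.
have Da0 : 0 <= Da by exact: enorm_ge0.
have Db0 : 0 <= Db by exact: enorm_ge0.
have Lp0 : 0 < L `^ p by exact: powR_gt0.
have e1 : (1 + (Da + Db) / L) `^ p <= k1 * (1 + k1 * (Da `^ p + Db `^ p) / L `^ p).
  apply: (le_trans (powR_add_le p0 ler01 _)); first by rewrite divr_ge0 ?addr_ge0// ltW.
  have -> : ((Da + Db) / L) `^ p = (Da + Db) `^ p / L `^ p.
    rewrite powRM; [|exact: addr_ge0|by rewrite invr_ge0 ltW].
    by rewrite inv_powR ?powRN// ltW.
  rewrite powR1 ler_wpM2l ?powR_ge0// lerD2l ler_wpM2r ?invr_ge0 ?(ltW Lp0)//.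
  exact: powR_add_le.
(* Uses x^2 + y^2 <= L^2 together with |x|^(p - 2) <= L^(p - 2), the latter because p >= 2. *)
have ker x y (x0 : x != 0) : `|x| + `|y| = L ->
    (L `^ p)^-1 * `|x|^-1 <= hardy_kernel p x y.
  move=> xyL; have nx : 0 < `|x| by rewrite normr_gt0.
  have xy0 : 0 < x ^+ 2 + y ^+ 2 by rewrite ltr_wpDr ?sqr_ge0// exprn_even_gt0.
  rewrite /hardy_kernel ler_pdivlMr// -invfM mulrC ler_pdivrMr ?mulr_gt0//.
  have -> : `|x| `^ (1 - p) * (L `^ p * `|x|) = `|x| `^ (2 - p) * L `^ p.
    rewrite mulrCA mulrC; congr (_ * _); rewrite -{2}(powRr1 (ltW nx)) -powRD.
      by congr (_ `^ _); ring.
    by rewrite (gt_eqF nx) implybT.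
  have -> : L `^ p = L `^ (p - 2) * L ^+ 2.
    rewrite -(powR_mulrn 2 (ltW L0)) -powRD; first by congr (_ `^ _); ring.
    by rewrite (gt_eqF L0) implybT.
  have h1 : 1 <= `|x| `^ (2 - p) * L `^ (p - 2).
    rewrite (_ : 2 - p = - (p - 2)); last ring.
    rewrite powRN mulrC ler_pdivlMr ?powR_gt0// mul1r.
    by apply: ge0_ler_powR; rewrite ?nnegrE ?subr_ge0 ?(ltW L0)// -xyL lerDl.
  have h2 : x ^+ 2 + y ^+ 2 <= L ^+ 2.
    rewrite -xyL -(real_normK (num_real x)) -(real_normK (num_real y)) -subr_ge0.
    rewrite [leRHS](_ : _ = 2 * (`|x| * `|y|)); last ring.
    by rewrite mulr_ge0// mulr_ge0.
  rewrite mulrA -[leLHS]mul1r; apply: ler_pM => //; exact: ltW.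
have term x y (x0 : x != 0) : - pi <= x <= pi -> `|x| + `|y| = L ->
    ((quotient_error Phi g s x `^ p / L `^ p)%:E <=
      k2%:E * ((hardy_kernel p x y)%:E * local_mass (jump_power p g) s x))%E.
  move=> xI xyL; have nx : 0 < `|x| by rewrite normr_gt0.
  have m0 := local_mass_ge0 jp0 s x.
  rewrite mulrC EFinM.
  apply: (le_trans (lee_wpmul2l _ (quotient_error_powR p1 dPhi cg s xI x0))).
    by rewrite lee_fin invr_ge0 ltW.
  rewrite !muleA lee_wpmul2r// -!EFinM lee_fin.
  rewrite (_ : _ * (4 `^ p / `|x|) = k2 * ((L `^ p)^-1 * `|x|^-1)); last by rewrite /k2; ring.
  by rewrite ler_wpM2l ?powR_ge0// ker.
set X := ((hardy_kernel p a b)%:E * _)%E; set Y := ((hardy_kernel p b a)%:E * _)%E.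
have X0 : (0 <= X)%E by rewrite mule_ge0 ?lee_fin ?hardy_kernel_ge0 ?local_mass_ge0.
have Y0 : (0 <= Y)%E by rewrite mule_ge0 ?lee_fin ?hardy_kernel_ge0 ?local_mass_ge0.
have hX := term a b a0 ha erefl.
have hY := term b a b0 hb (addrC _ _).
have Kt0 : 0 <= K * tau ^+ 2 * k1.
  by apply: mulr_ge0; [apply: mulr_ge0 => //; exact: sqr_ge0|exact: powR_ge0].
apply: (@le_trans _ _ ((K * tau ^+ 2 * k1)%:E * (1 + (k1 * k2)%:E * (X + Y)))%E).
  have h1 := hK tau s a b tt0 ha hb hE.
  apply: (@le_trans _ _ (K * tau ^+ 2 * k1 * (1 + k1 * (Da `^ p + Db `^ p) / L `^ p))%:E).
    rewrite lee_fin; apply: (le_trans h1).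
    rewrite -[leRHS]mulrA mulrAC ler_wpM2l//.
    by rewrite mulr_ge0// sqr_ge0.
  rewrite EFinM lee_wpmul2l ?lee_fin//.
  rewrite EFinD leeD2l// -mulrA mulrDl EFinM EFinM -muleA lee_wpmul2l// ?lee_fin ?powR_ge0//.
  by rewrite EFinD (ge0_muleDr _ X0 Y0); exact: (leeD hX hY).
rewrite (_ : K * (k1 * (k1 * k2)) * tau ^+ 2 = K * tau ^+ 2 * k1 * (k1 * k2)); last ring.
rewrite [in leRHS]EFinM -[leRHS]muleA; apply: lee_wpmul2l; first by rewrite lee_fin.
by rewrite (ge0_muleDr _ _ (adde_ge0 X0 Y0))// mule1 leeD2r.
Qed.

End RemainderIntegral.

Lemma integral_itv_cst (R : realType) (a b k : R) : a <= b ->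
  (\int[@lebesgue_measure R]_(x in `[a, b]) k%:E = (k * (b - a))%:E)%E.
Proof.
move=> ab; rewrite integral_cst//= lebesgue_measure_itv/= lte_fin EFinM.
case: ltP => [_|ba]; first by rewrite EFinB.
by rewrite (@le_anti _ _ a b) ?ab// subrr.
Qed.

(** * The integrated remainder is of second order *)

Section RemainderIntegral.
Context {R : realType} (m u v : 'rV[R]_3) (r : R).
Hypotheses (hr : 0 < r) (huu : dot u u = 1) (hvv : dot v v = 1) (huv : dot u v = 0).
Variables (Phi g : R -> 'rV[R]_3) (p : R).
Hypothesis p2 : 2 <= p.
Hypothesis dPhi : forall x : R, is_derive x 1 Phi (g x).
Hypothesis cg : forall i, continuous (fun x => g x 0 i).
Hypothesis pPhi : periodic Phi (pi *+ 2).
Hypothesis slob : (slobodeckii p g < +oo)%E.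
Notation mu := (@lebesgue_measure R).
Notation I := (`[0%R, (pi *+ 2)%R : R]%classic).
Notation J := (`[(- pi)%R, pi%R : R]%classic).
Notation gam := (circle m u v r).
Notation gam' := (fun x => r *: tangent u v x).
Notation rem tau := (curve_remainder p gam gam' Phi g tau).

Lemma measurable_vec_continuous (f : R -> 'rV[R]_3) d (X : measurableType d) (k : X -> R) :
  (forall i, continuous (fun x => f x 0 i)) -> measurable_fun [set: X] k ->
  measurable_vec (fun x => f (k x)).
Proof.
move=> cf mk i; apply: (@measurableT_comp _ _ _ _ _ _ (fun y => f y 0 i)) => //.
exact: continuous_measurable_fun.
Qed.

Lemma continuous_coord_derivable (f df : R -> 'rV[R]_3) :
  (forall x : R, is_derive x 1 f (df x)) -> forall i, continuous (fun x => f x 0 i).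
Proof. by move=> fd i x; exact: (is_derive_continuous (is_derive_coord i (fd x))). Qed.

Lemma continuous_tangent i : continuous (fun x => (r *: tangent u v x) 0 i).
Proof.
move=> x; rewrite (_ : (fun y => _) = fun y => r * (- sin y * u 0 i + cos y * v 0 i)); last first.
  by apply/funext => y; rewrite !mxE.
have d : is_derive x 1 (fun y => r * (- sin y * u 0 i + cos y * v 0 i))
   (r * ((- cos x * u 0 i + - sin x * 0) + (- sin x * v 0 i + cos x * 0))).
  apply: is_derive_scale; apply: is_derive_add; apply: is_derive_mul.
exact: (is_derive_continuous d).
Qed.

Let mtriple (f : R -> 'rV[R]_3) : (forall i, continuous (fun x => f x 0 i)) ->
  [/\ measurable_vec (fun z : R * R * R => f z.1.1),
      measurable_vec (fun z : R * R * R => f z.1.2) &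
      measurable_vec (fun z : R * R * R => f z.2)].
Proof.
by move=> cf; split; apply: measurable_vec_continuous => //; exact: measurableT_comp.
Qed.

Lemma measurable3_density (c c' : R -> 'rV[R]_3) :
  (forall i, continuous (fun x => c x 0 i)) -> (forall i, continuous (fun x => c' x 0 i)) ->
  measurable3 (fun s t x => (curve_density p c c' s t x)%:E).
Proof.
move=> /mtriple[? ? ?] /mtriple[? ? ?]; apply/measurable_EFinP.
by apply: measurable_edge_density => //; exact: measurable_vecB.
Qed.

Lemma measurable3_remainder tau : measurable3 (fun s t x => (rem tau s t x)%:E).
Proof.
have /mtriple[c1 c2 c3] := continuous_coord_derivable (is_derive_circle m u v r).
have /mtriple[d1 d2 d3] := continuous_coord_derivable dPhi.
have /mtriple[g1 g2 g3] := cg.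
have /mtriple[t1 t2 t3] := continuous_tangent.
apply/measurable_EFinP; apply: measurableT_comp => //.
have mD : measurable_fun [set: R * R * R]
    (fun z => curve_density p gam gam' z.1.1 z.1.2 z.2).
  by apply: measurable_edge_density => //; exact: measurable_vecB.
apply: measurable_funB; first apply: measurable_funB => //.
  by apply: measurable_edge_density; do ?apply: measurable_vecB;
    apply: measurable_vecD => //; exact: measurable_vecZ.
apply: measurable_funM => //; apply: measurable_funM => //.
by apply: measurable_edge_variation => //; exact: measurable_vecB.
Qed.

(** The reduction to a longest side opposite s costs the factor 3. The kernel bound then contributes
    the volume (2 pi)^3 and two Hardy integrals, each controlled by the Slobodeckii seminorm of the
    derivative. *)
Lemma remainder_integral_le : exists C t0 : R, [/\ 0 <= C, 0 < t0 &
  forall tau, `|tau| <= t0 ->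
  (integral3 I I I (fun s t x => (rem tau s t x)%:E) <= (C * tau ^+ 2)%:E)%E].
Proof.
have [K [t0 [K0 t00 hK]]] := remainder_kernel_le m hr huu hvv huv p2 dPhi cg pPhi.
have mI := measurable_itv `[0%R, (pi *+ 2)%R : R].
have mJ := measurable_itv `[(- pi)%R, pi%R : R].
have pg := periodic_derivative dPhi pPhi.
have p1 : 1 <= p by apply: le_trans p2; rewrite ler1n.
have jp0 s w : 0 <= jump_power p g s w by exact: powR_ge0.
have j0 s : jump_power p g s 0 = 0.
  by rewrite /jump_power addr0 subrr enorm0 powR0// gt_eqF// (lt_le_trans _ p1).
have mjp := measurable_jump_power p cg.
pose S := fine (slobodeckii p g).
have S0 : (0 <= slobodeckii p g)%E.
  apply: integral_ge0 => x _; apply: integral_ge0 => w _.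
  by rewrite lee_fin divr_ge0 ?powR_ge0.
have SE : slobodeckii p g = S%:E by rewrite fineK// ge0_fin_numE.
pose f1 (s a b : R) : \bar R := ((hardy_kernel p a b)%:E * local_mass (jump_power p g) s a)%E.
pose f2 (s a b : R) : \bar R := ((hardy_kernel p b a)%:E * local_mass (jump_power p g) s b)%E.
have f10 s a b : (0 <= f1 s a b)%E by rewrite mule_ge0 ?lee_fin ?hardy_kernel_ge0 ?local_mass_ge0.
have f20 s a b : (0 <= f2 s a b)%E by rewrite mule_ge0 ?lee_fin ?hardy_kernel_ge0 ?local_mass_ge0.
have mf1 : measurable3 f1.
  apply: emeasurable_funM.
    apply/measurable_EFinP.
    apply: (measurableT_comp (measurable_hardy_kernel p) (g := fun z : R * R * R => (z.1.2, z.2))).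
    by apply: measurable_fun_pair => //; exact: measurableT_comp.
  apply: (measurableT_comp (measurable_local_mass mjp jp0) (g := fun z : R * R * R => (z.1.1, z.1.2))).
  by apply: measurable_fun_pair => //; exact: measurableT_comp.
have mf2 : measurable3 f2.
  by apply: (measurable3_comp mf1); do ?apply: measurableT_comp.
have h1 : (integral3 I J J f1 <= (2 * pi ^+ 2 * S)%:E)%E.
  by rewrite EFinM -SE; exact: (hardy_integral p2 mjp jp0 j0).
(* [f2] is [f1] with a and b exchanged, so the two iterated integrals agree by Tonelli. *)
have h2 : (integral3 I J J f2 <= (2 * pi ^+ 2 * S)%:E)%E.
  apply: le_trans h1; rewrite le_eqVlt; apply/orP; left; apply/eqP.
  apply: eq_integral => s _.
  by apply: (@ge0_integral_swap _ J J (fun a b => f2 s a b) mJ mJ) => //; exact: (measurable3_comp mf2).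
pose one (s a b : R) : \bar R := 1%E.
have m1 : measurable3 one by exact: measurable_cst.
have one0 s a b : (0 <= one s a b)%E by exact: lee01.
have pi0 := @pi_ge0 R.
have pi20 : 0 <= pi *+ 2 :> R by rewrite mulrn_wge0.
have pipi : - pi <= pi :> R by rewrite (le_trans _ pi0)// oppr_le0.
have h0 : integral3 I J J one = ((pi *+ 2) ^+ 3)%:E.
  rewrite /integral3 /one.
  have JE (k : R) : (\int[mu]_(x in J) k%:E = (k * (pi *+ 2))%:E)%E.
    by rewrite (integral_itv_cst _ pipi) opprK -mulr2n.
  under eq_integral do under eq_integral do rewrite JE.
  under eq_integral do rewrite JE.
  by rewrite (integral_itv_cst _ pi20); congr EFin; ring.
exists (3 * (K * ((pi *+ 2) ^+ 3 + (2 * pi ^+ 2 * S + 2 * pi ^+ 2 * S)))), t0; split => //.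
  have S0' : 0 <= S by rewrite fine_ge0.
  have q0 : 0 <= 2 * pi ^+ 2 * S by rewrite mulr_ge0// mulr_ge0// exprn_ge0.
  apply: mulr_ge0 => //; apply: mulr_ge0 => //; apply: addr_ge0; first exact: exprn_ge0.
  exact: addr_ge0.
move=> tau tt0.
have mr := measurable3_remainder tau.
have r0 s t x : (0 <= (rem tau s t x)%:E)%E by rewrite lee_fin; exact: normr_ge0.
have Kt0 : 0 <= K * tau ^+ 2 by rewrite mulr_ge0// sqr_ge0.
have pc x : gam (x + pi *+ 2) = gam x by exact: circle_periodic.
have pt x : tangent u v (x + pi *+ 2) = tangent u v x by rewrite /tangent sinD2pi cosD2pi.
apply: (le_trans (ge0_integral3_dominates mr r0 _ _ _)).
- by move=> s t x; rewrite curve_remainderC.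
- by move=> s t x; rewrite curve_remainderCA.
- move=> s t x; rewrite /curve_remainder /curve_variation /curve_density.
  by rewrite !pc !pt !pPhi !pg.
rewrite -[X in (_ <= X%:E)%E]mulrA EFinM; apply: lee_wpmul2l; first by rewrite lee_fin.
pose F (s a b : R) : \bar R := (if pair_dominates a b then (rem tau s (s + a) (s + b))%:E else 0)%E.
have F0 s a b : (0 <= F s a b)%E by rewrite /F; case: ifP.
have mcos d (X : measurableType d) (k : X -> R) : measurable_fun [set: X] k ->
    measurable_fun [set: X] (fun x => cos (k x)).
  by apply: measurableT_comp; apply: continuous_measurable_fun; exact: continuous_cos.
have m11 : measurable_fun [set: R * R * R] (fun z => z.1.1) by apply: measurableT_comp.
have m12 : measurable_fun [set: R * R * R] (fun z => z.1.2) by apply: measurableT_comp.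
have mF : measurable3 F.
  apply: measurable_fun_ifT => //.
    by apply: measurable_and; apply: measurable_fun_ler; apply: mcos => //; exact: measurable_funB.
  by apply: (measurable3_comp mr) => //; exact: measurable_funD.
have mf12 : measurable3 (fun s a b => f1 s a b + f2 s a b)%E by exact: emeasurable_funD.
have f120 s a b : (0 <= f1 s a b + f2 s a b)%E by exact: adde_ge0.
have mf : measurable3 (fun s a b => one s a b + (f1 s a b + f2 s a b))%E by exact: emeasurable_funD.
have f0 s a b : (0 <= one s a b + (f1 s a b + f2 s a b))%E by exact: adde_ge0.
have mKf : measurable3 (fun s a b => (K * tau ^+ 2)%:E * (one s a b + (f1 s a b + f2 s a b)))%E.
  exact: measurable_funeM.
have Kf0 s a b : (0 <= (K * tau ^+ 2)%:E * (one s a b + (f1 s a b + f2 s a b)))%E.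
  by apply: mule_ge0 => //; rewrite lee_fin.
have FK s a b : I s -> J a -> J b ->
    (F s a b <= (K * tau ^+ 2)%:E * (one s a b + (f1 s a b + f2 s a b)))%E.
  move=> _ /=; rewrite !in_itv/= => aJ bJ.
  by rewrite /F; case: ifPn => [ab|_]; [exact: hK|exact: Kf0].
apply: (le_trans (ge0_le_integral3 mI mJ mJ mF mKf F0 Kf0 FK)).
rewrite (ge0_integral3Zl mI mJ mJ mf f0 Kt0) (ge0_integral3D mI mJ mJ m1 mf12 one0 f120).
rewrite (ge0_integral3D mI mJ mJ mf1 mf2 f10 f20) h0.
rewrite [leRHS](_ : _ = ((K * tau ^+ 2)%:E *
  ((pi *+ 2) ^+ 3 + (2 * pi ^+ 2 * S + 2 * pi ^+ 2 * S))%:E)%E); last first.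
  by rewrite -EFinM; congr EFin; ring.
apply: lee_wpmul2l; first by rewrite lee_fin.
rewrite EFinD; apply: leeD; first exact: lexx.
rewrite EFinD; exact: (leeD h1 h2).
Qed.

End RemainderIntegral.

(** * The real-valued integral over one period *)

Section PeriodIntegral.
Context {R : realType}.
Notation mu := (@lebesgue_measure R).
Notation I := (`[0%R, (pi *+ 2)%R : R]%classic).
Implicit Types f h : R -> R.

Definition period_integral f : R := \int[mu]_(x in I) f x.
Notation Int := period_integral.

Lemma continuous_integrable_itv f (a b : R) : continuous f ->
  mu.-integrable `[a, b] (EFin \o f).
Proof.
move=> cf; apply: continuous_compact_integrable; first exact: segment_compact.
exact: continuous_subspaceT.
Qed.

Lemma period_integralE f : continuous f -> (\int[mu]_(x in I) (f x)%:E = (Int f)%:E)%E.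
Proof.
move=> cf; rewrite /period_integral /Rintegral fineK//.
exact/integrable_fin_num/continuous_integrable_itv.
Qed.

Lemma continuous_lin f h (k l : R) : continuous f -> continuous h ->
  continuous (fun x => k * f x + l * h x).
Proof.
move=> cf ch x.
by apply: (@cvgD R R R (nbhs x)); apply: (@cvgM R R (nbhs x));
  do ?[exact: cvg_cst|exact: cf|exact: ch].
Qed.

Lemma period_integral_lin f h (k l : R) : continuous f -> continuous h ->
  Int (fun x => k * f x + l * h x) = k * Int f + l * Int h.
Proof.
move=> cf ch.
have z : continuous (fun _ : R => 0 : R) by move=> x; exact: cst_continuous.
have cZ (c : R) (e : R -> R) : continuous e -> continuous (fun x => c * e x).
  by move=> ce x; apply: (@cvgM R R (nbhs x)); [exact: cvg_cst|exact: ce].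
rewrite /period_integral RintegralD//; last 2 first.
- by apply: continuous_integrable_itv; exact: cZ.
- by apply: continuous_integrable_itv; exact: cZ.
by rewrite !RintegralZl//; exact: continuous_integrable_itv.
Qed.

Lemma period_integral_sum (T : Type) (l : seq T) (c : T -> R) (F : T -> R -> R) :
  (forall t, continuous (F t)) ->
  continuous (fun x => \sum_(t <- l) c t * F t x) /\
  Int (fun x => \sum_(t <- l) c t * F t x) = \sum_(t <- l) c t * Int (F t).
Proof.
move=> cF; elim: l => [|t l [cl IH]].
  under eq_fun do rewrite big_nil; rewrite big_nil; split; first by move=> x; exact: cst_continuous.
  by rewrite /period_integral /Rintegral integral0_eq.
have e : (fun x => \sum_(j <- t :: l) c j * F j x) =
    fun x => c t * F t x + 1 * \sum_(j <- l) c j * F j x.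
  by apply/funext => x; rewrite big_cons mul1r.
rewrite big_cons e; split; first exact: continuous_lin.
by rewrite period_integral_lin// mul1r IH.
Qed.

Lemma period_integral_shift f (d : R) : continuous f -> periodic f (pi *+ 2) ->
  Int (fun x => f (x + d)) = Int f.
Proof.
move=> cf pf; rewrite /period_integral /Rintegral; congr fine.
apply: (@periodic_integral_shift R (pi *+ 2) d (EFin \o f)).
- by rewrite pmulrn_lgt0// pi_gt0.
- by apply/measurable_EFinP; exact: continuous_measurable_fun.
- by move=> x /=; rewrite pf.
Qed.

Lemma continuous_dot (A B : R -> 'rV[R]_3) :
  (forall i, continuous (fun x => A x 0 i)) -> (forall i, continuous (fun x => B x 0 i)) ->
  continuous (fun x => dot (A x) (B x)).
Proof.
move=> cA cB; rewrite (_ : (fun x => _) = fun x => A x 0 0 * B x 0 0 + A x 0 1 * B x 0 1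
  + A x 0 2%:R * B x 0 2%:R); last by apply/funext => x; rewrite dotE.
by move=> x; do 2?apply: (@cvgD R R R (nbhs x)); apply: (@cvgM R R (nbhs x));
  do ?[exact: cA|exact: cB].
Qed.

Lemma continuous_shift_coord (A : R -> 'rV[R]_3) (d : R) :
  (forall i, continuous (fun x => A x 0 i)) -> forall i, continuous (fun x => A (x + d) 0 i).
Proof.
move=> cA i x; apply: (@continuous_comp _ _ _ (fun x => x + d) (fun x => A x 0 i)); last exact: cA.
by apply: continuousD; [exact: cvg_id|exact: cst_continuous].
Qed.

End PeriodIntegral.

(** * Averages along the circle *)

Section Averaging.
Context {R : realType} (m u v : 'rV[R]_3) (r : R).
Hypotheses (hr : 0 < r) (huu : dot u u = 1) (hvv : dot v v = 1) (huv : dot u v = 0).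
Variables (Phi g : R -> 'rV[R]_3).
Hypothesis dPhi : forall x : R, is_derive x 1 Phi (g x).
Hypothesis cg : forall i, continuous (fun x => g x 0 i).
Hypothesis pPhi : periodic Phi (pi *+ 2).
Notation gam := (circle m u v r).
Notation gam' := (fun x => r *: tangent u v x).
Notation tg := (tangent u v).

Definition normal (u v : 'rV[R]_3) (x : R) : 'rV[R]_3 := cos x *: u + sin x *: v.

(** The radial part of the rotational average of [Phi]; it is also the derivative of the length. *)
Definition normal_mass : R := period_integral (fun x => dot (Phi x) (normal u v x)).
Definition tangential_mass : R := period_integral (fun x => dot (Phi x) (tg x)).
Notation W := normal_mass.
Notation Q := tangential_mass.

Lemma tangentD (x y : R) : tg (x + y) = cos y *: tg x - sin y *: normal u v x.
Proof. by apply/rowP => i; rewrite !mxE sinD cosD; ring. Qed.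

Lemma is_derive_tangent (x : R) : is_derive x 1 tg (- normal u v x).
Proof.
apply: is_derive_rV => i; rewrite !mxE.
rewrite (_ : (fun y => _) = fun y => - sin y * u 0 i + cos y * v 0 i); last first.
  by apply/funext => y; rewrite !mxE.
apply: (@is_derive_eq1 _ _ _ ((- cos x * u 0 i + - sin x * 0) + (- sin x * v 0 i + cos x * 0))).
  by apply: is_derive_add; apply: is_derive_mul.
by ring.
Qed.

Lemma is_derive_normal (x : R) : is_derive x 1 (normal u v) (tg x).
Proof.
apply: is_derive_rV => i; rewrite !mxE.
rewrite (_ : (fun y => _) = fun y => cos y * u 0 i + sin y * v 0 i); last first.
  by apply/funext => y; rewrite !mxE.
apply: (@is_derive_eq1 _ _ _ ((- sin x * u 0 i + cos x * 0) + (cos x * v 0 i + sin x * 0))).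
  by apply: is_derive_add; apply: is_derive_mul.
by ring.
Qed.

Lemma is_derive_dot (A B : R -> 'rV[R]_3) (dA dB : 'rV[R]_3) (x : R) :
  is_derive x 1 A dA -> is_derive x 1 B dB ->
  is_derive x 1 (fun y => dot (A y) (B y)) (dot dA (B x) + dot (A x) dB).
Proof.
move=> hA hB.
have e : (fun y => dot (A y) (B y)) = fun y => A y 0 0 * B y 0 0 + A y 0 1 * B y 0 1
  + A y 0 2%:R * B y 0 2%:R by apply/funext => y; rewrite dotE.
rewrite e !dotE.
have d i := is_derive_mul (is_derive_coord i hA) (is_derive_coord i hB).
apply: is_derive_eq1 (is_derive_add (is_derive_add (d 0) (d 1)) (d 2%:R)) _.
by ring.
Qed.

Let cPhi := continuous_coord_derivable dPhi.
Let ctg := continuous_coord_derivable is_derive_tangent.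
Let cn := continuous_coord_derivable is_derive_normal.

Let ptg : periodic tg (pi *+ 2).
Proof. by move=> x; rewrite /tangent sinD2pi cosD2pi. Qed.

Let pn : periodic (normal u v) (pi *+ 2).
Proof. by move=> x; rewrite /normal sinD2pi cosD2pi. Qed.

(** Translating s by d leaves only the angle e - d between the two arguments, and the tangent turned
    by this angle is a fixed combination of tangent and normal. *)
Lemma average_tangent (d e : R) :
  continuous (fun s => dot (Phi (s + d)) (tg (s + e))) /\
  period_integral (fun s => dot (Phi (s + d)) (tg (s + e))) =
  cos (e - d) * Q - sin (e - d) * W.
Proof.
split; first by apply: continuous_dot; exact: continuous_shift_coord.
pose f x := dot (Phi x) (tg (x + (e - d))).
have cf : continuous f by apply: continuous_dot => //; exact: continuous_shift_coord.
rewrite (_ : (fun s => _) = fun s => f (s + d)); last first.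
  by apply/funext => s; rewrite /f -addrA (addrC d) subrK.
rewrite period_integral_shift//; last first.
  by move=> x; rewrite /f pPhi addrAC ptg.
rewrite (_ : f = fun x => cos (e - d) * dot (Phi x) (tg x) +
   (- sin (e - d)) * dot (Phi x) (normal u v x)); last first.
  by apply/funext => x; rewrite /f tangentD dotDr dotNr !dotZr mulNr.
by rewrite period_integral_lin ?mulNr//; exact: continuous_dot.
Qed.

(** Integration by parts over a period: tg . Phi is periodic with derivative tg . g - n . Phi, whose
    integral is therefore 0. *)
Lemma average_speed (d : R) :
  continuous (fun s => dot (tg (s + d)) (g (s + d))) /\
  period_integral (fun s => dot (tg (s + d)) (g (s + d))) = W.
Proof.
have pg := periodic_derivative dPhi pPhi.
pose f x := dot (tg x) (g x).
have cf : continuous f by exact: continuous_dot.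
split; first by apply: continuous_dot; exact: continuous_shift_coord.
rewrite (@period_integral_shift _ f d cf); last by move=> x; rewrite /f pg ptg.
have dF (x : R) := is_derive_dot (is_derive_tangent x) (dPhi x).
pose dF' x := 1 * dot (tg x) (g x) + (- 1) * dot (Phi x) (normal u v x).
have cdF' : continuous dF' by apply: continuous_lin; exact: continuous_dot.
have dFP (x : R) : is_derive x 1 (fun y => dot (tg y) (Phi y)) (dF' x).
  by apply: is_derive_eq1 (dF x) _; rewrite /dF' dotNl (dotC _ (Phi x)); ring.
have pi2 : 0 < pi *+ 2 :> R by rewrite pmulrn_lgt0// pi_gt0.
have := integral_derivative pi2 dFP cdF'.
rewrite (period_integralE cdF') -(add0r (pi *+ 2)) ptg pPhi subrr => -[].
rewrite period_integral_lin ?mul1r//; last 1 [exact: continuous_dot].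
by rewrite mulN1r => /eqP; rewrite subr_eq0 => /eqP.
Qed.

End Averaging.

(** * The averaged first variation does not depend on the triangle *)

Section AveragedVariation.
Context {R : realType} (m u v : 'rV[R]_3) (r : R).
Hypotheses (hr : 0 < r) (huu : dot u u = 1) (hvv : dot v v = 1) (huv : dot u v = 0).
Variables (Phi g : R -> 'rV[R]_3).
Hypothesis dPhi : forall x : R, is_derive x 1 Phi (g x).
Hypothesis cg : forall i, continuous (fun x => g x 0 i).
Hypothesis pPhi : periodic Phi (pi *+ 2).
Notation gam := (circle m u v r).
Notation gam' := (fun x => r *: tangent u v x).
Notation tg := (tangent u v).
Notation W := (normal_mass u v Phi).
Notation Q := (tangential_mass u v Phi).

(** Paired with the unit binormal, the cross product with a tangent acts as a quarter turn, so the
    area term also becomes an inner product with a tangent. *)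
Lemma dot_cross_tangent (A : 'rV[R]_3) (x : R) :
  dot (cross u v) (cross A (tg x)) = dot A (tg (x - pi / 2)).
Proof.
rewrite dot_cross /tangent sinBpihalf cosBpihalf !dotDr !dotZr huu hvv huv.
by rewrite (dotC v u) huv (dotC A u) (dotC A v); ring.
Qed.

Let quot (V V' : 'rV[R]_3) (k x : R) : k != 0 -> V = k *: tg x ->
  dot V V' / dot V V = k^-1 * dot V' (tg x).
Proof.
move=> k0 ->; rewrite !dotZl !dotZr dot_tangent// subrr cos0 (dotC _ V').
by field.
Qed.

(* Entries [(c, d, e)] stand for the term [c * dot (Phi (s + d)) (tg (s + e))]. *)
Definition variation_terms (a b : R) : seq (R * R * R) :=
  let x := a / 2 in let y := b / 2 in
  let al := sin x in let be := sin y in let de := sin (y - x) in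
  let n := 4 * r ^+ 2 * (al * be * de) in
  [:: (2 * r * be / n, a, y - pi / 2); (- (2 * r * be / n), 0, y - pi / 2);
      (- (2 * r * al / n), b, x - pi / 2); (2 * r * al / n, 0, x - pi / 2);
      (- (2 * r * al)^-1, a, x); ((2 * r * al)^-1, 0, x);
      (- (2 * r * be)^-1, b, y); ((2 * r * be)^-1, 0, y);
      (- (2 * r * de)^-1, b, x + y); ((2 * r * de)^-1, a, x + y)].

(** Since all edges are multiples of tangents at mid-angles, every quotient in the variation is a
    fixed coefficient times an inner product of [Phi] with a tangent, in the form that
    [average_tangent] integrates. *)
Lemma edge_variationE p (a b s : R) :
  sin (a / 2) != 0 -> sin (b / 2) != 0 -> sin (b / 2 - a / 2) != 0 ->
  edge_variation p (gam (s + a) - gam s) (gam (s + b) - gam s)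
    (gam' s) (gam' (s + a)) (gam' (s + b))
    (Phi (s + a) - Phi s) (Phi (s + b) - Phi s) (g s) (g (s + a)) (g (s + b)) =
  p * (\sum_(t <- variation_terms a b) t.1.1 * dot (Phi (s + t.1.2)) (tg (s + t.2))) +
  r^-1 * (\sum_(d <- [:: 0; a; b]) 1 * dot (tg (s + d)) (g (s + d))).
Proof.
move=> al0 be0 de0; have r0 : r != 0 by rewrite gt_eqF.
set x := a / 2 in al0 de0 *; set y := b / 2 in be0 de0 *.
have hA : gam (s + a) - gam s = (2 * r * sin x) *: tg (s + x).
  rewrite circle_sub; congr (_ *: tangent u v _); last by rewrite /x; field.
  by congr (_ * sin _); rewrite /x; field.
have hB : gam (s + b) - gam s = (2 * r * sin y) *: tg (s + y).
  rewrite circle_sub; congr (_ *: tangent u v _); last by rewrite /y; field.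
  by congr (_ * sin _); rewrite /y; field.
have hC : gam (s + b) - gam s - (gam (s + a) - gam s) = (2 * r * sin (y - x)) *: tg (s + (x + y)).
  have -> : gam (s + b) - gam s - (gam (s + a) - gam s) = gam (s + b) - gam (s + a).
    by rewrite opprB addrA subrK.
  rewrite circle_sub; congr (_ *: tangent u v _); last by rewrite /x /y; field.
  by congr (_ * sin _); rewrite /x /y; field.
have hC' : Phi (s + b) - Phi s - (Phi (s + a) - Phi s) = Phi (s + b) - Phi (s + a).
  by rewrite opprB addrA subrK.
have kA : 2 * r * sin x != 0 by rewrite !mulf_neq0// pnatr_eq0.
have kB : 2 * r * sin y != 0 by rewrite !mulf_neq0// pnatr_eq0.
have kC : 2 * r * sin (y - x) != 0 by rewrite !mulf_neq0// pnatr_eq0.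
have hT z G : dot (r *: tg z) G / dot (r *: tg z) (r *: tg z) = r^-1 * dot (tg z) G.
  by rewrite (quot G r0 erefl) dotC.
rewrite /edge_variation !hT (quot _ kA hA) (quot _ kB hB) (quot _ kC hC) hC'.
have hN : cross (gam (s + a) - gam s) (gam (s + b) - gam s) =
    (4 * r ^+ 2 * (sin x * sin y * sin (y - x))) *: cross u v.
  by rewrite cross_circle//; congr (_ * (_ * sin _) *: _); rewrite /x /y; field.
rewrite hN; set n := 4 * r ^+ 2 * _.
have n0 : n != 0 by rewrite !mulf_neq0// ?pnatr_eq0// expf_neq0.
have ww : dot (cross u v) (cross u v) = 1.
  by rewrite -enorm_sqr enorm_cross_uv// expr1n.
rewrite !dotZl !dotZr ww hA hB crossZr crossZl.
rewrite dotDr !dotZr (crossNC (tg _)) dotNr !dot_cross_tangent.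
rewrite /variation_terms -/x -/y -/n !big_cons !big_nil /= !addr0 !(dotDl (Phi _)) !dotNl !addrA.
by field; rewrite n0 r0 al0 be0 de0.
Qed.

(** The terms weighted by p average to -W / r and the three speed terms to W / r each. The
    tangential mass drops out, as it belongs to an infinitesimal rotation of the circle. The radial
    part is a dilation, under which curvature scales like the inverse of length. *)
Lemma average_variation p (a b : R) :
  sin (a / 2) != 0 -> sin (b / 2) != 0 -> sin (b / 2 - a / 2) != 0 ->
  let V s := edge_variation p (gam (s + a) - gam s) (gam (s + b) - gam s)
    (gam' s) (gam' (s + a)) (gam' (s + b))
    (Phi (s + a) - Phi s) (Phi (s + b) - Phi s) (g s) (g (s + a)) (g (s + b)) in
  continuous V /\ period_integral V = (3 - p) * W / r.
Proof.
move=> al0 be0 de0 V; have r0 : r != 0 by rewrite gt_eqF.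
have VE : V = fun s =>
  p * (\sum_(t <- variation_terms a b) t.1.1 * dot (Phi (s + t.1.2)) (tg (s + t.2))) +
  r^-1 * (\sum_(d <- [:: 0; a; b]) 1 * dot (tg (s + d)) (g (s + d))).
  by apply/funext => s; exact: edge_variationE.
have [c1 i1] := @period_integral_sum R _ (variation_terms a b) (fun t => t.1.1)
  (fun t s => dot (Phi (s + t.1.2)) (tg (s + t.2)))
  (fun t => (average_tangent u v dPhi pPhi t.1.2 t.2).1).
have [c2 i2] := @period_integral_sum R _ [:: 0; a; b] (fun => 1)
  (fun d s => dot (tg (s + d)) (g (s + d)))
  (fun d => (average_speed u v dPhi cg pPhi d).1).
rewrite VE; split; first exact: continuous_lin.
rewrite period_integral_lin// i1 i2.
under eq_bigr do rewrite (average_tangent u v dPhi pPhi _ _).2.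
under [X in _ + _ * X]eq_bigr do rewrite (average_speed u v dPhi cg pPhi _).2.
rewrite /variation_terms !big_cons !big_nil /= !addr0.
set x := a / 2 in al0 de0 *; set y := b / 2 in be0 de0 *.
have aE : a = x + x by rewrite /x; field.
have bE : b = y + y by rewrite /y; field.
have eA : a = x + x by rewrite /x; field.
have eB : b = y + y by rewrite /y; field.
have X1 (th : R) : cos (th - pi / 2) * Q - sin (th - pi / 2) * W = sin th * Q + cos th * W.
  by rewrite cosBpihalf sinBpihalf mulNr opprK.
have s1 : y - pi / 2 - a = (y - x - x) - pi / 2 by rewrite eA; ring.
have s2 : x - pi / 2 - b = (x - y - y) - pi / 2 by rewrite eB; ring.
rewrite s1 s2 !subr0 !X1.
have -> : x - a = - x by rewrite eA; ring.
have -> : y - b = - y by rewrite eB; ring.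
have -> : x + y - b = - (y - x) by rewrite eB; ring.
have -> : x + y - a = y - x by rewrite eA; ring.
rewrite !cosN !sinN.
(* Written with the angles x, y and y - x only, the sum becomes a rational identity in their sines
   and cosines. *)
have e1 : cos (y - x - x) = cos y + 2 * sin (y - x) * sin x.
  by rewrite -{2}(subrK x y) (cosB (y - x)) (cosD (y - x)); ring.
have e2 : sin (y - x - x) = sin y - 2 * cos (y - x) * sin x.
  by rewrite -{2}(subrK x y) (sinB (y - x)) (sinD (y - x)); ring.
have e3 : cos (x - y - y) = cos x - 2 * sin (y - x) * sin y.
  rewrite -{2}(subrK y x) (cosB (x - y)) (cosD (x - y)).
  by rewrite -(opprB x y) sinN; ring.
have e4 : sin (x - y - y) = sin x - 2 * cos (y - x) * sin y.
  rewrite -{2}(subrK y x) (sinB (x - y)) (sinD (x - y)).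
  by rewrite -(opprB x y) cosN; ring.
rewrite e1 e2 e3 e4.
by field; rewrite r0 al0 be0 de0.
Qed.

End AveragedVariation.

(** * Neglecting degenerate triangles *)

Section AlmostEverywhere.
Context {R : realType}.
Notation mu := (@lebesgue_measure R).
Notation J := (`[(- pi)%R, pi%R : R]%classic).

Lemma sin_half_eq0 (z : R) : `|z| <= pi *+ 2 -> sin (z / 2) = 0 ->
  [\/ z = 0, z = pi *+ 2 | z = - (pi *+ 2)].
Proof.
have pi0 := @pi_gt0 R; rewrite mulr2n => zpi.
have h (w : R) : 0 < w -> w <= pi + pi -> sin (w / 2) = 0 -> w = pi + pi.
  move=> w0 wpi s0; apply/eqP; rewrite eq_le wpi/= leNgt; apply/negP => wlt.
  by have : 0 < sin (w / 2) by [apply: sin_gt0_pi; lra]; rewrite s0 ltxx.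
move=> s0; have [z0|z0|->] := ltgtP z 0; last by constructor 1.
- constructor 3; rewrite -(opprK z); congr (- _); apply: h.
  + by rewrite oppr_gt0.
  + by rewrite -(ltr0_norm z0).
  + by rewrite mulNr sinN s0 oppr0.
- by constructor 2; apply: h => //; rewrite -(gtr0_norm z0).
Qed.

Lemma ae_notin_seq (l : seq R) (D : set R) (P : R -> Prop) :
  (forall x, D x -> x \notin l -> P x) -> {ae mu, forall x, D x -> P x}.
Proof.
move=> h; exists [set` l]; split.
- by apply: countable_measurable => //; exact: (finite_set_countable (finite_seq l)).
- by apply: countable_lebesgue_measure0; exact: (finite_set_countable (finite_seq l)).
- move=> x /= /not_implyP[Dx nPx]; apply: contrapT => /negP xl.
  exact/nPx/h.
Qed.

(** For each a other than 0 in the window, a triangle is degenerate only for b among 0, a and a plus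
    or minus 2 pi, a finite and hence null set. *)
Lemma ge0_le_integral_nondegenerate (f1 f2 : R -> R -> \bar R) :
  measurable_fun [set: R * R] (fun z => f1 z.1 z.2) ->
  measurable_fun [set: R * R] (fun z => f2 z.1 z.2) ->
  (forall a b, 0 <= f1 a b)%E -> (forall a b, 0 <= f2 a b)%E ->
  (forall a b : R, sin (a / 2) != 0 -> sin (b / 2) != 0 -> sin (b / 2 - a / 2) != 0 ->
    (f1 a b <= f2 a b)%E) ->
  (\int[mu]_(a in J) \int[mu]_(b in J) f1 a b <= \int[mu]_(a in J) \int[mu]_(b in J) f2 a b)%E.
Proof.
move=> mf1 mf2 f10 f20 h.
have pi0 := @pi_gt0 R.
have mJ := measurable_itv `[(- pi)%R, pi%R : R].
have nz (z : R) : J z -> z != 0 -> sin (z / 2) != 0.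
  rewrite /= in_itv/= -ler_norml => zpi z0; apply/eqP => s0.
  have zpi2 : `|z| <= pi *+ 2 by rewrite mulr2n; lra.
  have [/eqP|zE|zE] := sin_half_eq0 zpi2 s0; first by rewrite (negbTE z0).
  - by move: zpi; rewrite zE ger0_norm mulr2n; lra.
  - by move: zpi; rewrite zE normrN ger0_norm mulr2n; lra.
apply: ae_ge0_le_integral; [exact: mJ| | | | |].
- by move=> a _; apply: integral_ge0.
- by apply: measurable_funTS; exact: (measurable_integral_ge0 mJ mf1).
- by move=> a _; apply: integral_ge0.
- by apply: measurable_funTS; exact: (measurable_integral_ge0 mJ mf2).
apply: (@ae_notin_seq [:: 0]) => a aJ; rewrite inE => a0.
apply: ae_ge0_le_integral; [exact: mJ| | | | |].
- by [].
- by apply: measurable_funTS; exact: (measurable_fun_pair2 a mf1).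
- by [].
- by apply: measurable_funTS; exact: (measurable_fun_pair2 a mf2).
apply: (@ae_notin_seq [:: 0; a; a + pi *+ 2; a - pi *+ 2]) => b bJ.
rewrite !inE !negb_or => /and4P[b0 b1 b2 b3].
apply: h; [exact: nz|exact: nz|].
rewrite -mulrBl; apply/eqP => s0.
have bpi : `|b - a| <= pi *+ 2.
  move: aJ bJ; rewrite /= !in_itv/= => aJ bJ.
  by rewrite ler_norml mulr2n; lra.
have [/eqP|/eqP|/eqP] := sin_half_eq0 bpi s0.
- by rewrite subr_eq0 (negbTE b1).
- by rewrite subr_eq addrC (negbTE b2).
- by rewrite subr_eq addrC (negbTE b3).
Qed.

End AlmostEverywhere.

(** * Comparing a nonnegative integral with a continuous model *)

Section SliceComparison.
Context {R : realType}.
Notation mu := (@lebesgue_measure R).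
Notation I := (`[0%R, (pi *+ 2)%R : R]%classic).

(** Integrability of d is not assumed and l may change sign, so the pointwise triangle inequality is
    first shifted by B = max |l|. All integrands are then nonnegative, and the finite contribution
    of B cancels afterwards. *)
Lemma integral_compare (d l : R -> R) :
  measurable_fun [set: R] d -> (forall x, 0 <= d x) -> continuous l ->
  (\int[mu]_(s in I) (d s)%:E <= (period_integral l)%:E + \int[mu]_(s in I) `|d s - l s|%:E)%E /\
  ((period_integral l)%:E <= \int[mu]_(s in I) (d s)%:E + \int[mu]_(s in I) `|d s - l s|%:E)%E.
Proof.
move=> md d0 cl.
have pi2 : 0 <= pi *+ 2 :> R by rewrite mulrn_wge0// pi_ge0.
have mI := measurable_itv `[0%R, (pi *+ 2)%R : R].
have [|c cI hc] := @EVT_max R (fun x => `|l x|) 0 (pi *+ 2) pi2.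
  by apply: continuous_subspaceT => x; apply: cvg_norm; exact: cl.
set B := `|l c| in hc.
have lB x : I x -> 0 <= l x + B.
  by move=> Ix; have := hc x Ix; rewrite ler_norml => /andP[h _]; rewrite -lerBlDr sub0r.
have ml : measurable_fun [set: R] l by exact: continuous_measurable_fun.
have mlB : measurable_fun I (fun x => (l x + B)%:E).
  by apply: measurable_funTS; apply/measurable_EFinP; exact: measurable_funD.
have mdI : measurable_fun I (fun x => (d x)%:E).
  by apply: measurable_funTS; apply/measurable_EFinP.
have mr : measurable_fun I (fun x => (`|d x - l x|)%:E).
  apply: measurable_funTS; apply/measurable_EFinP; apply: measurableT_comp => //.
  exact: measurable_funB.
have r0 x : I x -> (0 <= `|d x - l x|%:E)%E by move=> _; rewrite lee_fin.
have dd0 x : I x -> (0 <= (d x)%:E)%E by move=> _; rewrite lee_fin.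
have lB0 x : I x -> (0 <= (l x + B)%:E)%E by move=> Ix; rewrite lee_fin lB.
have B0 (x : R) : I x -> (0 <= B%:E)%E by move=> _; rewrite lee_fin; exact: normr_ge0.
have mB : measurable_fun I (fun x : R => B%:E) by exact: measurable_cst.
have lBE : (\int[mu]_(x in I) (l x + B)%:E = (period_integral l + B * (pi *+ 2))%:E)%E.
  have cB : continuous (fun _ : R => B) by move=> x; exact: cst_continuous.
  rewrite (_ : (fun x => (l x + B)%:E) = fun x => (1 * l x + 1 * B)%:E); last first.
    by apply/funext => x; rewrite !mul1r.
  rewrite (period_integralE (@continuous_lin R _ _ 1 1 cl cB)).
  rewrite period_integral_lin// !mul1r; congr (_ + _)%:E.
  apply: EFin_inj; rewrite -(period_integralE cB).
  by rewrite (integral_itv_cst _ pi2) subr0.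
have BE : (\int[mu]_(x in I) B%:E = (B * (pi *+ 2))%:E)%E by rewrite (integral_itv_cst _ pi2) subr0.
split.
- set r := (\int[mu]_(s in I) `|_|%:E)%E.
  suff : (\int[mu]_(s in I) (d s)%:E + (B * (pi *+ 2))%:E <=
      (period_integral l + B * (pi *+ 2))%:E + r)%E.
    rewrite [leRHS](_ : _ = (period_integral l)%:E + r + (B * (pi *+ 2))%:E)%E; last first.
      by rewrite EFinD addeAC.
    by rewrite leeD2rE.
  rewrite -lBE -BE /r.
  rewrite -(@ge0_integralD _ _ _ mu I mI _ _ dd0 mdI B0 mB).
  rewrite -(@ge0_integralD _ _ _ mu I mI _ _ lB0 mlB r0 mr).
  apply: ge0_le_integral; [exact: mI| | | |].
  + by move=> x Ix; exact: adde_ge0 (dd0 x Ix) (B0 x Ix).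
  + exact: emeasurable_funD.
  + exact: emeasurable_funD.
  + move=> x _; rewrite -!EFinD lee_fin addrAC lerD2r.
    by have := ler_norm (d x - l x); rewrite lerBlDl.
- suff : ((period_integral l + B * (pi *+ 2))%:E <= \int[mu]_(s in I) (d s)%:E +
      \int[mu]_(s in I) `|d s - l s|%:E + (B * (pi *+ 2))%:E)%E.
    by rewrite EFinD leeD2rE.
  rewrite -lBE -BE.
  have i1 : (0 <= \int[mu]_(s in I) (d s)%:E)%E by apply: integral_ge0.
  rewrite -(@ge0_integralD _ _ _ mu I mI _ _ dd0 mdI r0 mr).
  have dr0 x : I x -> (0 <= (d x)%:E + `|d x - l x|%:E)%E.
    by move=> Ix; exact: adde_ge0 (dd0 x Ix) (r0 x Ix).
  have mdr : measurable_fun I (fun x => (d x)%:E + `|d x - l x|%:E)%E by exact: emeasurable_funD.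
  rewrite -(@ge0_integralD _ _ _ mu I mI _ _ dr0 mdr B0 mB).
  apply: ge0_le_integral; [exact: mI|exact: lB0|exact: mlB|exact: emeasurable_funD|].
  move=> x _; rewrite -!EFinD lee_fin lerD2r.
  by have := ler_norm (l x - d x); rewrite lerBlDl distrC.
Qed.

End SliceComparison.

(** * Periodicity of density and remainder *)

Section CurvePeriodicity.
Context {R : realType} (p P tau : R) (c T d G : R -> 'rV[R]_3).
Hypotheses (pc : periodic c P) (pT : periodic T P) (pd : periodic d P) (pG : periodic G P).

Lemma curve_density_periodic s t x :
  curve_density p c T s (t + P) x = curve_density p c T s t x /\
  curve_density p c T s t (x + P) = curve_density p c T s t x.
Proof. by rewrite /curve_density !pc !pT. Qed.

Lemma curve_remainder_periodic s t x :
  curve_remainder p c T d G tau s (t + P) x = curve_remainder p c T d G tau s t x /\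
  curve_remainder p c T d G tau s t (x + P) = curve_remainder p c T d G tau s t x.
Proof. by rewrite /curve_remainder /curve_variation /curve_density !pc !pT !pd !pG. Qed.

End CurvePeriodicity.

(** * First order expansion of the energy *)

Section EnergyExpansion.
Context {R : realType} (m u v : 'rV[R]_3) (r : R).
Hypotheses (hr : 0 < r) (huu : dot u u = 1) (hvv : dot v v = 1) (huv : dot u v = 0).
Variables (Phi g : R -> 'rV[R]_3) (p : R).
Hypothesis p2 : 2 <= p.
Hypothesis dPhi : forall x : R, is_derive x 1 Phi (g x).
Hypothesis cg : forall i, continuous (fun x => g x 0 i).
Hypothesis pPhi : periodic Phi (pi *+ 2).
Hypothesis slob : (slobodeckii p g < +oo)%E.
Notation mu := (@lebesgue_measure R).
Notation I := (`[0%R, (pi *+ 2)%R : R]%classic).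
Notation J := (`[(- pi)%R, pi%R : R]%classic).
Notation gam := (circle m u v r).
Notation gam' := (fun x => r *: tangent u v x).
Notation W := (normal_mass u v Phi).
Notation gamt tau := (fun x => gam x + tau *: Phi x).
Notation gamt' tau := (fun x => r *: tangent u v x + tau *: g x).
Notation dens tau := (curve_density p (gamt tau) (gamt' tau)).
Notation rem tau := (curve_remainder p gam gam' Phi g tau).
Notation E0 := (r^-1 `^ p * r ^+ 3).
Notation kap tau := (E0 * (pi *+ 2 + tau * ((3 - p) * W / r))).

Lemma is_derive_gamt tau (x : R) : is_derive x 1 (gamt tau) (gamt' tau x).
Proof.
apply: is_derive_rV => i.
rewrite (_ : (fun y => _) = fun y => gam y 0 i + tau * Phi y 0 i); last first.
  by apply/funext => y; rewrite mxE [X in _ + X]mxE.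
rewrite mxE [X in _ + X]mxE; apply: is_derive_add.
  exact/is_derive_coord/is_derive_circle.
by apply: is_derive_scale; exact/is_derive_coord.
Qed.

Lemma continuous_gamt' tau i : continuous (fun x => gamt' tau x 0 i).
Proof.
rewrite (_ : (fun y => _) = fun y => 1 * gam' y 0 i + tau * g y 0 i); last first.
  by apply/funext => y; rewrite mxE [X in _ + X]mxE mul1r.
by apply: continuous_lin => //; exact: continuous_tangent.
Qed.

Lemma menger_energyE tau : menger_energy p (gamt tau) =
  integral3 I I I (fun s t x => (dens tau s t x)%:E).
Proof.
have d1 (x : R) : speed (gamt tau) x = enorm (gamt' tau x).
  by rewrite /speed derive1E; have [_ ->] := is_derive_gamt tau x.
apply: eq_integral => s _; apply: eq_integral => t _; apply: eq_integral => x _.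
congr EFin; rewrite !d1 /menger_c /curve_density /edge_density.
have -> : gamt tau s - gamt tau x = - (gamt tau x - gamt tau s) by rewrite opprB.
have -> : gamt tau x - gamt tau s - (gamt tau t - gamt tau s) = gamt tau x - gamt tau t.
  by rewrite opprB addrA subrK.
by rewrite enormN.
Qed.

Let pg := periodic_derivative dPhi pPhi.

Let pc tau x : gamt tau (x + pi *+ 2) = gamt tau x.
Proof. by rewrite /= circle_periodic pPhi. Qed.

Let pc' tau x : gamt' tau (x + pi *+ 2) = gamt' tau x.
Proof. by rewrite /= pg /tangent sinD2pi cosD2pi. Qed.

Lemma density_ge0 (c c' : R -> 'rV[R]_3) s t x : 0 <= curve_density p c c' s t x.
Proof. by rewrite /curve_density /edge_density !mulr_ge0 ?powR_ge0 ?enorm_ge0. Qed.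

(** Brings the base point s to the innermost integral with the offsets fixed outside, the order in
    which the first variation can be averaged. *)
Lemma integral3_swing (f : R -> R -> R -> \bar R) : measurable3 f ->
  (forall s t x, 0 <= f s t x)%E ->
  (forall s t x, f s (t + pi *+ 2) x = f s t x) ->
  (forall s t x, f s t (x + pi *+ 2) = f s t x) ->
  integral3 I I I f = integral3 J J I (fun a b s => f s (s + a) (s + b)).
Proof.
move=> mf f0 pt px.
have mI := measurable_itv `[0%R, (pi *+ 2)%R : R].
have mJ := measurable_itv `[(- pi)%R, pi%R : R].
apply: (eq_trans (ge0_integral3_shift mf f0 pt px)).
apply: (@ge0_integral3_rotate _ (fun s a b => f s (s + a) (s + b)) I J J mI mJ mJ) => //.
have m11 : measurable_fun [set: R * R * R] (fun z => z.1.1) by apply: measurableT_comp.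
have m12 : measurable_fun [set: R * R * R] (fun z => z.1.2) by apply: measurableT_comp.
by apply: (measurable3_comp mf) => //; exact: measurable_funD.
Qed.

Lemma measurable3_swing (f : R -> R -> R -> \bar R) : measurable3 f ->
  measurable3 (fun a b s => f s (s + a) (s + b)).
Proof.
move=> mf.
have m11 : measurable_fun [set: R * R * R] (fun z => z.1.1) by apply: measurableT_comp.
have m12 : measurable_fun [set: R * R * R] (fun z => z.1.2) by apply: measurableT_comp.
by apply: (measurable3_comp mf) => //; exact: measurable_funD.
Qed.

(** For fixed nondegenerate offsets the first order model of the density is E0 (1 + tau V(s)), and
    its integral over s is the constant [kap tau] by [average_variation]. *)
Lemma slice_compare tau (a b : R) :
  sin (a / 2) != 0 -> sin (b / 2) != 0 -> sin (b / 2 - a / 2) != 0 ->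
  (\int[mu]_(s in I) (dens tau s (s + a) (s + b))%:E <=
    (kap tau)%:E + \int[mu]_(s in I) (rem tau s (s + a) (s + b))%:E)%E /\
  ((kap tau)%:E <= \int[mu]_(s in I) (dens tau s (s + a) (s + b))%:E +
    \int[mu]_(s in I) (rem tau s (s + a) (s + b))%:E)%E.
Proof.
move=> sa sb sab.
have [cV iV] := average_variation m hr huu hvv huv dPhi cg pPhi p sa sb sab.
move: cV iV; set V := (fun s => edge_variation _ _ _ _ _ _ _ _ _ _ _) => cV iV.
have c1 : continuous (fun _ : R => 1 : R) by move=> x; exact: cst_continuous.
pose l s := E0 * 1 + (tau * E0) * V s.
have cl : continuous l := @continuous_lin R _ _ E0 (tau * E0) c1 cV.
have pi2 : 0 <= pi *+ 2 :> R by rewrite mulrn_wge0// pi_ge0.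
have il : period_integral l = kap tau.
  rewrite /l (@period_integral_lin R _ _ E0 (tau * E0) c1 cV) iV.
  have -> : period_integral (fun _ : R => 1) = pi *+ 2 :> R.
    apply: EFin_inj; rewrite -(period_integralE c1).
    by rewrite (integral_itv_cst _ pi2) subr0 mul1r.
  by ring.
have remE s : rem tau s (s + a) (s + b) = `|dens tau s (s + a) (s + b) - l s|.
  have sab' : sin ((b - a) / 2) != 0 by rewrite mulrBl.
  have e : curve_density p gam gam' s (s + a) (s + b) = E0.
    exact: edge_density_circle.
  rewrite /curve_remainder /curve_variation e /l; congr `|_|.
  by rewrite -/(V s); ring.
have md : measurable_fun [set: R] (fun s => dens tau s (s + a) (s + b)).
  have := @measurable3_density R p _ _ (continuous_coord_derivable (is_derive_gamt tau))
    (fun i => @continuous_gamt' tau i).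
  move=> h; apply/measurable_EFinP.
  apply: (measurable3_comp h) => //; exact: measurable_funD.
have := integral_compare md (fun s => density_ge0 _ _ _ _ _) cl.
rewrite il; under [in X in (_ <= _ + X)%E /\ _]eq_integral do rewrite -remE.
by under [in X in _ /\ (_ <= _ + X)%E]eq_integral do rewrite -remE.
Qed.

(** Integrates the slice bounds over the offsets. The constant k is represented as a triple integral
    of k / (2 pi), so that monotonicity applies to three-fold integrands. The upper bound also shows
    that the integral of D is finite. *)
Lemma integral3_compare (D Re : R -> R -> R -> \bar R) (k c : R) :
  measurable3 D -> measurable3 Re ->
  (forall a b s, 0 <= D a b s)%E -> (forall a b s, 0 <= Re a b s)%E -> 0 <= k ->
  (forall a b, sin (a / 2) != 0 -> sin (b / 2) != 0 -> sin (b / 2 - a / 2) != 0 ->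
    (\int[mu]_(s in I) D a b s <= k%:E + \int[mu]_(s in I) Re a b s)%E /\
    (k%:E <= \int[mu]_(s in I) D a b s + \int[mu]_(s in I) Re a b s)%E) ->
  (integral3 J J I Re <= c%:E)%E ->
  exists2 M : R, integral3 J J I D = M%:E & `|M - k * (pi *+ 2) ^+ 2| <= c.
Proof.
move=> mD mRe D0 Re0 kap0 slice XC.
have pi0 : 0 < pi *+ 2 :> R by rewrite pmulrn_lgt0// pi_gt0.
have mI := measurable_itv `[0%R, (pi *+ 2)%R : R].
have mJ := measurable_itv `[(- pi)%R, pi%R : R].
pose K (a b s : R) := (k / (pi *+ 2))%:E.
have mK : measurable3 K by exact: measurable_cst.
have K0 a b s : (0 <= K a b s)%E by rewrite lee_fin divr_ge0// ltW.
have KE (a b : R) : (\int[mu]_(s in I) K a b s = k%:E)%E.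
  by rewrite /K (integral_itv_cst _ (ltW pi0)) subr0 divfK// gt_eqF.
have pipi : - pi <= pi :> R by have := @pi_ge0 R => h; rewrite (le_trans _ h)// oppr_le0.
have K3 : integral3 J J I K = (k * (pi *+ 2) ^+ 2)%:E.
  have JE (e : R) : (\int[mu]_(x in J) e%:E = (e * (pi *+ 2))%:E)%E.
    by rewrite (integral_itv_cst _ pipi) opprK -mulr2n.
  rewrite /integral3; under eq_integral do under eq_integral do rewrite KE.
  under eq_integral do rewrite JE.
  by rewrite JE -mulrA.
have mi f (mf : measurable3 f) (f0 : forall a b s, (0 <= f a b s)%E) :=
  measurable3_integral mI mf f0.
have sum2 f1 f2 : measurable3 f1 -> measurable3 f2 -> (forall a b s, 0 <= f1 a b s)%E ->
    (forall a b s, 0 <= f2 a b s)%E -> forall a b : R,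
    (\int[mu]_(s in I) (f1 a b s + f2 a b s) =
     \int[mu]_(s in I) f1 a b s + \int[mu]_(s in I) f2 a b s)%E.
  move=> mf1 mf2 f10 f20 a b.
  apply: (@ge0_integralD _ _ _ mu I mI _ _ (fun s _ => f10 a b s) _ (fun s _ => f20 a b s)).
    exact: measurable_funTS (measurable3_comp mf1 (measurable_cst a) (measurable_cst b) (@measurable_id _ _ _)).
  exact: measurable_funTS (measurable3_comp mf2 (measurable_cst a) (measurable_cst b) (@measurable_id _ _ _)).
have mKR : measurable3 (fun a b s => K a b s + Re a b s)%E by exact: emeasurable_funD.
have mDR : measurable3 (fun a b s => D a b s + Re a b s)%E by exact: emeasurable_funD.
have KR0 a b s : (0 <= K a b s + Re a b s)%E by exact: adde_ge0.
have DR0 a b s : (0 <= D a b s + Re a b s)%E by exact: adde_ge0.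
have i1 f (f0 : forall a b s : R, (0 <= f a b s)%E) (a b : R) :
  (0 <= \int[mu]_(s in I) f a b s)%E by apply: integral_ge0.
have up : (integral3 J J I D <= (k * (pi *+ 2) ^+ 2)%:E + integral3 J J I Re)%E.
  rewrite -K3 -(ge0_integral3D mJ mJ mI mK mRe K0 Re0).
  apply: (ge0_le_integral_nondegenerate (mi _ mD D0) (mi _ mKR KR0) (i1 _ D0) (i1 _ KR0)).
  move=> a b sa sb sab; rewrite (sum2 _ _ mK mRe K0 Re0) KE.
  exact: (slice _ _ sa sb sab).1.
have lo : ((k * (pi *+ 2) ^+ 2)%:E <= integral3 J J I D + integral3 J J I Re)%E.
  rewrite -K3 -(ge0_integral3D mJ mJ mI mD mRe D0 Re0).
  apply: (ge0_le_integral_nondegenerate (mi _ mK K0) (mi _ mDR DR0) (i1 _ K0) (i1 _ DR0)).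
  move=> a b sa sb sab; rewrite (sum2 _ _ mD mRe D0 Re0) KE.
  exact: (slice _ _ sa sb sab).2.
have Mfin : integral3 J J I D \is a fin_num.
  rewrite ge0_fin_numE; last exact: integral3_ge0.
  apply: (le_lt_trans up); apply: (le_lt_trans (leeD (lexx _) XC)).
  by rewrite -EFinD ltry.
have up' := le_trans up (leeD (lexx _) XC).
have lo' := le_trans lo (leeD (lexx _) XC).
rewrite -(fineK Mfin) -EFinD lee_fin in up'; rewrite -(fineK Mfin) -EFinD lee_fin in lo'.
exists (fine (integral3 J J I D)); first by rewrite fineK.
by rewrite ler_norml; apply/andP; split; rewrite ?lerBlDl// lerNl opprB lerBlDl.
Qed.

Lemma energy_expansion : exists C t0 : R, [/\ 0 <= C, 0 < t0 &
  forall tau, `|tau| <= t0 -> exists2 M : R, menger_energy p (gamt tau) = M%:E &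
  `|M - E0 * ((pi *+ 2) ^+ 3 + tau * ((3 - p) * (pi *+ 2) ^+ 2 * W / r))| <= C * tau ^+ 2].
Proof.
have [C [t0 [C0 t00 hC]]] := remainder_integral_le m hr huu hvv huv p2 dPhi cg pPhi slob.
have pi0 : 0 < pi *+ 2 :> R by rewrite pmulrn_lgt0// pi_gt0.
have mI := measurable_itv `[0%R, (pi *+ 2)%R : R].
have mJ := measurable_itv `[(- pi)%R, pi%R : R].
pose w := `|(3 - p) * W / r|; have w0 : 0 <= w by exact: normr_ge0.
have w1 : 0 < 1 + w by rewrite ltr_wpDr.
(* The second bound on tau keeps [kap tau] nonnegative, as [integral3_compare] requires of its
   constant. *)
exists C, (Num.min t0 (pi *+ 2 / (1 + w))); split => //.
  by rewrite lt_min t00 divr_gt0.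
move=> tau; rewrite le_min => /andP[tt0 tw].
have E00 : 0 <= E0 by rewrite mulr_ge0 ?powR_ge0// exprn_ge0// ltW.
have kap0 : 0 <= kap tau.
  rewrite mulr_ge0//; have : - (tau * ((3 - p) * W / r)) <= pi *+ 2.
    apply: (le_trans (ler_norm _)); rewrite normrN normrM -/w.
    apply: (@le_trans _ _ (pi *+ 2 / (1 + w) * (1 + w))); last by rewrite divfK// gt_eqF.
    by apply: ler_pM => //; rewrite lerDr.
  by rewrite -subr_ge0 opprK.
have md := @measurable3_density R p _ _ (continuous_coord_derivable (is_derive_gamt tau))
    (fun i => @continuous_gamt' tau i).
have mr := @measurable3_remainder R m u v r Phi g p dPhi cg tau.
have d0 s t x : (0 <= (dens tau s t x)%:E)%E by rewrite lee_fin density_ge0.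
have r0 s t x : (0 <= (rem tau s t x)%:E)%E by rewrite lee_fin; exact: normr_ge0.
have pgam : periodic gam (pi *+ 2) by move=> x; exact: circle_periodic.
have pgam' : periodic gam' (pi *+ 2) by move=> x; rewrite /tangent sinD2pi cosD2pi.
have dpt s t x : (dens tau s (t + pi *+ 2) x)%:E = (dens tau s t x)%:E.
  by rewrite (curve_density_periodic p (pc tau) (pc' tau) s t x).1.
have dpx s t x : (dens tau s t (x + pi *+ 2))%:E = (dens tau s t x)%:E.
  by rewrite (curve_density_periodic p (pc tau) (pc' tau) s t x).2.
have rpt s t x : (rem tau s (t + pi *+ 2) x)%:E = (rem tau s t x)%:E.
  by rewrite (curve_remainder_periodic p tau pgam pgam' pPhi pg s t x).1.
have rpx s t x : (rem tau s t (x + pi *+ 2))%:E = (rem tau s t x)%:E.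
  by rewrite (curve_remainder_periodic p tau pgam pgam' pPhi pg s t x).2.
have hM := integral3_swing md d0 dpt dpx.
have hR := integral3_swing mr r0 rpt rpx.
pose D (a b s : R) := (dens tau s (s + a) (s + b))%:E.
pose Re (a b s : R) := (rem tau s (s + a) (s + b))%:E.
have mD : measurable3 D by exact: (measurable3_swing md).
have mRe : measurable3 Re by exact: (measurable3_swing mr).
have D0 a b s : (0 <= D a b s)%E by exact: d0.
have Re0 a b s : (0 <= Re a b s)%E by exact: r0.
have [M ME hM'] : exists2 M : R, integral3 J J I D = M%:E &
    `|M - kap tau * (pi *+ 2) ^+ 2| <= C * tau ^+ 2.
  apply: (integral3_compare mD mRe D0 Re0 kap0 (slice_compare tau)).
  exact: (eq_ind _ (fun z => z <= (C * tau ^+ 2)%:E)%E (hC tau tt0) _ hR).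
exists M; first exact: (eq_trans (menger_energyE tau) (eq_trans hM ME)).
suff <- : kap tau * (pi *+ 2) ^+ 2 =
  E0 * ((pi *+ 2) ^+ 3 + tau * ((3 - p) * (pi *+ 2) ^+ 2 * W / r)) by [].
by move: W E0 => w' e0; ring.
Qed.

End EnergyExpansion.

(** * First order expansion of the length *)

Section LengthExpansion.
Context {R : realType} (m u v : 'rV[R]_3) (r : R).
Hypotheses (hr : 0 < r) (huu : dot u u = 1) (hvv : dot v v = 1) (huv : dot u v = 0).
Variables (Phi g : R -> 'rV[R]_3).
Hypothesis dPhi : forall x : R, is_derive x 1 Phi (g x).
Hypothesis cg : forall i, continuous (fun x => g x 0 i).
Hypothesis pPhi : periodic Phi (pi *+ 2).
Notation mu := (@lebesgue_measure R).
Notation I := (`[0%R, (pi *+ 2)%R : R]%classic).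
Notation W := (normal_mass u v Phi).
Notation gamt tau := (fun x => circle m u v r x + tau *: Phi x).
Notation gamt' tau := (fun x => r *: tangent u v x + tau *: g x).

Lemma integral_approx (d l : R -> R) (c : R) :
  measurable_fun [set: R] d -> (forall x, 0 <= d x) -> continuous l ->
  (forall x, `|d x - l x| <= c) ->
  exists2 L : R, (\int[mu]_(x in I) (d x)%:E = L%:E)%E &
    `|L - period_integral l| <= c * (pi *+ 2).
Proof.
move=> md d0 cl hc.
have pi2 : 0 <= pi *+ 2 :> R by rewrite mulrn_wge0// pi_ge0.
have mI := measurable_itv `[0%R, (pi *+ 2)%R : R].
have c0 : 0 <= c := le_trans (normr_ge0 _) (hc 0).
have XC : (\int[mu]_(x in I) `|d x - l x|%:E <= (c * (pi *+ 2))%:E)%E.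
  have <- : (\int[mu]_(x in I) c%:E = (c * (pi *+ 2))%:E)%E.
    by rewrite (integral_itv_cst _ pi2) subr0.
  apply: ge0_le_integral => //; last by move=> x _; rewrite lee_fin.
  - apply: measurable_funTS; apply/measurable_EFinP; apply: measurableT_comp => //.
    by apply: measurable_funB => //; exact: continuous_measurable_fun.
have [up lo] := integral_compare md d0 cl.
have up' := le_trans up (leeD (lexx _) XC).
have lo' := le_trans lo (leeD (lexx _) XC).
have Mfin : (\int[mu]_(x in I) (d x)%:E)%E \is a fin_num.
  rewrite ge0_fin_numE; last by apply: integral_ge0 => x _; rewrite lee_fin.
  by apply: (le_lt_trans up'); rewrite -EFinD ltry.
rewrite -(fineK Mfin) -EFinD lee_fin in up'; rewrite -(fineK Mfin) -EFinD lee_fin in lo'.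
exists (fine (\int[mu]_(x in I) (d x)%:E)%E); first by rewrite fineK.
by rewrite ler_norml; apply/andP; split; rewrite ?lerBlDl// lerNl opprB lerBlDl.
Qed.

(** The speed is expanded by [approx1_side] with exponent 1, uniformly in x since |Phi'| is bounded
    and the circle has constant speed r. Its linear term integrates to W by [average_speed]. *)
Lemma length_expansion : exists C t0 : R, [/\ 0 <= C, 0 < t0 &
  forall tau, `|tau| <= t0 -> exists2 L : R, curve_length (gamt tau) = L%:E &
  `|L - (r * (pi *+ 2) + tau * W)| <= C * tau ^+ 2].
Proof.
have pi2 : 0 < pi *+ 2 :> R by rewrite pmulrn_lgt0// pi_gt0.
have [M M0 gM] := periodic_rV_bounded pi2 cg (periodic_derivative dPhi pPhi).
have gle x : enorm (g x) <= 2 * M by exact: enorm_le_coord.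
pose c := 1 + 2 * M / r.
have c1 : 1 <= c by rewrite lerDl divr_ge0// ?mulr_ge0// ltW.
have [C [t0 [C1 t00 hC]]] := approx1_side 1 c1.
exists (r * C * (pi *+ 2)), t0; split => //.
  by rewrite !mulr_ge0// ?ltW// (lt_le_trans _ C1).
move=> tau tt0.
have nV x : enorm (r *: tangent u v x) = r.
  by rewrite enormZ enorm_tangent// mulr1 gtr0_norm.
pose d x := enorm (gamt' tau x).
pose l x := r * 1 + tau * dot (tangent u v (x + 0)) (g (x + 0)).
have [cs is_] := average_speed u v dPhi cg pPhi 0.
have ones : continuous (fun _ : R => 1 : R) by move=> x; exact: cst_continuous.
have cl : continuous l := @continuous_lin R _ _ r tau ones cs.
have md : measurable_fun [set: R] d.
  by apply: measurable_enorm => i; apply: continuous_measurable_fun; exact: continuous_gamt'.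
have hd x : `|d x - l x| <= r * C * tau ^+ 2.
  have h : enorm (g x) <= c * enorm (r *: tangent u v x).
    rewrite nV /c mulrDl divfK ?gt_eqF// mul1r.
    by apply: (le_trans (gle x)); rewrite lerDr ltW.
  have V0 : 0 < enorm (r *: tangent u v x) by rewrite nV.
  have [+ _] := hC tau _ _ tt0 V0 h.
  have dr0 : 0 <= d x / r by rewrite divr_ge0 ?enorm_ge0// ltW.
  rewrite -/(d x) [in X in _ * (_ * (_ / X))]enorm_sqrE !nV (powRr1 dr0) (dotZl r) mul1r => k.
  have -> : d x - l x = r * (d x / r - 1 - tau * (r * dot (tangent u v x) (g x) / (r * r))).
    by rewrite /l addr0; move: (dot _ _) (d x) => a b; field; rewrite gt_eqF.
  by rewrite normrM (gtr0_norm hr) -[leRHS]mulrA; apply: ler_wpM2l => //; exact: ltW.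
have d0 x : 0 <= d x by exact: enorm_ge0.
have [L LE hL] := integral_approx md d0 cl hd.
exists L.
  rewrite /curve_length -LE; apply: eq_integral => x _; congr EFin.
  by rewrite /speed derive1E; have [_ ->] := is_derive_gamt m u v r dPhi tau x.
rewrite mulrAC; suff <- : period_integral l = r * (pi *+ 2) + tau * W by [].
rewrite /l (@period_integral_lin R _ _ r tau ones cs) is_; congr (_ * _ + _).
apply: EFin_inj; rewrite -(period_integralE ones).
by rewrite (integral_itv_cst _ (ltW pi2)) subr0 mul1r.
Qed.

End LengthExpansion.

(** * Derivatives from error estimates *)

Section DeriveEpsilonDelta.
Context {R : realType}.

Lemma is_derive_eps (f : R -> R) (x b : R) :
  (forall e : R, 0 < e -> exists2 d : R, 0 < d & forall h, `|h| < d ->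
    `|f (x + h) - f x - h * b| <= e * `|h|) ->
  is_derive x 1 f b.
Proof.
move=> hf.
have cv : h^-1 *: (f (h *: 1 + x) - f x) @[h --> 0^'] --> b.
  apply/cvgrPdist_le => e e0; have [d d0 hd] := hf e e0.
  near=> h.
  have hn0 : h != 0 by near: h; exact: nbhs_dnbhs_neq.
  have hlt : `|h| < d.
    by near: h; exact: dnbhs0_lt.
  rewrite distrC [h *: 1](mulr1 h) (addrC h).
  have -> : h^-1 *: (f (x + h) - f x) - b = h^-1 * (f (x + h) - f x - h * b).
    by rewrite [RHS]mulrBr mulKf.
  rewrite normrM normfV mulrC ler_pdivrMr ?normr_gt0//.
  exact: hd.
by apply: DeriveDef; [apply/cvg_ex; exists b|exact: cvg_lim].
Unshelve. all: by end_near. Qed.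

Lemma is_derive_quadratic (f : R -> R) (a b C t0 : R) : 0 < t0 ->
  (forall t, `|t| <= t0 -> `|f t - (a + t * b)| <= C * t ^+ 2) ->
  f 0 = a /\ is_derive (0 : R) (1 : R) f b.
Proof.
move=> t00 hf.
have f0 : f 0 = a.
  have := hf 0; rewrite normr0 ltW// => /(_ isT).
  by rewrite expr0n/= mulr0 normr_le0 mul0r addr0 subr_eq0 => /eqP.
split=> //; apply: is_derive_eps => e e0.
have C1 : 0 < `|C| + 1 by rewrite ltr_wpDl.
exists (Num.min t0 (e / (`|C| + 1))); first by rewrite lt_min t00 divr_gt0.
move=> h; rewrite lt_min => /andP[ht he]; rewrite add0r f0.
have -> : f h - a - h * b = f h - (a + h * b) by rewrite opprD addrA.
apply: (le_trans (hf h (ltW ht))).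
rewrite -(@real_normK _ h) ?num_real// expr2 mulrA ler_wpM2r//.
rewrite ltr_pdivlMr// in he.
apply: (le_trans _ (ltW he)); rewrite mulrC ler_wpM2l//.
by rewrite (le_trans (ler_norm _))// lerDl.
Qed.

End DeriveEpsilonDelta.

(** * The first variations at the circle *)

Section CircleStationary.
Context {R : realType} (m u v : 'rV[R]_3) (r : R).
Hypotheses (hr : 0 < r) (huu : dot u u = 1) (hvv : dot v v = 1) (huv : dot u v = 0).
Variables (Phi g : R -> 'rV[R]_3) (p : R).
Hypothesis p2 : 2 <= p.
Hypothesis dPhi : forall x : R, is_derive x 1 Phi (g x).
Hypothesis cg : forall i, continuous (fun x => g x 0 i).
Hypothesis pPhi : periodic Phi (pi *+ 2).
Hypothesis slob : (slobodeckii p g < +oo)%E.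
Notation gam := (circle m u v r).
Notation W := (normal_mass u v Phi).
Notation gamt tau := (fun x => gam x + tau *: Phi x).
Notation E0 := (r^-1 `^ p * r ^+ 3).

Lemma circle_energy_derivative : exists M : R -> R,
  [/\ \forall t \near 0, menger_energy p (gamt t) = (M t)%:E,
      M 0 = E0 * (pi *+ 2) ^+ 3 &
      is_derive (0 : R) (1 : R) M (E0 * ((3 - p) * (pi *+ 2) ^+ 2 * W / r))].
Proof.
have [C [t0 [C0 t00 hM]]] := energy_expansion m hr huu hvv huv p2 dPhi cg pPhi slob.
exists (fun t => fine (menger_energy p (gamt t))).
have h t : `|t| <= t0 -> menger_energy p (gamt t) = (fine (menger_energy p (gamt t)))%:E.
  by move=> /hM[M ->].
have [] := @is_derive_quadratic R (fun t => fine (menger_energy p (gamt t)))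
  (E0 * (pi *+ 2) ^+ 3) (E0 * ((3 - p) * (pi *+ 2) ^+ 2 * W / r)) C t0 t00.
  move=> t /hM[M -> hC]; rewrite mulrDr in hC.
  by rewrite [t * (E0 * _)]mulrCA.
move=> f0 df; split=> //.
exact: filterS h (@nbhs0_le R R^o _ t00).
Qed.

Lemma circle_length_derivative : exists L : R -> R,
  [/\ \forall t \near 0, curve_length (gamt t) = (L t)%:E,
      L 0 = r * (pi *+ 2) & is_derive (0 : R) (1 : R) L W].
Proof.
have [C [t0 [C0 t00 hM]]] := length_expansion m hr huu hvv huv dPhi cg pPhi.
exists (fun t => fine (curve_length (gamt t))).
have h t : `|t| <= t0 -> curve_length (gamt t) = (fine (curve_length (gamt t)))%:E.
  by move=> /hM[M ->].
have [] := @is_derive_quadratic R (fun t => fine (curve_length (gamt t)))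
  (r * (pi *+ 2)) W C t0 t00.
  by move=> t /hM[M ->].
move=> f0 df; split=> //.
exact: filterS h (@nbhs0_le R R^o _ t00).
Qed.

Lemma circle_energy_variation : p = 3 -> is_first_variation (menger_energy p) gam Phi 0.
Proof.
move=> p3; have [M [ME M0 dM]] := circle_energy_derivative.
split; first by apply: filterS ME => t ->.
apply: (@near_eq_is_derive R R R M).
- by apply: filterS ME => t ->.
- by apply: (is_derive_eq1 dM); rewrite p3 subrr !mul0r mulr0.
Qed.

(** M'/M = (3 - p) W / (2 pi r) and L'/L = W / (2 pi r) at 0, so the logarithmic derivative of
    M^(1/p) L^((p - 3)/p) is zero. *)
Lemma circle_scaled_energy_variation : is_first_variation (scaled_energy p) gam Phi 0.
Proof.
have [M [ME M0 dM]] := circle_energy_derivative.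
have [L [LE L0 dL]] := circle_length_derivative.
have E : \forall t \near 0, scaled_energy p (gamt t) = (M t `^ p^-1 * L t `^ ((p - 3) / p))%:E.
  by near=> t; rewrite /scaled_energy (near ME)// (near LE)// !poweR_EFin.
split; first by apply: filterS E => t ->.
apply: (@near_eq_is_derive R R R (fun t => M t `^ p^-1 * L t `^ ((p - 3) / p))).
- by apply: filterS E => t ->.
have pi0 : 0 < pi *+ 2 :> R by rewrite pmulrn_lgt0// pi_gt0.
have p0 : 0 < p by exact: (lt_le_trans _ p2).
have E00 : 0 < E0 by rewrite mulr_gt0 ?powR_gt0 ?exprn_gt0 ?invr_gt0.
have M00 : 0 < M 0 by rewrite M0 mulr_gt0// exprn_gt0.
have L00 : 0 < L 0 by rewrite L0 mulr_gt0.
pose a := p^-1; pose b := (p - 3) / p.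
have := is_derive_mul (is_derive_comp (is_derive_powR a M00) dM)
  (is_derive_comp (is_derive_powR b L00) dL).
move=> d; apply: (is_derive_eq1 d).
have pw x e : 0 < x -> x `^ (e - 1) = x `^ e / x.
  move=> x0; rewrite powRD ?powRN ?powRr1 ?(ltW x0)//.
  by rewrite (gt_eqF x0) implybT.
rewrite !pw// M0 L0 /a /b.
set A := _ `^ p^-1; set B := _ `^ ((p - 3) / p).
(* The cancellation in abstract form, with P for 2 pi, e for E0 and w for W. *)
have alg (P e w : R) : P != 0 -> e != 0 ->
    p^-1 * (A / (e * P ^+ 3)) * (e * ((3 - p) * P ^+ 2 * w / r)) * B +
    A * ((p - 3) / p * (B / (r * P)) * w) = 0.
  by move=> P0 e0; field; rewrite P0 e0 (gt_eqF hr) (gt_eqF p0).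
apply: (eq_trans _ (alg _ _ W (negbT (gt_eqF pi0)) (negbT (gt_eqF E00)))).
by [].

Unshelve. all: by end_near. Qed.

End CircleStationary.

(** * Integrability of powers of the distance to the origin *)

Section AbsPowerIntegral.
Context {R : realType}.
Notation mu := (@lebesgue_measure R).
Notation J := (`[(- pi)%R, pi%R : R]%classic).

Lemma ler_powR_neg (x y q : R) : q <= 0 -> 0 < x -> x <= y -> y `^ q <= x `^ q.
Proof.
move=> q0 x0 xy; have y0 := lt_le_trans x0 xy.
rewrite -(opprK q) -(inv_powR _ (ltW x0)) -(inv_powR _ (ltW y0)).
apply: ge0_ler_powR; first by rewrite oppr_ge0.
- by rewrite nnegrE invr_ge0 ltW.
- by rewrite nnegrE invr_ge0 ltW.
- by rewrite lef_pV2.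
Qed.

(* The antiderivative [w (e + w^2)^(q/2)] has derivative at least [(1 + q) (e + w^2)^(q/2)]. *)
Lemma integral_regularized_powR (q e : R) : -1 < q -> q < 0 -> 0 < e ->
  (\int[mu]_(w in J) ((e + w ^+ 2) `^ (q / 2))%:E <=
   ((1 + q)^-1 * (2 * pi * (pi ^+ 2) `^ (q / 2)))%:E)%E.
Proof.
move=> q1 q0 e0; have pi0 := @pi_gt0 R.
have ew (w : R) : 0 < e + w ^+ 2 by rewrite ltr_wpDr ?sqr_ge0.
pose h a (w : R) := (e + w ^+ 2) `^ a.
have dh a (w : R) : is_derive w 1 (h a) (a * (e + w ^+ 2) `^ (a - 1) * (0 + (1 * w + w * 1))).
  apply: (@is_derive_comp R (fun y => y `^ a) (fun w => e + w ^+ 2)).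
    exact: is_derive_powR.
  by apply: is_derive_add; apply: is_derive_mul.
have ch a : continuous (h a) by move=> w; exact: is_derive_continuous (dh a w).
pose F w := w * h (q / 2) w.
pose dF w := h (q / 2) w + q * (w * w * h (q / 2 - 1) w).
have dFE (w : R) : is_derive w 1 F (dF w).
  have := is_derive_mul (is_derive_id w 1) (dh (q / 2) w).
  move=> d; apply: (is_derive_eq1 d); rewrite /dF /h.
  by move: (_ `^ (q / 2 - 1)) (_ `^ (q / 2)) => a b; field.
have cdF : continuous dF.
  move=> w; apply: (@cvgD R R R (nbhs w)); first exact: ch.
  apply: (@cvgM R R (nbhs w)); first exact: cvg_cst.
  by apply: (@cvgM R R (nbhs w)); [apply: (@cvgM R R (nbhs w)); exact: cvg_id|exact: ch].
have hle w : (1 + q) * h (q / 2) w <= dF w.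
  rewrite /dF mulrDl mul1r lerD2l ler_nM2l// /h.
  rewrite powRD; last by rewrite (gt_eqF (ew w)) implybT.
  rewrite powR_inv1 ?(ltW (ew w))// mulrC -mulrA ler_piMr ?powR_ge0//.
  by rewrite mulrC ler_pdivrMr// mul1r -expr2 lerDr ltW.
have pipi : - pi < pi :> R by rewrite (lt_trans _ pi0)// oppr_lt0.
have q1' : 0 < 1 + q by rewrite -ltrBlDl sub0r.
have mh a : measurable_fun [set: R] (h a) by exact: continuous_measurable_fun.
have mJ := measurable_itv `[(- pi)%R, pi%R : R].
have := integral_derivative pipi dFE cdF => i.
apply: (@le_trans _ _ (\int[mu]_(w in J) ((1 + q)^-1%:E * (dF w)%:E))%E).
  apply: ge0_le_integral; [exact: mJ| | | |].
  - by move=> w _; rewrite lee_fin powR_ge0.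
  - by apply: measurable_funTS; apply/measurable_EFinP; exact: mh.
  - apply: measurable_funTS; apply/measurable_EFinP; apply: measurable_funM => //.
    exact: continuous_measurable_fun.
  - move=> w _; rewrite -EFinM lee_fin [leRHS]mulrC ler_pdivlMr// mulrC; exact: hle.
rewrite ge0_integralZl//; last 3 first.
- by apply: measurable_funTS; apply/measurable_EFinP; exact: continuous_measurable_fun.
- move=> w _; rewrite lee_fin; apply: (le_trans _ (hle w)).
  by rewrite mulr_ge0 ?powR_ge0// ltW.
- by rewrite lee_fin invr_ge0 ltW.
rewrite i -EFinM lee_fin ler_wpM2l ?invr_ge0 ?(ltW q1')//.
have -> : F pi - F (- pi) = 2 * pi * (e + pi ^+ 2) `^ (q / 2).
  by rewrite /F /h sqrrN; ring.
apply: ler_wpM2l; first by rewrite mulr_ge0// ltW.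
by apply: ler_powR_neg; rewrite ?exprn_gt0 ?lerDr ?(ltW e0)//; lra.
Qed.

(** For q < 0 the window is exhausted by the sets |w| >= 1/(n + 1). There w^2 is at least half of
    e^2 + w^2 with e = 1/(n + 1), so |w|^q is bounded by the regularised power, whose integral is
    bounded uniformly in n. *)
Lemma integral_abs_powR (q : R) : -1 < q -> (\int[mu]_(w in J) (`|w| `^ q)%:E < +oo)%E.
Proof.
move=> q1; have pi0 := @pi_gt0 R.
have mJ := measurable_itv `[(- pi)%R, pi%R : R].
have mf : measurable_fun [set: R] (fun w : R => (`|w| `^ q)%:E).
  by apply/measurable_EFinP; apply: (measurableT_comp (@measurable_powR R q)); exact: normr_measurable.
have f0 (w : R) : (0 <= (`|w| `^ q)%:E)%E by rewrite lee_fin powR_ge0.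
have pipi : - pi <= pi :> R by rewrite (le_trans _ (ltW pi0))// oppr_le0 ltW.
have [q0|q0] := leP 0 q.
  apply: (@le_lt_trans _ _ (\int[mu]_(w in J) (pi `^ q)%:E)%E); last first.
    by rewrite (integral_itv_cst _ pipi) ltry.
  apply: ge0_le_integral => //; first exact: measurable_funTS.
  move=> w /=; rewrite in_itv/= -ler_norml => wpi; rewrite lee_fin.
  by apply: ge0_ler_powR; rewrite ?nnegrE// ltW.
pose e n : R := (n.+1%:R)^-1.
have e0 n : 0 < e n by rewrite invr_gt0.
(* The point 0 is included so that the union is the whole window; there the integrand is 0, as 0^q =
   0 for negative q. *)
pose Fn n := `[(- pi)%R, (- e n)%R]%classic `|` ([set 0%R] `|` `[e n, pi]%classic) : set R.
have mFn n : measurable (Fn n).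
  by apply: measurableU; [|apply: measurableU].
have FnE n w : Fn n w <-> J w /\ (w = 0 \/ e n <= `|w|).
  have en := e0 n; rewrite /Fn /= !in_itv/=; split.
  - move=> [/andP[h1 h2]|[->|/andP[h1 h2]]].
    + rewrite h1/=; split; first by lra.
      by right; rewrite ler0_norm; lra.
    + by split; [lra|left].
    + by rewrite h2 andbT; split; [lra|right; rewrite ger0_norm; lra].
  - move=> [/andP[h1 h2] [->|]]; first by right; left.
    have [w0|w0] := leP 0 w; first by rewrite ger0_norm// => h; right; right; rewrite h.
    by rewrite ltr0_norm// => h; left; rewrite h1 lerNr.
have UF : \bigcup_n Fn n = J.
  rewrite eqEsubset; split=> w; first by move=> [n _] /FnE[].
  move=> Jw; have [->|w0] := eqVneq w 0.
    by exists 0%N => //; apply/FnE; split; [rewrite /= in_itv/=; lra|left].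
  have nw : 0 < `|w| by rewrite normr_gt0.
  have [n _ /(_ n (leqnn n)) hn] := near_infty_natSinv_lt (PosNum nw).
  by exists n => //; apply/FnE; split=> //; right; exact: ltW.
have := @ge0_nondecreasing_set_cvg_integral _ (measurableTypeR R) R Fn (fun w : R => (`|w| `^ q)%:E) mu.
rewrite UF => cv.
pose B := (2 `^ (q / 2))^-1 * ((1 + q)^-1 * (2 * pi * (pi ^+ 2) `^ (q / 2))).
apply: (@le_lt_trans _ _ B%:E); last exact: ltry.
apply: (cvge_le _ (cv _ _ _ _)).
- apply: nearW => n.
  have h (w : R) : Fn n w -> ((`|w| `^ q)%:E <=
      (2 `^ (q / 2))^-1%:E * ((e n ^+ 2 + w ^+ 2) `^ (q / 2))%:E)%E.
    move=> /FnE[_ []]; rewrite -EFinM lee_fin.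
      by move=> ->; rewrite normr0 powR0 ?lt_eqF// mulr_ge0 ?invr_ge0 ?powR_ge0.
    move=> ew; have w0 : 0 < `|w| := lt_le_trans (e0 n) ew.
    have w2 : e n ^+ 2 <= w ^+ 2 by rewrite -(@real_normK _ w) ?num_real// lerXn2r ?nnegrE// ltW.
    have w20 : 0 < w ^+ 2 := lt_le_trans (exprn_gt0 2 (e0 n)) w2.
    have -> : `|w| `^ q = (w ^+ 2) `^ (q / 2).
      rewrite -(@real_normK _ w) ?num_real// -powR_mulrn// -powRrM.
      by congr (_ `^ _); field.
    rewrite [leRHS]mulrC ler_pdivlMr ?powR_gt0// -powRM// ?(ltW w20)//.
    by apply: ler_powR_neg; [lra|rewrite addr_gt0// exprn_gt0|lra].
  have mh : measurable_fun [set: R] (fun w => ((e n ^+ 2 + w ^+ 2) `^ (q / 2))%:E).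
    apply/measurable_EFinP; apply: (measurableT_comp (@measurable_powR R (q / 2))).
    exact: measurable_funD.
  have k0 : (0 <= (2 `^ (q / 2))^-1%:E :> \bar R)%E by rewrite lee_fin invr_ge0 powR_ge0.
  have h0 (w : R) : (0 <= ((e n ^+ 2 + w ^+ 2) `^ (q / 2))%:E)%E by rewrite lee_fin powR_ge0.
  apply: (@le_trans _ _ (\int[mu]_(w in Fn n)
      ((2 `^ (q / 2))^-1%:E * ((e n ^+ 2 + w ^+ 2) `^ (q / 2))%:E))%E).
    apply: ge0_le_integral; [exact: mFn|by []| |by apply: measurable_funTS; exact: measurable_funeM|exact: h].
    exact: measurable_funTS.
  rewrite ge0_integralZl; [|exact: mFn|exact: measurable_funTS|by []|exact: k0].
  rewrite /B EFinM; apply: lee_wpmul2l => //.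
  apply: (le_trans _ (integral_regularized_powR q1 q0 (exprn_gt0 2 (e0 n)))).
  apply: ge0_subset_integral; [exact: mFn|exact: mJ|exact: measurable_funTS|by []|].
  by move=> w /FnE[].
- move=> n k nk; rewrite subsetEset => w /FnE[Jw h]; apply/FnE; split=> //.
  case: h => [->|h]; [by left|right; apply: (le_trans _ h)].
  by rewrite /e lef_pV2 ?posrE// ler_nat.
- exact: mFn.
- by move=> n; exact: measurable_funTS.
- by [].
Qed.

End AbsPowerIntegral.

(** * Hoelder directions have finite Slobodeckii seminorm *)

Section HolderDirections.
Context {R : realType}.
Notation mu := (@lebesgue_measure R).
Notation I := (`[0%R, (pi *+ 2)%R : R]%classic).
Notation J := (`[(- pi)%R, pi%R : R]%classic).

Lemma holder_continuous (f : R -> R) (C alpha : R) : 0 < alpha ->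
  (forall x y, `|f x - f y| <= C * `|x - y| `^ alpha) -> continuous f.
Proof.
move=> a0 hf x; apply/cvgrPdist_le => e e0.
have C1 : 0 < `|C| + 1 by rewrite ltr_wpDl.
pose d := (e / (`|C| + 1)) `^ alpha^-1.
have d0 : 0 < d by rewrite powR_gt0// divr_gt0.
near=> y; apply: (le_trans (hf x y)).
have xy : `|x - y| <= d.
  by near: y; apply: cvgr_dist_le; [exact: cvg_id|].
apply: (@le_trans _ _ ((`|C| + 1) * d `^ alpha)).
  apply: (@le_trans _ _ ((`|C| + 1) * `|x - y| `^ alpha)).
    by rewrite ler_wpM2r ?powR_ge0// (le_trans (ler_norm _))// lerDl.
  rewrite ler_wpM2l ?(ltW C1)//.
  by apply: ge0_ler_powR; rewrite ?nnegrE ?(ltW a0) ?(ltW d0).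
rewrite /d -powRrM mulVf ?gt_eqF// powRr1; last by rewrite divr_ge0 ?(ltW e0) ?(ltW C1).
by rewrite mulrC divfK// gt_eqF.
Unshelve. all: by end_near. Qed.

Lemma measurable_slobodeckii (g : R -> 'rV[R]_3) (p : R) :
  (forall i, measurable_fun [set: R] (fun x => g x 0 i)) ->
  measurable_fun [set: R * R]
    (fun z => (enorm (g (z.1 + z.2) - g z.1) `^ p / `|z.2| `^ (p - 1))%:E).
Proof.
move=> mg; apply/measurable_EFinP; apply: measurable_funM.
  apply: (measurableT_comp (@measurable_powR R p)); apply: measurable_enorm.
  apply: measurable_vecB => i; apply: (measurableT_comp (mg i)) => //.
  exact: measurable_funD.
apply: measurable_inv_ge0; first by move=> z; exact: powR_ge0.
by apply: (measurableT_comp (@measurable_powR R (p - 1))); exact: measurableT_comp.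
Qed.

(** The integrand is at most |C|^p |w|^q with q = alpha p - p + 1, and q > -1 is equivalent to alpha
    > 1 - 2/p. *)
Lemma holder_slobodeckii (g : R -> 'rV[R]_3) (C alpha p : R) : 1 < p -> 1 - 2 / p < alpha ->
  (forall i, continuous (fun x => g x 0 i)) ->
  (forall x y, enorm (g x - g y) <= C * `|x - y| `^ alpha) -> (slobodeckii p g < +oo)%E.
Proof.
move=> p1 ha cg hC.
have p0 : 0 < p by exact: lt_trans p1.
pose q := alpha * p - p + 1.
have q1 : -1 < q.
  rewrite /q; have : p * (1 - 2 / p) < p * alpha by rewrite ltr_pM2l.
  by rewrite mulrBr mulrCA divff ?gt_eqF// !mulr1; lra.
have iq := integral_abs_powR q1.
set X := (\int[mu]_(w in J) (`|w| `^ q)%:E)%E in iq.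
have X0 : (0 <= X)%E by apply: integral_ge0 => w _; rewrite lee_fin powR_ge0.
have mI := measurable_itv `[0%R, (pi *+ 2)%R : R].
have mJ := measurable_itv `[(- pi)%R, pi%R : R].
have mq : measurable_fun [set: R] (fun w : R => (`|w| `^ q)%:E).
  by apply/measurable_EFinP; apply: (measurableT_comp (@measurable_powR R q)); exact: normr_measurable.
have pi0 : 0 <= pi *+ 2 :> R by rewrite mulrn_wge0// pi_ge0.
have ms := measurable_slobodeckii p (fun i => continuous_measurable_fun (@cg i)).
have s0 (z : R * R) : (0 <= (enorm (g (z.1 + z.2) - g z.1) `^ p / `|z.2| `^ (p - 1))%:E)%E.
  by rewrite lee_fin divr_ge0 ?powR_ge0.
have inner x : (\int[mu]_(w in J) (enorm (g (x + w) - g x) `^ p / `|w| `^ (p - 1))%:E <=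
    (`|C| `^ p)%:E * X)%E.
  rewrite /X -ge0_integralZl; [|exact: mJ|exact: measurable_funTS| |]; last 2 first.
  - by move=> w _; rewrite lee_fin powR_ge0.
  - by rewrite lee_fin powR_ge0.
  apply: ge0_le_integral; [exact: mJ| | | |].
  - by move=> w _; rewrite lee_fin divr_ge0 ?powR_ge0.
  - apply: measurable_funTS; exact: (measurableT_comp ms (measurable_fun_pair (measurable_cst x) (@measurable_id _ _ _))).
  - by apply: measurable_funTS; exact: measurable_funeM.
  - move=> w _; rewrite -EFinM lee_fin.
    have [->|w0] := eqVneq w 0.
      by rewrite addr0 subrr enorm0 powR0 ?gt_eqF// mul0r mulr_ge0 ?powR_ge0.
    have nw : 0 < `|w| by rewrite normr_gt0.
    rewrite ler_pdivrMr ?powR_gt0// -mulrA -powRD; last by rewrite (gt_eqF nw) implybT.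
    rewrite (_ : q + (p - 1) = alpha * p); last by rewrite /q; ring.
    rewrite powRrM -powRM ?powR_ge0//.
    apply: ge0_ler_powR; rewrite ?nnegrE ?(ltW p0) ?enorm_ge0 ?mulr_ge0 ?powR_ge0//.
    apply: (le_trans (hC _ _)); rewrite addrAC subrr add0r ler_wpM2r ?powR_ge0//.
    exact: ler_norm.
apply: (@le_lt_trans _ _ (\int[mu]_(x in I) ((`|C| `^ p)%:E * X))%E).
  apply: ge0_le_integral; [exact: mI| | | |].
  - by move=> x _; apply: integral_ge0 => w _; exact: (s0 (x, w)).
  - apply: measurable_funTS; exact: (measurable_integral_ge0 mJ ms s0).
  - exact: measurable_cst.
  - by move=> x _; exact: inner.
have -> : ((`|C| `^ p)%:E * X = (`|C| `^ p * fine X)%:E)%E.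
  by rewrite EFinM fineK// ge0_fin_numE.
by rewrite (integral_itv_cst _ pi0) ltry.
Qed.

End HolderDirections.

(** * Smooth periodic approximations of the indicator of an arc *)

Section LogisticBump.
Context {R : realType}.

(** A logistic function of cos z. For e = cos d and k tending to infinity it approaches, on
    [0, 2 pi], the indicator of [pi - d, pi + d]; it is smooth and 2 pi periodic by construction. *)
Definition bump (k e z : R) : R := (1 + expR (k * (cos z + e)))^-1.

Lemma bump_gt0 k e z : 0 < bump k e z.
Proof. by rewrite invr_gt0 ltr_wpDr// expR_ge0. Qed.

Lemma bump_le1 k e z : bump k e z <= 1.
Proof. by rewrite invf_le1 ?lerDl ?expR_ge0// ltr_wpDr// expR_ge0. Qed.

Lemma onem_bump k e z : 1 - bump k e z = bump (- k) e z.
Proof.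
rewrite /bump mulNr expRN; set y := expR _; have y0 : 0 < y by exact: expR_gt0.
have y1 : 0 < 1 + y by rewrite ltr_wpDr// ltW.
have y2 : 0 < 1 + y^-1 by rewrite ltr_wpDr// invr_ge0 ltW.
by field; rewrite !gt_eqF//= addrC.
Qed.

Lemma bump_le_expR k e z : bump k e z <= expR (- (k * (cos z + e))).
Proof. by rewrite expRN /bump lef_pV2 ?posrE ?expR_gt0 ?lerDr// ltr_wpDr// expR_ge0. Qed.

Definition dbump (k e z : R) : R := k * sin z * (bump k e z * (1 - bump k e z)).

Lemma is_derive_bump k e (z : R) : is_derive z 1 (bump k e) (dbump k e z).
Proof.
have y0 : 0 < expR (k * (cos z + e)) by exact: expR_gt0.
have y1 : 0 < 1 + expR (k * (cos z + e)) by rewrite ltr_wpDr// ltW.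
have dc : is_derive z 1 (fun x => cos x + e) (- sin z + 0) by apply: is_derive_add.
have dk := is_derive_scale k dc.
have dE : is_derive z 1 (fun x => expR (k * (cos x + e)))
    (expR (k * (cos z + e)) * (k * (- sin z + 0))).
  exact: (@is_derive_comp R expR (fun x => k * (cos x + e)) z _ _ (is_derive_expR _) dk).
have d1 : is_derive z 1 (fun x => 1 + expR (k * (cos x + e)))
    (0 + expR (k * (cos z + e)) * (k * (- sin z + 0))) by exact: is_derive_add.
have d2 := @is_deriveV R (fun x => 1 + expR (k * (cos x + e))) z _ 1 (negbT (gt_eqF y1)) d1.
apply: (is_derive_eq1 d2); rewrite /dbump /bump /GRing.scale/=.
by move: (expR _) y0 y1 => y y0 y1; field; rewrite gt_eqF.
Qed.

(** With theta = min(1, eta/2), exp(n eta/2) >= 1 + n eta/2 >= theta (n + 1). Squaring gives K =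
    theta^(-2). *)
Lemma expR_decay (eta : R) : 0 < eta -> exists2 K, 0 <= K & forall n : nat,
  n.+1%:R * expR (- (n%:R * eta)) <= K / n.+1%:R.
Proof.
move=> eta0; pose th := Num.min 1 (eta / 2).
have th0 : 0 < th by rewrite lt_min ltr01 divr_gt0.
exists (th ^- 2) => [|n]; first by rewrite invr_ge0 sqr_ge0.
rewrite ler_pdivlMr// mulrAC expRN ler_pdivrMr ?expR_gt0//.
rewrite ler_pdivlMl ?exprn_gt0// -expr2 -exprMn.
have -> : n%:R * eta = n%:R * (eta / 2) + n%:R * (eta / 2) by field.
rewrite expRD -expr2 lerXn2r ?nnegrE ?mulr_ge0 ?expR_ge0 ?(ltW th0)//.
apply: (le_trans _ (expR_ge1Dx _)).
rewrite -natr1 mulrDr mulr1 addrC lerD ?ge_min ?lexx//.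
by rewrite mulrC ler_wpM2l// ge_min lexx orbT.
Qed.

(** A class of expressions containing the shifted bump and closed under differentiation; by
    induction all iterated derivatives of the bump exist. *)
Inductive smooth_class (c k e : R) : (R -> R) -> Prop :=
| smooth_cst a : smooth_class c k e (fun _ => a)
| smooth_sin : smooth_class c k e (fun z => sin (z - c))
| smooth_cos : smooth_class c k e (fun z => cos (z - c))
| smooth_bump : smooth_class c k e (fun z => bump k e (z - c))
| smooth_add f h : smooth_class c k e f -> smooth_class c k e h ->
    smooth_class c k e (fun z => f z + h z)
| smooth_mul f h : smooth_class c k e f -> smooth_class c k e h ->
    smooth_class c k e (fun z => f z * h z).

Lemma is_derive_shift (f : R -> R) (c x a : R) :
  is_derive (x - c) 1 f a -> is_derive x 1 (fun z => f (z - c)) a.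
Proof.
move=> d; have := @is_derive_comp R f (fun z => z - c) x a (1 - 0) d.
rewrite subr0 mulr1; apply; rewrite -[X in is_derive _ _ _ X](subr0 (1 : R)).
exact: (is_derive_sub (is_derive_id x 1) (is_derive_cst c x 1)).
Qed.

Lemma smooth_class_derive c k e f : smooth_class c k e f ->
  exists2 df, smooth_class c k e df & forall x : R, is_derive x 1 f (df x).
Proof.
elim=> [a||||f1 h1 _ [df cf hf] _ [dh ch hh]|f1 h1 cf1 [df cf hf] ch1 [dh ch hh]].
- by exists (fun _ => 0); [exact: smooth_cst|move=> x; exact: is_derive_cst].
- exists (fun z => cos (z - c)); first exact: smooth_cos.
  by move=> x; apply: is_derive_shift.
- exists (fun z => -1 * sin (z - c)); first by apply: smooth_mul; [exact: smooth_cst|exact: smooth_sin].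
  by move=> x; rewrite mulN1r; apply: is_derive_shift.
- exists (fun z => k * sin (z - c) * (bump k e (z - c) * (1 + -1 * bump k e (z - c)))).
    apply: smooth_mul; first by apply: smooth_mul; [exact: smooth_cst|exact: smooth_sin].
    apply: smooth_mul; first exact: smooth_bump.
    apply: smooth_add; first exact: smooth_cst.
    by apply: smooth_mul; [exact: smooth_cst|exact: smooth_bump].
  by move=> x; apply: is_derive_shift; rewrite mulN1r; exact: is_derive_bump.
- exists (fun z => df z + dh z); first exact: smooth_add.
  by move=> x; exact: is_derive_add.
- exists (fun z => df z * h1 z + f1 z * dh z); last by move=> x; exact: is_derive_mul.
  by apply: smooth_add; exact: smooth_mul.
Qed.

Lemma test_function_bump c k e : test_function (fun z => bump k e (z - c)).
Proof.
split=> [x|n]; first by rewrite /bump addrAC cosD2pi.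
have cn : smooth_class c k e (derive1n n (fun z => bump k e (z - c))).
  elim: n => [|n IH]; first exact: smooth_bump.
  have [df cdf hdf] := smooth_class_derive IH.
  rewrite derive1nS (_ : derive1 _ = df)//.
  by apply/funext => x; rewrite derive1E; have [_ ->] := hdf x.
by move=> x; have [df _ hdf] := smooth_class_derive cn; have [] := hdf x.
Qed.

End LogisticBump.

(** * Limits of the bumps and of their derivatives *)

Section BumpLimits.
Context {R : realType}.
Notation mu := (@lebesgue_measure R).
Notation I := (`[0%R, (pi *+ 2)%R : R]%classic).
Variable d : R.
Hypotheses (d0 : 0 < d) (dpi : d < pi).
Notation A := (`[(pi - d)%R, (pi + d)%R]%classic).

Lemma cvg_le_harmonic (u : nat -> R) (l K : R) :
  (forall n, `|u n - l| <= K / n.+1%:R) -> u n @[n --> \oo] --> l.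
Proof.
move=> h; apply/subr_cvg0/norm_cvg0P.
apply: (@squeeze_cvgr _ _ _ _ (fun _ => 0) (fun n => K * harmonic n)).
- by apply: nearW => n; rewrite normr_ge0; exact: h.
- exact: cvg_cst.
- by rewrite -(mulr0 K); apply: cvgM; [exact: cvg_cst|exact: cvg_harmonic].
Qed.

Lemma bump_pos_le eta n z : cos z + cos d >= eta -> bump n%:R (cos d) z <= expR (- (n%:R * eta)).
Proof.
move=> h; apply: (le_trans (bump_le_expR _ _ _)).
by rewrite ler_expR lerN2 ler_wpM2l.
Qed.

Lemma bump_neg_le eta n z : cos z + cos d <= - eta ->
  1 - bump n%:R (cos d) z <= expR (- (n%:R * eta)).
Proof.
move=> h; rewrite onem_bump; apply: (le_trans (bump_le_expR _ _ _)).
by rewrite ler_expR mulNr lerN2 -mulrN ler_wpM2l// lerNr.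
Qed.

Lemma cvg_bump z : (cos z + cos d < 0 -> bump n%:R (cos d) z @[n --> \oo] --> (1 : R)) /\
  (0 < cos z + cos d -> bump n%:R (cos d) z @[n --> \oo] --> (0 : R)).
Proof.
have le1 (n : nat) (a b : R) : 0 <= a -> n.+1%:R * a <= b -> a <= b.
  by move=> a0; apply: le_trans; rewrite ler_peMl// ler1n.
split=> h.
- have h' : 0 < - (cos z + cos d) by rewrite oppr_gt0.
  have [K K0 hK] := expR_decay h'.
  apply: (@cvg_le_harmonic _ _ K) => n; rewrite distrC ger0_norm ?subr_ge0 ?bump_le1//.
  apply: (le_trans (@bump_neg_le (- (cos z + cos d)) n z _)); first by rewrite opprK.
  by apply: (le1 n); [exact: expR_ge0|exact: hK].
- have [K K0 hK] := expR_decay h.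
  apply: (@cvg_le_harmonic _ _ K) => n; rewrite subr0 ger0_norm ?(ltW (bump_gt0 _ _ _))//.
  apply: (le_trans (@bump_pos_le (cos z + cos d) n z _)) => //.
  by apply: (le1 n); [exact: expR_ge0|exact: hK].
Qed.

(** As cos d = -cos(pi - d), the sign follows from the monotonicity of the cosine on [0, pi]; the
    second half of the period is reflected to the first by z -> 2 pi - z. *)
Lemma cos_add_sign z : I z -> z != pi - d -> z != pi + d ->
  if z \in A then cos z + cos d < 0 else 0 < cos z + cos d.
Proof.
rewrite /= in_itv/= => /andP[z0 z2] n1 n2; have e0 := d0; have epi := dpi.
have cd : cos d = - cos (pi - d) by rewrite (addrC pi) cosDpi cosN opprK.
have half w : 0 <= w <= pi -> ((cos w + cos d < 0) = (pi - d < w)) * ((0 < cos w + cos d) = (w < pi - d)).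
  move=> wpi; rewrite cd subr_lt0 subr_gt0.
  by rewrite !ltr_cos// in_itv/=; lra.
have [zpi|zpi] := leP z pi.
- have := half z; rewrite z0 zpi => /(_ isT)[-> ->].
  case: ifPn; rewrite ?notin_setE ?inE/= in_itv/=.
  + by move=> /andP[h _]; rewrite lt_neqAle eq_sym n1.
  + by move=> /negP; rewrite negb_and -!ltNge => /orP[//|h]; lra.
- have cz : cos z = cos (pi *+ 2 - z) by rewrite -cosN -(cosD2pi (- z)) addrC.
  have := half (pi *+ 2 - z); rewrite cz.
  have -> : 0 <= pi *+ 2 - z <= pi by rewrite mulr2n in z2 *; lra.
  move=> /(_ isT)[-> ->]; rewrite mulr2n.
  case: ifPn; rewrite ?notin_setE ?inE/= in_itv/=.
  + move=> /andP[_ h]; have : z < pi + d by rewrite lt_neqAle n2. 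
    lra.
  + by move=> /negP; rewrite negb_and -!ltNge => /orP[h|h]; lra.
Qed.

(** Dominated convergence with majorant |G|; the bumps converge to the indicator except at the two
    endpoints of the arc. *)
Lemma bump_integral_cvg (G : R -> R) : mu.-integrable I (EFin \o G) ->
  (\int[mu]_(z in I) (G z * bump n%:R (cos d) z)%:E @[n --> \oo] -->
   \int[mu]_(z in A) (G z)%:E)%E.
Proof.
move=> iG; have e0 := d0; have epi := dpi; have mI := measurable_itv `[0%R, (pi *+ 2)%R : R].
have mA : measurable (A : set R) by [].
have cb n : continuous (bump n%:R (cos d) : R -> R).
  by move=> z; exact: is_derive_continuous (is_derive_bump _ _ _).
have mG : measurable_fun I G by apply/measurable_EFinP; exact: (measurable_int mu iG).
pose f_ (n : nat) (z : R) := (G z * bump n%:R (cos d) z)%:E.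
pose f := ((EFin \o G) \_ A).
have AI : A `<=` I.
  by move=> z /=; rewrite !in_itv/= mulr2n; lra.
have [|||||_ _] := @dominated_convergence _ _ R mu I mI f_ f (fun z => `|(G z)%:E|%E).
- move=> n; apply/measurable_EFinP; apply: measurable_funM => //.
  by apply: measurable_funTS; exact: continuous_measurable_fun.
- apply/(measurable_restrict (EFin \o G) mA mI); rewrite setIidr//; apply/measurable_EFinP; exact: (measurable_funS mI AI).
- apply: (@ae_notin_seq _ [:: pi - d; pi + d]) => z Iz; rewrite !inE negb_or => /andP[n1 n2].
  have cG (l : R) : bump n%:R (cos d) z @[n --> \oo] --> l ->
      (f_ n z @[n --> \oo] --> (G z * l)%:E)%E.
    move=> hl; apply: cvg_EFin; first exact: nearW.
    by apply: (@cvgM R nat \oo); [exact: cvg_cst|exact: hl].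
  have := cos_add_sign Iz n1 n2; rewrite /f /patch; case: ifPn => _ h.
  + by have := cG _ ((cvg_bump z).1 h); rewrite mulr1.
  + by have := cG _ ((cvg_bump z).2 h); rewrite mulr0.
- exact: integrable_abse.
- apply: aeW => z n Iz; rewrite lee_fin normrM ler_piMr//.
  by rewrite ger0_norm ?bump_le1// ltW// bump_gt0.
rewrite /f -integral_mkcondr.
by rewrite setIidr.
Qed.

Notation e := (cos d).

Lemma dbump_le_away eta n z : eta <= `|cos z + e| ->
  `|dbump n%:R e z| <= n.+1%:R * expR (- (n%:R * eta)).
Proof.
move=> h; have b0 := ltW (bump_gt0 n%:R e z); have b1 := bump_le1 n%:R e z.
have c0 : 0 <= 1 - bump n%:R e z by rewrite subr_ge0.
have c1 : 1 - bump n%:R e z <= 1 by rewrite lerBlDr lerDl.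
have E : bump n%:R e z * (1 - bump n%:R e z) <= expR (- (n%:R * eta)).
  have [s0|s0] := leP 0 (cos z + e); [rewrite ger0_norm// in h|rewrite ltr0_norm// in h].
  - apply: (le_trans _ (bump_pos_le n h)); exact: ler_piMr.
  - apply: (le_trans _ (@bump_neg_le eta n z _)); last by rewrite lerNr.
    exact: ler_piMl.
rewrite /dbump normrM (ger0_norm (mulr_ge0 b0 c0)).
apply: ler_pM => //; first exact: mulr_ge0.
rewrite normrM normr_nat; apply: (@le_trans _ _ (n%:R * 1)); last by rewrite mulr1 ler_nat.
by rewrite ler_wpM2l// ler_norml sin_geN1 sin_le1.
Qed.

Lemma continuous_dbump n : continuous (dbump n%:R e : R -> R).
Proof.
have cb : continuous (bump n%:R e : R -> R).
  by move=> z; exact: is_derive_continuous (is_derive_bump _ _ _).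
move=> z; rewrite /dbump; apply: (@cvgM R R (nbhs z)).
  by apply: (@cvgM R R (nbhs z)); [exact: cvg_cst|exact: continuous_sin].
apply: (@cvgM R R (nbhs z)); first exact: cb.
by apply: (@cvgB R R R (nbhs z)); [exact: cvg_cst|exact: cb].
Qed.

(** On [a, b] the derivative of the bump is an approximate identity at x0: it has constant sign s,
    total mass tending to s, and is uniformly small where cos z + e stays away from 0. *)
Lemma dbump_concentrates (F : R -> R) (a b x0 s : R) : a < b -> continuous F ->
  (forall n z, a <= z <= b -> 0 <= s * dbump n%:R e z) -> `|s| = 1 ->
  (forall eps : R, 0 < eps -> exists2 eta : R, 0 < eta & forall z, a <= z <= b ->
     `|cos z + e| < eta -> `|F z - F x0| <= eps) ->
  (bump n%:R e b - bump n%:R e a) @[n --> \oo] --> s ->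
  (\int[mu]_(z in `[a, b]) (F z * dbump n%:R e z))%R @[n --> \oo] --> s * F x0.
Proof.
move=> ab cF sg s1 loc lim.
pose m n := bump n%:R e b - bump n%:R e a.
have mab := measurable_itv `[a, b].
have ci f : continuous f -> mu.-integrable `[a, b] (EFin \o f) by exact: continuous_integrable_itv.
have cd := continuous_dbump.
have cM (f h : R -> R) : continuous f -> continuous h -> continuous (fun z => f z * h z : R).
  by move=> cf ch z; apply: (@cvgM R R (nbhs z)); [exact: cf|exact: ch].
have cK (k : R) : continuous (fun _ : R => k) by move=> z; exact: cst_continuous.
have cB : continuous (fun z => F z - F x0).
  by move=> z; apply: (@cvgB R R R (nbhs z)); [exact: cF|exact: cvg_cst].
have mE n : (\int[mu]_(z in `[a, b]) dbump n%:R e z)%R = m n.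
  apply: EFin_inj; rewrite /Rintegral fineK; last exact: integrable_fin_num (ci _ (@cd n)).
  exact: (integral_derivative ab (is_derive_bump n%:R e) (@cd n)).
have -> : (fun n => (\int[mu]_(z in `[a, b]) (F z * dbump n%:R e z))%R) =
    fun n => (\int[mu]_(z in `[a, b]) ((F z - F x0) * dbump n%:R e z))%R + m n * F x0.
  apply/funext => n; rewrite -mE mulrC -RintegralZl//; last exact: ci.
  rewrite -RintegralD//; [|by apply/ci/cM|by apply/ci/cM].
  by apply: eq_Rintegral => z _; ring.
rewrite -[X in _ --> X]add0r; apply: cvgD; last by apply: cvgM => //; exact: cvg_cst.
have [|c cab hc] := @EVT_max R (fun x => `|F x - F x0|) a b (ltW ab).
  by apply: continuous_subspaceT => x; apply: cvg_norm; exact: cB.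
set M := `|F c - F x0| in hc.
apply/cvgrPdist_le => eps eps0.
have [eta eta0 heta] := loc _ (divr_gt0 eps0 (ltr0Sn R 1)).
have [K K0 hK] := expR_decay eta0.
have Q : (b - a) * (M * K) * harmonic n @[n --> \oo] --> (0 : R).
  by rewrite -(mulr0 ((b - a) * (M * K))); apply: cvgM; [exact: cvg_cst|exact: cvg_harmonic].
move/cvgrPdist_le: Q => /(_ _ (divr_gt0 eps0 (ltr0Sn R 1))) Q'.
near=> n.
rewrite sub0r normrN.
(* Near the zero of cos z + e the oscillation of F is at most eps/2; elsewhere the derivative of the
   bump is at most K / (n + 1). *)
have pt z : `[a, b]%classic z -> `|(F z - F x0) * dbump n%:R e z| <=
    eps / 2 * s * dbump n%:R e z + M * (K / n.+1%:R) * 1.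
  move=> zab; have zab' : a <= z <= b by move: zab; rewrite /= in_itv.
  rewrite normrM mulr1 -mulrA.
  have sd : s * dbump n%:R e z = `|dbump n%:R e z|.
    by rewrite -(ger0_norm (sg n z zab')) normrM s1 mul1r.
  have [h|h] := ltP `|cos z + e| eta.
  - rewrite sd; apply: (@le_trans _ _ (eps / 2 * `|dbump n%:R e z|)).
      by rewrite ler_wpM2r// heta.
    by rewrite lerDl mulr_ge0// ?normr_ge0// divr_ge0.
  - apply: (@le_trans _ _ (M * (K / n.+1%:R))).
      apply: ler_pM => //; first by apply: hc; rewrite in_itv.
      exact: le_trans (dbump_le_away n h) (hK n).
    by rewrite lerDr mulr_ge0 ?sg// divr_ge0// ltW.
apply: le_trans; first by apply: le_normr_Rintegral => //; exact/ci/cM.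
apply: (@le_trans _ _ (\int[mu]_(z in `[a, b])
    (eps / 2 * s * dbump n%:R e z + M * (K / n.+1%:R) * 1))).
apply: le_Rintegral => //.
- by apply: (@ci (fun z => `|(F z - F x0) * dbump n%:R e z|)) => z; apply: cvg_norm; exact: (cM _ _ cB (@cd n) z).
- exact/ci/continuous_lin.
rewrite RintegralD//; [|exact/ci/cM|exact/ci/cM].
rewrite !RintegralZl//; [|exact: ci|exact: ci]; rewrite mE Rintegral_cst// mul1r.
have -> : fine (mu `[a, b]) = b - a by rewrite lebesgue_measure_itv/= lte_fin ab.
have sm : s * m n <= 1.
  apply: (le_trans (ler_norm _)); rewrite normrM s1 mul1r ler_norml /m.
  have := bump_gt0 n%:R e a; have := bump_gt0 n%:R e b.
  have := bump_le1 n%:R e a; have := bump_le1 n%:R e b.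
  by move: (bump _ _ a) (bump _ _ b) => x y; lra.
have eps2 : 0 <= eps / 2 by rewrite divr_ge0// ltW.
have t1 : eps / 2 * s * m n <= eps / 2 by rewrite -mulrA ler_piMr.
have t2 : M * (K / n.+1%:R) * (b - a) <= eps / 2.
  rewrite (_ : _ * (b - a) = (b - a) * (M * K) * harmonic n); last by rewrite /=; ring.
  apply: (le_trans (ler_norm _)); rewrite -normrN -sub0r; near: n; exact: Q'.
by rewrite [leRHS](_ : eps = eps / 2 + eps / 2); [exact: lerD|field].
Unshelve. all: by end_near. Qed.

End BumpLimits.

(** * From the weak derivative to the fundamental theorem of calculus *)

Section WeakDerivative.
Context {R : realType}.
Notation mu := (@lebesgue_measure R).
Notation I := (`[0%R, (pi *+ 2)%R : R]%classic).

(** On [0, pi], F is a continuous function of cos z at z = pi - d, through the arccosine. *)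
Lemma continuous_cos_scale (F : R -> R) (d eps : R) : 0 < d -> d < pi -> continuous F ->
  0 < eps -> exists2 eta : R, 0 < eta & forall z, 0 <= z <= pi ->
  `|cos z + cos d| < eta -> `|F z - F (pi - d)| <= eps.
Proof.
move=> d0 dpi cF eps0.
have I0 (w : R) : 0 <= w <= pi -> w \in `[0, pi] by rewrite in_itv.
have cd : cos d = - cos (pi - d) by rewrite (addrC pi) cosDpi cosN opprK.
have lo : -1 < cos (pi - d).
  by rewrite -cospi ltr_cos ?I0//; have := @pi_gt0 R; lra.
have hi : cos (pi - d) < 1.
  by rewrite -cos0 ltr_cos ?I0//; have := @pi_gt0 R; lra.
have ca : {for cos (pi - d), continuous (F \o acos)}.
  apply: continuous_comp; last exact: cF.
  by apply: continuous_acos; rewrite lo.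
have Ka : acos (cos (pi - d)) = pi - d by apply: cosK; rewrite I0//; lra.
move/cvgrPdist_le: ca => /(_ _ eps0)/nbhs_ballP[eta /= eta0 h].
exists eta => // z zpi hz.
have := h (cos z); rewrite /= Ka cosK ?I0// distrC; apply.
by rewrite /ball/= distrC -[- cos (pi - d)]cd.
Qed.

(** The period is cut at pi. On the first half the bump increases from 0 to 1 in the limit, with the
    mass at pi - d; on the second half it decreases again, with the mass at pi + d. *)
Lemma dbump_integral_cvg (F : R -> R) (d : R) : 0 < d -> d < pi -> continuous F ->
  (\int[mu]_(z in I) (F z * dbump n%:R (cos d) z))%R @[n --> \oo] -->
  F (pi - d) - F (pi + d).
Proof.
move=> d0 dpi cF; have pi0 := @pi_gt0 R.
have cd n := @continuous_dbump R d n.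
have cM (n : nat) : continuous (fun z => F z * dbump n%:R (cos d) z : R).
  by move=> z; apply: (@cvgM R R (nbhs z)); [exact: cF|exact: cd].
have pi2 : pi < pi *+ 2 :> R by rewrite mulr2n ltrDl.
have split n : (\int[mu]_(z in I) (F z * dbump n%:R (cos d) z))%R =
    (\int[mu]_(z in `[0%R, pi]) (F z * dbump n%:R (cos d) z))%R +
    (\int[mu]_(z in `[pi, (pi *+ 2)%R]) (F z * dbump n%:R (cos d) z))%R.
  have iI := @continuous_integrable_itv R _ 0 (pi *+ 2) (cM n).
  have iP := @continuous_integrable_itv R _ pi (pi *+ 2) (cM n).
  rewrite -(@Rintegral_itv_obnd_cbnd R pi); last first.
    by apply: integrableS iP => //; apply: subset_itvr; rewrite bnd_simp.
  rewrite -(@Rintegral_itvB _ _ (BLeft 0) (BRight (pi *+ 2)) pi iI) ?bnd_simp ?(ltW pi0) ?(ltW pi2)//.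
  by rewrite addrC subrK.
under eq_cvg do rewrite split.
have bd n z : 0 <= bump n%:R (cos d) z * (1 - bump n%:R (cos d) z).
  by rewrite mulr_ge0 ?subr_ge0 ?bump_le1// ltW// bump_gt0.
have cl : cos d < 1 by rewrite -cos0 ltr_cos// in_itv/=; lra.
have cr : -1 < cos d by rewrite -cospi ltr_cos// in_itv/=; lra.
have b0 : bump n%:R (cos d) 0 @[n --> \oo] --> (0 : R).
  by apply: (cvg_bump d 0).2; rewrite cos0; lra.
have bpi : bump n%:R (cos d) pi @[n --> \oo] --> (1 : R).
  by apply: (cvg_bump d pi).1; rewrite cospi; lra.
have b2 : bump n%:R (cos d) (pi *+ 2) @[n --> \oo] --> (0 : R).
  by apply: (cvg_bump d _).2; rewrite cos2pi; lra.
apply: cvgD.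
- rewrite -[X in _ --> X]mul1r.
  apply: (@dbump_concentrates R d F 0 pi (pi - d) 1) => //; last 3 first.
  + by rewrite normr1.
  + by move=> eps; exact: continuous_cos_scale.
  + by rewrite -[X in _ --> X](subr0 1); apply: cvgB.
  + by move=> n z zpi; rewrite mul1r mulr_ge0// mulr_ge0// sin_ge0_pi.
- rewrite -[X in _ --> X]mulN1r.
  apply: (@dbump_concentrates R d F pi (pi *+ 2) (pi + d) (-1)) => //; last 3 first.
  + by rewrite normrN1.
  + move=> eps eps0.
    (* The reflection z -> 2 pi - z carries the second half of the period to the first. *)
    have cF' : continuous (fun z => F (pi *+ 2 - z)).
      move=> z; apply: (@continuous_comp _ _ _ (fun z => pi *+ 2 - z) F); last exact: cF.
      by apply: (@cvgB R R R (nbhs z)); [exact: cvg_cst|exact: cvg_id].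
    have [eta eta0 h] := continuous_cos_scale d0 dpi cF' eps0.
    exists eta => // z zpi hz.
    have := h (pi *+ 2 - z).
    have -> : pi *+ 2 - (pi *+ 2 - z) = z by rewrite opprB addrC subrK.
    have -> : pi *+ 2 - (pi - d) = pi + d by rewrite mulr2n; ring.
    apply; first by move: zpi; rewrite mulr2n; lra.
    by rewrite -[cos (_ - _)]cosN opprB cosB cos2pi sin2pi mulr1 mulr0 addr0.
  + by rewrite -[X in _ --> X](sub0r 1); apply: cvgB.
  + move=> n z zpi; rewrite mulN1r -mulNr mulr_ge0// -mulrN mulr_ge0//.
    have -> : - sin z = sin (z - pi) by rewrite -[in LHS](subrK pi z) sinDpi opprK.
    by apply: sin_ge0_pi; move: zpi; rewrite mulr2n; lra.
Qed.

Lemma integral_itv_shift (c a b : R) (f : R -> \bar R) : measurable_fun [set: R] f ->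
  (\int[mu]_(x in `[(a + c)%R, (b + c)%R]) f x = \int[mu]_(x in `[a, b]) f (x + c)%R)%E.
Proof.
move=> mf; rewrite integralE [RHS]integralE; congr (_ - _)%E.
- rewrite ge0_integral_itv_shift//; last exact: measurable_funepos.
  by apply: eq_integral => x _; rewrite !funeposE.
- rewrite ge0_integral_itv_shift//; last exact: measurable_funeneg.
  by apply: eq_integral => x _; rewrite !funenegE.
Qed.

(** The weak identity is tested with bumps approximating the indicator of [x, y]. One side tends to
    the integral of g over [x, y], and the derivative of the bump extracts f(y) - f(x) on the
    other. *)
Lemma weak_derivative_integral (f g : R -> R) : continuous f -> periodic f (pi *+ 2) ->
  measurable_fun [set: R] g -> periodic g (pi *+ 2) -> mu.-integrable I (EFin \o g) ->
  (forall phi, test_function phi -> \int[mu]_(x in I) (f x * derive1 phi x) =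
     - \int[mu]_(x in I) (g x * phi x)) ->
  forall x y, x < y -> y < x + pi *+ 2 ->
  (\int[mu]_(z in `[x, y]) (g z)%:E = (f y - f x)%:E)%E.
Proof.
move=> cf pf mg pg ig weak x y xy yx.
have pi0 : 0 < pi *+ 2 :> R by rewrite pmulrn_lgt0// pi_gt0.
have mI := measurable_itv `[0%R, (pi *+ 2)%R : R].
(* Translation by [c] puts the midpoint of [x, y] at pi, so the interval becomes the arc of
   half-length [d]; y < x + 2 pi gives d < pi. *)
pose c := (x + y) / 2 - pi; pose d := (y - x) / 2.
have d0 : 0 < d by rewrite divr_gt0// subr_gt0.
have dpi : d < pi by rewrite /d; rewrite mulr2n in yx; lra.
have xE : pi - d + c = x by rewrite /d /c; field.
have yE : pi + d + c = y by rewrite /d /c; field.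
have cF : continuous (fun z => f (z + c)).
  move=> z; apply: (@continuous_comp _ _ _ (fun z => z + c) f); last exact: cf.
  by apply: (@cvgD R R R (nbhs z)); [exact: cvg_id|exact: cvg_cst].
pose G z := g (z + c).
have mG : measurable_fun [set: R] G by apply: measurableT_comp => //; exact: measurable_funD.
have iG : mu.-integrable I (EFin \o G).
  apply/integrableP; split; first by apply: measurable_funTS; exact/measurable_EFinP.
  have /integrableP[_] := ig.
  rewrite -(@ge0_periodic_integral_shift R (pi *+ 2) c (fun z => `|(EFin \o g) z|%E))//.
  - by apply: measurableT_comp => //; exact/measurable_EFinP.
  - by move=> z /=; rewrite pg.
have mb n : measurable_fun [set: R] (bump n (cos d)).
  by apply: continuous_measurable_fun => z; exact: is_derive_continuous (is_derive_bump _ _ _).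
have pb n z : bump n (cos d) (z + pi *+ 2) = bump n (cos d) z by rewrite /bump cosD2pi.
have iGb (n : nat) : mu.-integrable I (fun z => (G z * bump n%:R (cos d) z)%:E).
  apply: (@le_integrable _ _ _ mu I mI _ (EFin \o G)) => //.
  - by apply: measurable_funTS; apply/measurable_EFinP; apply: measurable_funM => //; exact: mb.
  - move=> z _ /=; rewrite lee_fin normrM ler_piMr// ger0_norm ?bump_le1//.
    by rewrite ltW// bump_gt0.
pose u (n : nat) := (\int[mu]_(z in I) (f (z + c) * dbump n%:R (cos d) z))%R.
have uE n : (\int[mu]_(z in I) (G z * bump n%:R (cos d) z)%:E)%E = (- u n)%:E.
  have := weak _ (test_function_bump c n%:R (cos d)).
  have -> : (\int[mu]_(z in I) (f z * derive1 (fun z => bump n%:R (cos d) (z - c)) z))%R = u n.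
    rewrite /u /Rintegral; congr fine.
    pose k z := (f z * dbump n%:R (cos d) (z - c))%:E.
    transitivity (\int[mu]_(z in I) k z)%E.
      apply: eq_integral => z _; congr (_ * _)%:E; rewrite derive1E.
      by have [_ ->] := is_derive_shift (is_derive_bump n%:R (cos d) (z - c)).
    rewrite -(@periodic_integral_shift R (pi *+ 2) c k pi0).
    - by apply: eq_integral => z _; rewrite /k addrK.
    - apply/measurable_EFinP; apply: measurable_funM; first exact: continuous_measurable_fun.
      apply: measurableT_comp; last exact: measurable_funD.
      exact: (continuous_measurable_fun (@continuous_dbump R d n)).
    - by move=> z; rewrite /k pf addrAC /dbump pb sinD2pi.
  move=> ->; rewrite opprK /Rintegral.
  have <- : (\int[mu]_(z in I) (G z * bump n%:R (cos d) z)%:E =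
      \int[mu]_(z in I) (g z * bump n%:R (cos d) (z - c))%:E)%E.
    pose k z := (g z * bump n%:R (cos d) (z - c))%:E.
    rewrite -(@periodic_integral_shift R (pi *+ 2) c k pi0).
    - by apply: eq_integral => z _; rewrite /k addrK.
    - apply/measurable_EFinP; apply: measurable_funM => //.
      by apply: measurableT_comp; [exact: mb|exact: measurable_funD].
    - by move=> z; rewrite /k pg addrAC pb.
  by rewrite fineK// integrable_fin_num.
have lim1 := bump_integral_cvg d0 dpi iG.
have lim2 : ((- u n)%:E @[n --> \oo] --> (f y - f x)%:E)%E.
  rewrite -(opprB (f x)); apply: cvg_EFin; first exact: nearW.
  by apply: cvgN; rewrite -{1}xE -{1}yE; exact: dbump_integral_cvg.
have := integral_itv_shift c (pi - d) (pi + d) (iffRL (measurable_EFinP _ _) mg).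
rewrite xE yE => ->.
have uu : (fun n : nat => \int[mu]_(z in I) (G z * bump n%:R (cos d) z)%:E)%E =
  (fun n => (- u n)%:E) by apply/funext.
rewrite uu in lim1.
exact: (cvg_unique _ lim1 lim2).
Qed.

End WeakDerivative.

(** * A Campanato criterion for continuous differentiability *)

Section Campanato.
Context {R : realType}.

(** Writing the same increment of f from x and from y shows that g(x) and g(y) are close, so uniform
    differentiability forces a continuous derivative. *)
Lemma is_derive_uniform (f g : R -> R) :
  (forall e : R, 0 < e -> exists2 d : R, 0 < d & forall x h, `|h| < d ->
    `|f (x + h) - f x - h * g x| <= e * `|h|) ->
  (forall x : R, is_derive x 1 f (g x)) /\ continuous g.
Proof.
move=> hf; split=> x.
  by apply: is_derive_eps => e e0; have [d d0 hd] := hf e e0; exists d => // h; exact: hd.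
apply/cvgrPdist_le => e e0.
have [d d0 hd] := hf _ (divr_gt0 e0 (ltr0Sn R 1)).
near=> y; have [->|yx] := eqVneq y x; first by rewrite subrr normr0 ltW.
have h : `|y - x| < d.
  by rewrite distrC; near: y; apply: cvgr_dist_lt; [exact: cvg_id|].
have h0 : 0 < `|y - x| by rewrite normr_gt0 subr_eq0.
have h1 := hd x (y - x) h; have h2 := hd y (x - y); rewrite distrC in h2.
have {}h2 := h2 h.
rewrite -(ler_pM2r h0) -normrM.
have -> : (g x - g y) * (y - x) = - ((f (x + (y - x)) - f x - (y - x) * g x) +
    (f (y + (x - y)) - f y - (x - y) * g y)).
  have -> : x + (y - x) = y by rewrite addrC subrK.
  by have -> : y + (x - y) = x; [rewrite addrC subrK|ring].
rewrite normrN; apply: (le_trans (ler_normD _ _)).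
have -> : e * `|y - x| = e / 2 * `|y - x| + e / 2 * `|y - x| by field.
by apply: lerD => //; rewrite [X in _ <= _ * X]distrC.
Unshelve. all: by end_near. Qed.

Lemma geometric_small (z e : R) : 0 < z -> z < 1 -> 0 < e -> exists n, z ^+ n <= e.
Proof.
move=> z0 z1 e0; have : `|z| < 1 by rewrite gtr0_norm.
move=> /cvg_expr/cvgrPdist_le/(_ _ e0)[n _ /(_ n (leqnn n))].
by rewrite sub0r normrN ger0_norm ?exprn_ge0 ?(ltW z0)// => h; exists n.
Qed.

Variables (f : R -> R) (C b : R).
Hypotheses (C0 : 0 <= C) (b0 : 0 < b).
Hypothesis affine : forall a l : R, 0 < l <= 1 -> exists c, forall x y,
  a <= x <= a + l -> a <= y <= a + l -> `|f y - f x - (y - x) * c| <= C * l `^ (1 + b).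

Let t n : R := 2^-1 ^+ n.
Let th : R := 2^-1 `^ b.
Let t_gt0 n : 0 < t n. Proof. by rewrite exprn_gt0. Qed.
Let t_le1 n : t n <= 1. Proof. by rewrite exprn_ile1// invf_le1// ler1n. Qed.
Let tS n : t n.+1 = t n / 2. Proof. by rewrite /t exprS mulrC. Qed.
Let t_powR n : t n `^ b = th ^+ n.
Proof. by rewrite /t /th -powR_mulrn ?invr_ge0// -powRrM mulrC powRrM powR_mulrn ?powR_ge0. Qed.
Let th_gt0 : 0 < th. Proof. by rewrite powR_gt0// invr_gt0. Qed.
Let th_lt1 : th < 1.
Proof.
have -> : 1 = 1 `^ b by rewrite powR1.
by apply: gt0_ltr_powR; rewrite ?nnegrE ?invr_ge0// invf_lt1 ?ltr1n.
Qed.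

(** The slope of an affine approximation on the interval of length 2^(-n) centred at x. *)
Let slope x n : {c | forall y, `|y - x| <= t n / 2 ->
  `|f y - f x - (y - x) * c| <= C * t n * th ^+ n}.
Proof.
apply: cid; have tn := t_gt0 n; have [|c hc] := affine (x - t n / 2) (l := t n).
  by rewrite tn t_le1.
exists c => y; rewrite ler_norml => /andP[h1 h2].
have := hc x y; rewrite powRD; last by rewrite (gt_eqF tn) implybT.
rewrite powRr1 ?(ltW tn)// t_powR mulrA; apply; clear hc; lra.
Qed.

Let c x n := sval (slope x n).
(** Chosen so that K th^n - K th^(n+1) = 8 C th^n, the bound on the change of slope from one dyadic
    scale to the next; these bounds then telescope. *)
Let K := 8 * C / (1 - th).

Let K_ge0 : 0 <= K.
Proof. by rewrite divr_ge0 ?mulr_ge0// subr_ge0 ltW. Qed.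

Let slope_step x n : `|c x n - c x n.+1| <= K * th ^+ n - K * th ^+ n.+1.
Proof.
have tn := t_gt0 n.
have h1 := svalP (slope x n) (x + t n / 4); have h2 := svalP (slope x n.+1) (x + t n / 4).
rewrite -/(c x n) in h1; rewrite -/(c x n.+1) in h2.
rewrite addrAC subrr add0r ger0_norm ?divr_ge0 ?(ltW tn)// in h1 h2.
have {}h1 : `|f (x + t n / 4) - f x - t n / 4 * c x n| <= C * t n * th ^+ n by apply: h1; lra.
have {}h2 : `|f (x + t n / 4) - f x - t n / 4 * c x n.+1| <= C * t n * th ^+ n.
  apply: (le_trans (h2 _)); first by rewrite tS; lra.
  apply: ler_pM; rewrite ?mulr_ge0 ?exprn_ge0 ?(ltW (t_gt0 _)) ?(ltW th_gt0)//.
    by rewrite ler_wpM2l// tS; lra.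
  by rewrite exprS ler_piMl ?exprn_ge0 ?(ltW th_gt0) ?(ltW th_lt1).
have -> : K * th ^+ n - K * th ^+ n.+1 = 8 * C * th ^+ n.
  by rewrite /K exprS; field; rewrite subr_eq0 gt_eqF.
have tn4 : 0 < t n / 4 by rewrite divr_gt0.
rewrite -(ler_pM2l tn4) -[X in X * `|_|]gtr0_norm// -normrM.
have -> : t n / 4 * (c x n - c x n.+1) = (f (x + t n / 4) - f x - t n / 4 * c x n.+1) -
  (f (x + t n / 4) - f x - t n / 4 * c x n) by ring.
apply: (le_trans (ler_normB _ _)).
have -> : t n / 4 * (8 * C * th ^+ n) = C * t n * th ^+ n + C * t n * th ^+ n by field.
exact: lerD.
Qed.

Let slope_le x n m : (n <= m)%N -> `|c x n - c x m| <= K * th ^+ n - K * th ^+ m.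
Proof.
elim: m => [|m IH]; first by rewrite leqn0 => /eqP ->; rewrite !subrr normr0.
rewrite leq_eqVlt => /predU1P[->|]; first by rewrite !subrr normr0.
rewrite ltnS => /IH {}IH.
have -> : c x n - c x m.+1 = (c x n - c x m) + (c x m - c x m.+1) by ring.
apply: (le_trans (ler_normD _ _)); apply: (le_trans (lerD IH (slope_step x m))).
by rewrite addrA subrK.
Qed.

(** The limit of the slopes. Every lower bound c_k - K th^k is at most every upper bound c_m + K
    th^m, so the supremum lies within K th^n of each slope. *)
Let g x := sup (range (fun n => c x n - K * th ^+ n)).

Let g_slope x n : `|g x - c x n| <= K * th ^+ n.
Proof.
have pw k : 0 <= K * th ^+ k by rewrite mulr_ge0// exprn_ge0// ltW.
have cross k m : c x k - K * th ^+ k <= c x m + K * th ^+ m.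
  have [km|mk] := leqP k m.
  - have := slope_le x km; rewrite ler_norml => /andP[_ h]; have := pw m; lra.
  - have := slope_le x (ltnW mk); rewrite ler_norml => /andP[h _]; have := pw k; lra.
have ub : has_sup (range (fun n => c x n - K * th ^+ n)).
  split; first by exists (c x 0%N - K * th ^+ 0), 0%N.
  by exists (c x 0%N + K * th ^+ 0) => _ [k _ <-]; exact: cross.
have h1 : c x n - K * th ^+ n <= g x by apply: ub_le_sup; [exact: ub.2|exists n].
have h2 : g x <= c x n + K * th ^+ n.
  by apply: ge_sup; [exact: ub.1|move=> _ [k _ <-]; exact: cross].
by rewrite ler_norml; apply/andP; split; lra.
Qed.

(** The scale adapted to h is the first n with t_(n+1)/2 <= |h|; minimality gives the matching upper
    bound. *)
Let dyadic_scale (h : R) (N : nat) : h != 0 -> `|h| < t N / 2 ->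
  exists n, [/\ (N <= n)%N, t n.+1 / 2 <= `|h| & `|h| <= t n / 2].
Proof.
move=> h0 hN; have nh : 0 < `|h| by rewrite normr_gt0.
have half_gt0 : 0 < 2^-1 :> R by rewrite invr_gt0.
have half_lt1 : 2^-1 < 1 :> R by rewrite invf_lt1// ltr1n.
have ex : exists n, t n.+1 / 2 <= `|h|.
  have [n hn] := geometric_small half_gt0 half_lt1 nh; exists n; apply: (le_trans _ hn).
  by rewrite -/(t n) tS; have := t_gt0 n; lra.
have [n hn min] := ex_minnP ex; exists n; split=> //.
- rewrite leqNgt; apply/negP => nN; move: hN; apply/negP; rewrite -leNgt.
  apply: (le_trans _ hn); rewrite ler_wpM2r ?invr_ge0//.
  by rewrite /t ler_wiXn2l ?invr_ge0// invf_le1// ler1n.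
- case: n hn min => [_ _|n _ min].
    by apply: (le_trans (ltW hN)); rewrite ler_wpM2r ?invr_ge0// [t 0]expr0 t_le1.
  by rewrite leNgt; apply/negP => /ltW /min; rewrite ltnn.
Qed.

(** At the dyadic scale of h both the affine error and the distance of the slope from its limit are
    at most a multiple of th^n |h|, uniformly in x, so [is_derive_uniform] applies. *)
Lemma affine_approx_C1 : exists2 g : R -> R, forall x : R, is_derive x 1 f (g x) & continuous g.
Proof.
suff [h1 h2] : (forall x : R, is_derive x 1 f (g x)) /\ continuous g by exists g.
apply: is_derive_uniform => e e0.
have [N hN] : exists N, (4 * C + K) * th ^+ N <= e.
  have A1 : 0 < 4 * C + K + 1 by rewrite ltr_wpDl// addr_ge0// mulr_ge0.
  have eA : 0 < e / (4 * C + K + 1) by rewrite divr_gt0.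
  have [N hN] := geometric_small th_gt0 th_lt1 eA; exists N.
  rewrite ler_pdivlMr// in hN; apply: (le_trans _ hN).
  by rewrite mulrC ler_wpM2l ?exprn_ge0 ?(ltW th_gt0)// lerDl.
exists (t N / 2); first by rewrite divr_gt0.
move=> x h hh; have [->|h0] := eqVneq h 0; first by rewrite addr0 subrr mul0r subrr normr0 mulr0.
have [n [Nn lo hi]] := dyadic_scale h0 hh.
have := svalP (slope x n) (x + h); rewrite -/(c x n) addrAC subrr add0r => /(_ hi) k1.
have -> : f (x + h) - f x - h * g x = (f (x + h) - f x - h * c x n) - h * (g x - c x n) by ring.
apply: (le_trans (ler_normB _ _)); rewrite normrM.
have p0 k : 0 <= th ^+ k by rewrite exprn_ge0// ltW.
apply: (@le_trans _ _ ((4 * C + K) * th ^+ n * `|h|)); last first.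
  rewrite ler_wpM2r//; apply: (le_trans _ hN); apply: ler_wpM2l.
    by apply: addr_ge0 => //; exact: mulr_ge0.
  by rewrite ler_wiXn2l ?(ltW th_gt0) ?(ltW th_lt1).
have k2 : `|h| * `|g x - c x n| <= K * th ^+ n * `|h| by rewrite mulrC ler_wpM2r.
have k3 : C * t n * th ^+ n <= 4 * C * th ^+ n * `|h|.
  rewrite (_ : 4 * C * th ^+ n * `|h| = C * (4 * `|h|) * th ^+ n); last by ring.
  by rewrite ler_wpM2r// ler_wpM2l//; rewrite tS in lo; lra.
rewrite [leRHS](_ : _ = 4 * C * th ^+ n * `|h| + K * th ^+ n * `|h|); last by ring.
exact: lerD (le_trans k1 k3) k2.
Qed.

End Campanato.

(** * Affine approximation from the Slobodeckii seminorm *)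

Section SlobodeckiiAffine.
Context {R : realType}.
Notation mu := (@lebesgue_measure R).
Notation I := (`[0%R, (pi *+ 2)%R : R]%classic).
Notation J := (`[(- pi)%R, pi%R : R]%classic).

Lemma pi_ge1 : 1 <= pi :> R.
Proof. by have := @pi_ge2 R; apply: le_trans; rewrite ler1n. Qed.

(** Otherwise the integral would be at least S + 1. Adding 1 to S supplies the strict inequality. *)
Lemma exists_le_average (s : R -> \bar R) (a l S : R) : 0 < l ->
  measurable_fun [set: R] s -> (forall y, 0 <= s y)%E ->
  (\int[mu]_(y in `[a, (a + l)%R]) s y <= S%:E)%E ->
  exists2 y, a <= y <= a + l & (s y <= ((S + 1) / l)%:E)%E.
Proof.
move=> l0 ms s0 hS; apply: contrapT => h.
have al : a <= a + l by rewrite lerDl ltW.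
have big y : `[a, (a + l)%R]%classic y -> (((S + 1) / l)%:E <= s y)%E.
  move=> yal; rewrite leNgt; apply/negP => /ltW sy; apply: h; exists y => //.
have S0 : 0 <= S by rewrite -lee_fin; apply: le_trans hS; exact: integral_ge0.
have : (\int[mu]_(y in `[a, (a + l)%R]) ((S + 1) / l)%:E <= \int[mu]_(y in `[a, (a + l)%R]) s y)%E.
  apply: ge0_le_integral => //; last exact: measurable_funTS.
  by move=> y _; rewrite lee_fin divr_ge0 ?addr_ge0// ltW.
rewrite (integral_itv_cst _ al) addrAC subrr add0r divfK ?gt_eqF// => /le_trans/(_ hS).
by rewrite lee_fin -subr_ge0 opprD addrA subrr sub0r oppr_ge0 ler10.
Qed.

(** Some y in [a, a + l] has a Slobodeckii slice of size at most (S + 1)/l, and g(y) serves as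
    slope. The error is an integral of |g(z) - g(y)|, bounded by Young's inequality and the weight
    |z - y|^(p - 1) <= l^(p - 1). The exponent gained is (p - 3)/p, positive since p > 3. *)
Lemma slobodeckii_affine (g : R -> 'rV[R]_3) (p : R) (i : 'I_3) (f : R -> R) : 3 < p ->
  (forall j, measurable_fun [set: R] (fun x => g x 0 j)) -> periodic g (pi *+ 2) ->
  (slobodeckii p g < +oo)%E ->
  (forall x y, x < y -> y < x + pi *+ 2 ->
    mu.-integrable `[x, y] (fun z => (g z 0 i)%:E) /\
    (\int[mu]_(z in `[x, y]) (g z 0 i)%:E = (f y - f x)%:E)%E) ->
  exists2 C, 0 <= C & forall a l : R, 0 < l <= 1 -> exists c, forall x y,
    a <= x <= a + l -> a <= y <= a + l ->
    `|f y - f x - (y - x) * c| <= C * l `^ (1 + (p - 3) / p).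
Proof.
move=> p3 mg pg slob hf.
have p0 : 0 < p by exact: lt_trans p3.
have p1 : 1 <= p by rewrite (le_trans _ (ltW p3))// ler1n.
have pi2 : 0 < pi *+ 2 :> R by rewrite pmulrn_lgt0// pi_gt0.
have mI := measurable_itv `[0%R, (pi *+ 2)%R : R].
have mJ := measurable_itv `[(- pi)%R, pi%R : R].
have ms := measurable_slobodeckii p mg.
pose k y w := (enorm (g (y + w) - g y) `^ p / `|w| `^ (p - 1))%:E.
have k0 y w : (0 <= k y w)%E by rewrite lee_fin divr_ge0 ?powR_ge0.
have mk y : measurable_fun [set: R] (k y).
  exact: (measurableT_comp ms (measurable_fun_pair (measurable_cst y) (@measurable_id _ _ _))).
pose s y := (\int[mu]_(w in J) k y w)%E.
have s0 y : (0 <= s y)%E by apply: integral_ge0.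
have msi : measurable_fun [set: R] s.
  exact: (measurable_integral_ge0 mJ ms (fun z => k0 z.1 z.2)).
have ps y : s (y + pi *+ 2) = s y.
  by apply: eq_integral => w _; rewrite /k addrAC !pg.
pose S := fine (slobodeckii p g).
have slob0 : (0 <= slobodeckii p g)%E by apply: integral_ge0 => y _; exact: s0.
have SE : slobodeckii p g = S%:E by rewrite fineK// ge0_fin_numE.
have S0 : 0 <= S by rewrite fine_ge0.
exists (S + 2); first by rewrite addr_ge0.
move=> a l /andP[l0 l1].
have lpi : l <= pi by apply: (le_trans l1); exact: pi_ge1.
have hS : (\int[mu]_(y in `[a, (a + l)%R]) s y <= S%:E)%E.
  (* By periodicity the seminorm may be computed over the period starting at a, which contains
     [a, a + l]. *)
  have -> : S%:E = (\int[mu]_(y in `[a, (pi *+ 2 + a)%R]) s y)%E.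
    rewrite -SE; apply: (eq_trans (esym (@ge0_periodic_integral_shift R (pi *+ 2) a s pi2 msi s0 ps))).
    by rewrite -(ge0_integral_itv_shift _ _ _ msi s0) add0r.
  apply: ge0_subset_integral; [by []|by []|exact: measurable_funTS|by []|].
  by apply: subset_itvl; rewrite bnd_simp addrC lerD2r mulr2n; have := @pi_ge0 R; lra.
have [y /andP[ya yl] sy] := exists_le_average l0 msi s0 hS.
exists (g y 0 i).
(* This lambda balances the two terms of Young's inequality: both lam l and lam^(1 - p) l^(p - 2)
   equal l^(1 + b). *)
pose b := (p - 3) / p; pose lam := l `^ b.
have lam0 : 0 < lam by exact: powR_gt0.
pose B z := (lam%:E + (lam `^ (1 - p) * l `^ (p - 1))%:E * k y (z - y)%R)%E.
have mk' : measurable_fun [set: R] (fun z => k y (z - y)).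
  by apply: measurableT_comp => //; exact: measurable_funB.
have c0 : (0 <= (lam `^ (1 - p) * l `^ (p - 1))%:E :> \bar R)%E by rewrite lee_fin mulr_ge0 ?powR_ge0.
have B0 z : (0 <= B z)%E by apply: adde_ge0; [rewrite lee_fin ltW|exact: mule_ge0].
have mB : measurable_fun [set: R] B.
  by apply: emeasurable_funD => //; exact: measurable_funeM.
have pt z : a <= z <= a + l -> (`|g z 0 i - g y 0 i|%:E <= B z)%E.
  move=> zal; pose E := enorm (g z - g y).
  have E0 : 0 <= E by exact: enorm_ge0.
  have h1 : `|g z 0 i - g y 0 i| <= E.
    by have := coord_le_enorm (g z - g y) i; rewrite !mxE.
  rewrite /B /k (addrC y) subrK -/E -EFinM -EFinD lee_fin.
  apply: (le_trans h1); apply: (le_trans (le_young p1 E0 lam0)).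
  rewrite lerD2l -mulrA [leLHS]mulrC ler_wpM2l ?powR_ge0//.
  have [zy|zy] := eqVneq z y.
    by rewrite /E zy !subrr enorm0 powR0 ?gt_eqF// mul0r mulr0.
  have w0 : 0 < `|z - y| by rewrite normr_gt0 subr_eq0.
  rewrite mulrCA ler_peMr ?powR_ge0// ler_pdivlMr ?powR_gt0// mul1r.
  apply: ge0_ler_powR; rewrite ?nnegrE ?subr_ge0 ?(ltW l0)//.
  by rewrite ler_norml; move: zal; lra.
have IB : (\int[mu]_(z in `[a, (a + l)%R]) B z <= ((S + 2) * l `^ (1 + b))%:E)%E.
  have al : a <= a + l by rewrite lerDl ltW.
  have kle : (\int[mu]_(z in `[a, (a + l)%R]) k y (z - y)%R <= ((S + 1) / l)%:E)%E.
    apply: (le_trans _ sy).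
    have := @ge0_integral_itv_shift R y (a - y) (a + l - y) (fun z => k y (z - y)%R) mk' (fun z => k0 y _).
    rewrite !subrK => ->.
    have -> : (fun x => k y (x + y - y)%R) = k y by apply/funext => x; rewrite addrK.
    apply: ge0_subset_integral; [by []|exact: mJ|by apply: measurable_funTS; exact: mk|by move=> w _; exact: k0|].
    by move=> w /=; rewrite !in_itv/=; lra.
  have kz0 z : `[a, (a + l)%R]%classic z -> (0 <= k y (z - y)%R)%E by [].
  rewrite /B ge0_integralD//; last 3 first.
  - by move=> z _; rewrite lee_fin ltW.
  - by move=> z _; exact: mule_ge0.
  - by apply: measurable_funTS; exact: measurable_funeM.
  rewrite (integral_itv_cst _ al) ge0_integralZl//; last exact: measurable_funTS.
  apply: (le_trans (leeD (lexx _) (lee_wpmul2l c0 kle))).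
  rewrite -EFinM -EFinD lee_fin addrAC subrr add0r.
  have e1 : lam * l = l `^ (1 + b).
    by rewrite /lam -[X in _ * X](powRr1 (ltW l0)) -powRD ?(gt_eqF l0) ?implybT// addrC.
  have e2 : lam `^ (1 - p) * l `^ (p - 1) / l = l `^ (1 + b).
    rewrite /lam -powRrM -(powR_inv1 (ltW l0)) -!powRD ?(gt_eqF l0) ?implybT//.
    by congr (_ `^ _); rewrite /b; field; rewrite gt_eqF.
  have -> : lam `^ (1 - p) * l `^ (p - 1) * ((S + 1) / l) =
      (S + 1) * (lam `^ (1 - p) * l `^ (p - 1) / l) by ring.
  rewrite e2 e1; have -> : (S + 2) * l `^ (1 + b) = l `^ (1 + b) + (S + 1) * l `^ (1 + b) by ring.
  exact: lexx.
have main x x' : a <= x <= a + l -> a <= x' <= a + l -> x < x' ->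
    `|f x' - f x - (x' - x) * g y 0 i| <= (S + 2) * l `^ (1 + b).
  move=> hx hx' xx.
  have x2 : x' < x + pi *+ 2.
    by rewrite mulr2n; have := @pi_gt0 R; lra.
  have [ig fE] := hf x x' xx x2.
  have ic : mu.-integrable `[x, x'] (fun z : R => (g y 0 i)%:E).
    by apply: continuous_integrable_itv => z; exact: cst_continuous.
  rewrite -lee_fin.
  have -> : `|f x' - f x - (x' - x) * g y 0 i|%:E =
      (`|\int[mu]_(z in `[x, x']) (g z 0 i - g y 0 i)%:E|)%E.
    rewrite integralB_EFin// fE (integral_itv_cst _ (ltW xx)).
    by rewrite -EFinB /= [g y 0 i * _]mulrC.
  have md : measurable_fun [set: R] (fun z => (g z 0 i - g y 0 i)%:E).
    by apply/measurable_EFinP; exact: measurable_funB.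
  apply: (le_trans _ IB).
  apply: (@le_trans _ _ (\int[mu]_(z in `[x, x']) B z)%E); last first.
    apply: ge0_subset_integral; [by []|by []|exact: measurable_funTS|by []|].
    by move=> z /=; rewrite !in_itv/=; lra.
  apply: le_trans; first by apply: le_abse_integral => //; exact: measurable_funTS.
  apply: ge0_le_integral => //.
  - by apply: measurable_funTS; exact: measurableT_comp.
  - exact: measurable_funTS.
  - by move=> z; rewrite /= in_itv/= => hz; apply: pt; lra.
move=> x x' hx hx'; have [xx|xx|->] := ltgtP x x'; first exact: main.
- rewrite (_ : _ - _ = - (f x - f x' - (x - x') * g y 0 i)); last by ring.
  by rewrite normrN; exact: main.
- by rewrite !subrr mul0r subrr normr0 mulr_ge0 ?powR_ge0// addr_ge0.
Qed.

End SlobodeckiiAffine.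

(** * From one period to the line; almost everywhere derivatives *)

Section LocalIntegrability.
Context {R : realType}.
Notation mu := (@lebesgue_measure R).
Notation I := (`[0%R, (pi *+ 2)%R : R]%classic).

Lemma archimedean_step (T a b : R) : 0 < T -> exists n, b < a + T *+ n.
Proof.
move=> T0; exists (Num.Def.archi_bound (`|b - a| / T)).
have := archi_boundP (divr_ge0 (normr_ge0 (b - a)) (ltW T0)).
by rewrite ltr_pdivrMr// mulr_natl -ltrBlDl; apply: le_lt_trans; exact: ler_norm.
Qed.

Lemma periodic_integrable (T : R) (g : R -> R) (a b : R) : 0 < T ->
  measurable_fun [set: R] g -> periodic g T -> mu.-integrable `[0, T] (EFin \o g) ->
  mu.-integrable `[a, b] (EFin \o g).
Proof.
move=> T0 mg pg /integrableP[_ ig].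
have mf : measurable_fun [set: R] (fun z => `|(g z)%:E|%E).
  by apply: measurableT_comp => //; exact/measurable_EFinP.
have fN n : (\int[mu]_(z in `[a, (a + T *+ n)%R]) `|(g z)%:E| < +oo)%E.
  elim: n => [|n IH]; first by rewrite mulr0n addr0 set_itv1 integral_set1.
  rewrite (@ge0_integral_itv_split R a (a + T *+ n))//; last 2 first.
  - by rewrite lerDl mulrn_wge0// ltW.
  - by rewrite lerD2l mulrSr lerDl ltW.
  rewrite lte_add_pinfty//.
  have -> : a + T *+ n.+1 = T + (a + T *+ n) by rewrite mulrS addrCA.
  have := @ge0_integral_itv_shift R (a + T *+ n) 0 T _ mf (fun z => abse_ge0 _).
  rewrite add0r => ->.
  by rewrite (@ge0_periodic_integral_shift R T (a + T *+ n) _ T0 mf (fun z => abse_ge0 _))// => z; rewrite pg.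
apply/integrableP; split; first by apply: measurable_funTS; exact/measurable_EFinP.
have [n bn] : exists n, b < a + T *+ n by exact: archimedean_step.
apply: le_lt_trans (fN n).
apply: ge0_subset_integral; [by []|by []|exact: measurable_funTS|by []|].
by apply: subset_itvl; rewrite bnd_simp ltW.
Qed.

(** Induction on the number of steps of length e/2: the last such piece is short enough for the
    hypothesis, and the rest is covered by the induction. *)
Lemma integral_additive_extend (g f : R -> R) (e : R) : 0 < e ->
  (forall a b, mu.-integrable `[a, b] (EFin \o g)) ->
  (forall x y, x < y -> y < x + e -> (\int[mu]_(z in `[x, y]) (g z)%:E = (f y - f x)%:E)%E) ->
  forall x y, x < y -> (\int[mu]_(z in `[x, y]) g z)%R = f y - f x.
Proof.
move=> e0 ig h x y xy.
have [n yn] : exists n : nat, y < x + e / 2 *+ n by apply: archimedean_step; rewrite divr_gt0.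
elim: n y xy yn => [|n IH] y xy; first by rewrite mulr0n addr0 => /(lt_trans xy); rewrite ltxx.
move=> yn; have [ye|ye] := ltP y (x + e).
  by rewrite /Rintegral h.
have z1 : x < y - e / 2 by lra.
have z2 : y - e / 2 < x + e / 2 *+ n by move: yn; rewrite mulrSr; lra.
have zy : y - e / 2 < y by lra.
have := @Rintegral_itvB R _ (BLeft x) (BRight y) (y - e / 2) (ig x y).
rewrite !bnd_simp (ltW z1) (ltW zy) => /(_ isT isT)/eqP; rewrite subr_eq => /eqP ->.
rewrite IH//.
rewrite Rintegral_itv_obnd_cbnd; last first.
  by apply: integrableS (ig (y - e / 2) y) => //; apply: subset_itvr; rewrite bnd_simp.
by rewrite /Rintegral h//; [rewrite /= addrA subrK|lra].
Qed.

(** By Lebesgue's differentiation theorem the integral of g from a has derivative g at almost every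
    point beyond a, and this integral is f - f(a). *)
Lemma ae_eq_derivative (g f df : R -> R) (a : R) : measurable_fun [set: R] g ->
  (forall x y, mu.-integrable `[x, y] (EFin \o g)) ->
  (forall x y, x < y -> (\int[mu]_(z in `[x, y]) g z)%R = f y - f x) ->
  (forall x : R, is_derive x 1 f (df x)) ->
  {ae mu, forall x, a < x -> g x = df x}.
Proof.
move=> mg ig fg dfE.
have lg : locally_integrable [set: R] g.
  split=> //; first exact: openT.
  move=> K _ cK; have [M [_ /(_ (M + 1))]] := compact_bounded cK.
  rewrite ltrDl => /(_ ltr01) KM.
  have /integrableP[_] := ig (- (M + 1)) (M + 1); apply: le_lt_trans.
  apply: ge0_subset_integral => //.
  - exact: compact_measurable.
  - by apply: measurable_funTS; apply/measurable_EFinP; exact: measurableT_comp.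
  - by move=> x /KM /=; rewrite in_itv/= -ler_norml.
have := @FTC1 R g (BLeft a) (ig a) lg.
apply: filterS; first exact: (ae_filter_ringOfSetsType mu).
move=> x /= h ax.
have [] := h; first by rewrite lte_fin.
move=> dF FE.
have eqF : \forall y \near x, f y - f a = (\int[mu]_(z in `[a, y]) g z)%R.
  by near=> y; rewrite fg//; near: y; exact: lt_nbhsr.
have d1 : is_derive x 1 (fun y => f y - f a) (df x).
  rewrite -[df x]subr0; apply: is_derive_sub.
have := near_eq_is_derive eqF d1 => -[_ <-].
by rewrite -FE derive1E.
Unshelve. all: by end_near. Qed.

End LocalIntegrability.

(** * Sobolev-Slobodeckii directions are continuously differentiable *)

Section SobolevDirections.
Context {R : realType}.
Notation mu := (@lebesgue_measure R).
Notation I := (`[0%R, (pi *+ 2)%R : R]%classic).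
Notation J := (`[(- pi)%R, pi%R : R]%classic).

(** With z = x + w in the inner integral, the exceptional set no longer moves with x. The points z
    that occur are at least -pi, hence beyond a. *)
Lemma slobodeckii_ae (p a : R) (g h : R -> 'rV[R]_3) : a < - pi ->
  (forall i, measurable_fun [set: R] (fun x => g x 0 i)) ->
  (forall i, measurable_fun [set: R] (fun x => h x 0 i)) ->
  {ae mu, forall x, a < x -> g x = h x} -> slobodeckii p g = slobodeckii p h.
Proof.
move=> api mg mh gh; have FF := ae_filter_ringOfSetsType mu.
have mI := measurable_itv `[0%R, (pi *+ 2)%R : R].
have mJ := measurable_itv `[(- pi)%R, pi%R : R].
pose k (g : R -> 'rV[R]_3) (x w : R) := (enorm (g (x + w) - g x) `^ p / `|w| `^ (p - 1))%:E.
have k0 g' x w : (0 <= k g' x w)%E by rewrite lee_fin divr_ge0 ?powR_ge0.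
have msi (g' : R -> 'rV[R]_3) : (forall i, measurable_fun [set: R] (fun x => g' x 0 i)) ->
    measurable_fun I (fun x => \int[mu]_(w in J) k g' x w)%E.
  move=> mg'; apply: measurable_funTS.
  exact: (measurable_integral_ge0 mJ (measurable_slobodeckii p mg') (fun z => k0 g' z.1 z.2)).
apply: ge0_ae_eq_integral; [exact: mI|exact: msi|exact: msi| | |].
- by move=> x _; apply: integral_ge0 => w _; exact: k0.
- by move=> x _; apply: integral_ge0 => w _; exact: k0.
apply: filterS (gh) => x ghx; rewrite /= in_itv/= => /andP[x0 x2].
have gx : g x = h x by apply: ghx; rewrite (lt_le_trans api)// (le_trans _ x0)// oppr_le0 pi_ge0.
pose q (g : R -> 'rV[R]_3) (z : R) := (enorm (g z - g x) `^ p / `|z - x| `^ (p - 1))%:E.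
have q0 g' z : (0 <= q g' z)%E by rewrite lee_fin divr_ge0 ?powR_ge0.
have mq (g' : R -> 'rV[R]_3) : (forall i, measurable_fun [set: R] (fun x => g' x 0 i)) ->
    measurable_fun [set: R] (q g').
  move=> mg'; apply/measurable_EFinP; apply: measurable_funM.
    apply: (measurableT_comp (@measurable_powR R p)); apply: measurable_enorm.
    by apply: measurable_vecB => // i; exact: measurable_cst.
  apply: measurable_inv_ge0; first by move=> z; exact: powR_ge0.
  apply: (measurableT_comp (@measurable_powR R (p - 1))).
  by apply: measurableT_comp => //; exact: measurable_funB.
have qE (g' : R -> 'rV[R]_3) : (forall i, measurable_fun [set: R] (fun x => g' x 0 i)) ->
    (\int[mu]_(w in J) k g' x w = \int[mu]_(z in `[(- pi + x)%R, (pi + x)%R]) q g' z)%E.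
  move=> mg'; apply: esym; apply: (eq_trans (ge0_integral_itv_shift _ _ _ (mq _ mg') (q0 g'))).
  by apply: eq_integral => w _; rewrite /q /k addrK (addrC w).
rewrite (qE g mg) (qE h mh).
apply: ge0_ae_eq_integral; [by []| | | | |].
- by apply: measurable_funTS; exact: mq.
- by apply: measurable_funTS; exact: mq.
- by move=> z _; exact: q0.
- by move=> z _; exact: q0.
apply: filterS gh => z ghz; rewrite /= in_itv/= => /andP[z0 z2].
by rewrite /q gx ghz//; rewrite (lt_le_trans api)// (le_trans _ z0)// lerDl.
Qed.

(** Each coordinate satisfies the fundamental theorem of calculus with its weak derivative, hence
    the affine approximation of Campanato type, hence is C^1. The classical derivative agrees almost
    everywhere with the weak one and inherits its finite seminorm. *)
Lemma sobolev_slobodeckii_C1 (p : R) (Phi : R -> 'rV[R]_3) : 3 < p ->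
  sobolev_slobodeckii p Phi ->
  periodic Phi (pi *+ 2) /\ exists h : R -> 'rV[R]_3,
    [/\ forall x : R, is_derive x 1 Phi (h x), forall i, continuous (fun x => h x 0 i) &
        (slobodeckii p h < +oo)%E].
Proof.
move=> p3 [cPhi [pPhi _ _] [g [[pg mg gLp] wd slob]]]; split=> //.
have p1 : 1 <= p by rewrite (le_trans _ (ltW p3))// ler1n.
have pi2 : 0 < pi *+ 2 :> R by rewrite pmulrn_lgt0// pi_gt0.
have mI := measurable_itv `[0%R, (pi *+ 2)%R : R].
have pgi i : periodic (fun x => g x 0 i) (pi *+ 2) by move=> x; rewrite pg.
have cPhii i : continuous (fun x => Phi x 0 i).
  move=> x; apply: (@continuous_comp _ _ _ Phi (fun M : 'rV[R]_3 => M 0 i)); first exact: cPhi.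
  exact: coord_continuous.
have igI i : mu.-integrable I (EFin \o (fun x => g x 0 i)).
  apply/integrableP; split; first by apply: measurable_funTS; apply/measurable_EFinP; exact: (mg i).
  have mp : measurable_fun [set: R] (fun x => (enorm (g x) `^ p)%:E).
    apply/measurable_EFinP; apply: (measurableT_comp (@measurable_powR R p)).
    exact: measurable_enorm.
  (* On a bounded interval p-integrability gives integrability, by x <= 1 + x^p. *)
  apply: (@le_lt_trans _ _ (\int[mu]_(x in I) (1%:E + (enorm (g x) `^ p)%:E))%E).
    apply: ge0_le_integral; [exact: mI|by []| | |].
    - by apply: measurable_funTS; apply: measurableT_comp => //; apply/measurable_EFinP; exact: (mg i).
    - by apply: measurable_funTS; exact: emeasurable_funD.
    - move=> x _; rewrite -EFinD lee_fin; apply: (le_trans (coord_le_enorm _ _)).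
      by have := le_young p1 (enorm_ge0 (g x)) (@ltr01 R); rewrite powR1 mulr1.
  rewrite ge0_integralD; [|exact: mI|by []|exact: measurable_cst| |exact: measurable_funTS]; last first.
    by move=> x _; rewrite lee_fin powR_ge0.
  by rewrite (integral_itv_cst _ (ltW pi2)) lte_add_pinfty// ltry.
have ig i a b := periodic_integrable a b pi2 (mg i) (pgi i) (igI i).
have wi i : forall x y, x < y -> y < x + pi *+ 2 ->
    (\int[mu]_(z in `[x, y]) (g z 0 i)%:E = (Phi y 0 i - Phi x 0 i)%:E)%E.
  apply: (weak_derivative_integral (cPhii i) _ (mg i) (pgi i) (igI i)).
    by move=> x; rewrite pPhi.
  by move=> phi tphi; exact: wd.
have C1 i : exists hi : R -> R, (forall x : R, is_derive x 1 (fun x => Phi x 0 i) (hi x)) /\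
    continuous hi.
  have [|||||C C0 hC] := @slobodeckii_affine R g p i (fun x => Phi x 0 i) => //.
    by move=> x y xy yx; split; [exact: ig|exact: wi].
  have b0 : 0 < (p - 3) / p by rewrite divr_gt0 ?subr_gt0// (lt_trans _ p3).
  by have [hi h1 h2] := affine_approx_C1 C0 b0 hC; exists hi.
have {C1}[h hP] := choice C1.
pose H x := \row_i h i x : 'rV[R]_3.
have HE i x : H x 0 i = h i x by rewrite mxE.
have cH i : continuous (fun x => H x 0 i).
  by under eq_fun do rewrite HE; exact: (hP i).2.
exists H; split; [|exact: cH|].
  by move=> x; apply: is_derive_rV => i; rewrite HE; exact: (hP i).1.
suff <- : slobodeckii p g = slobodeckii p H by exact: slob.
apply: (@slobodeckii_ae p (- (pi *+ 2)) g H _ mg).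
- by rewrite ltrN2 mulr2n ltrDl pi_gt0.
- by move=> i; exact: (continuous_measurable_fun (@cH i)).
have ae i : {ae mu, forall x, - (pi *+ 2) < x -> g x 0 i = h i x}.
  apply: (ae_eq_derivative _ (mg i) (ig i) _ (hP i).1).
  exact: (integral_additive_extend pi2 (ig i) (wi i)).
have FF := ae_filter_ringOfSetsType mu.
have A := ae 0; have B := ae 1; have C := ae 2%:R.
apply: filterS3 A B C => x a b c xpi.
by apply: eq_rV3; rewrite HE; [exact: a|exact: b|exact: c].
Qed.

End SobolevDirections.

(** As p >= 2, the lower bound 1 - 2/p is nonnegative, so alpha > 0 and the Hoelder condition makes
    the derivative continuous. *)
Lemma holder_C1_regular (R : realType) (p alpha : R) (Phi : R -> 'rV[R]_3) : 2 <= p ->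
  1 - 2 / p < alpha -> holder_C1 alpha Phi ->
  periodic Phi (pi *+ 2) /\ exists h : R -> 'rV[R]_3,
    [/\ forall x : R, is_derive x 1 Phi (h x), forall i, continuous (fun x => h x 0 i) &
        (slobodeckii p h < +oo)%E].
Proof.
move=> p2 ha [pPhi dPhi [C hC]]; split=> //.
have p0 : 0 < p by exact: lt_le_trans p2.
have a0 : 0 < alpha.
  by apply: le_lt_trans ha; rewrite subr_ge0 ler_pdivrMr// mul1r.
have ch i : continuous (fun x => derive1 Phi x 0 i).
  apply: (@holder_continuous R _ C alpha a0) => x y.
  apply: (le_trans _ (hC x y)); apply: (le_trans _ (coord_le_enorm _ i)).
  by rewrite !mxE.
exists (derive1 Phi); split.
- by move=> x; apply: DeriveDef; [exact: dPhi|rewrite derive1E].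
- exact: ch.
- by apply: (holder_slobodeckii _ ha ch hC); rewrite (lt_le_trans _ p2)// ltr1n.
Qed.


Theorem theorem2p38 (R : realType) (m u v : 'rV[R]_3) (r : R) (hr : 0 < r)
  (huu : dot u u = 1) (hvv : dot v v = 1) (huv : dot u v = 0) :
  (forall p alpha : R, 2 <= p ->
     (p <= 3 -> 1 - 2 / p < alpha /\ alpha <= 1) ->
     stationary (scaled_energy p) (admissible p alpha) (circle m u v r)) /\
  (forall alpha : R, 1 - 2 / 3 < alpha -> alpha <= 1 ->
     stationary (menger_energy 3) (admissible 3 alpha) (circle m u v r)).

Proof.
(* Both kinds of admissible directions provide the same data: a periodic C^1 field whose derivative
   has finite Slobodeckii seminorm, which is all that the variation lemmas ask of [Phi]. *)
have regular p alpha Phi : 2 <= p -> (p <= 3 -> 1 - 2 / p < alpha) -> admissible p alpha Phi ->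
    periodic Phi (pi *+ 2) /\ exists h : R -> 'rV[R]_3,
    [/\ forall x : R, is_derive x 1 Phi (h x), forall i, continuous (fun x => h x 0 i) &
        (slobodeckii p h < +oo)%E].
  move=> p2 ha; rewrite /admissible; case: ifPn => [p3|]; first exact: sobolev_slobodeckii_C1.
  by rewrite -leNgt => /ha; exact: holder_C1_regular.
split=> [p alpha p2 ha|alpha ha _] Phi XPhi.
- have [pPhi [h [dPhi ch slob]]] := regular _ _ _ p2 (fun p3 => (ha p3).1) XPhi.
  exact: (circle_scaled_energy_variation m hr huu hvv huv p2 dPhi ch pPhi slob).
- have p2 : 2 <= 3 :> R by rewrite ler_nat.
  have [pPhi [h [dPhi ch slob]]] := regular _ _ _ p2 (fun _ => ha) XPhi.
  exact: (circle_energy_variation m hr huu hvv huv p2 dPhi ch pPhi slob).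
Qed.
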